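(* Let $0<q<1$ and let $(C^\infty(SU_q(2)),\mathcal H,\mathcal D)$ be the spectral triple for $SU_q(2)$ constructed by Dąbrowski, Landi, Sitarz, van Suijlekom and Várilly. Then the cochain $\phi_3$ of the local index formula vanishes identically, i.e. $\phi_3(a^0da^1da^2da^3)=0$ for all $a^0,a^1,a^2,a^3\in C^\infty(SU_q(2))$.
   Context: The cochain $\phi_3$: with $|\mathcal D|=\sqrt{\mathcal D^2}$ and $\tau_k(b|\mathcal D|^y)=\mathrm{Res}_{z=0}\,z^k\,\mathrm{Trace}(b|\mathcal D|^{y-2z})$ (via meromorphic continuation), $$\phi_3(a^0da^1da^2da^3)=\tfrac1{12}\tau_0\big(a^0[\mathcal D,a^1][\mathcal D,a^2][\mathcal D,a^3]|\mathcal D|^{-3}\big)-\tfrac16\tau_1\big(a^0[\mathcal D,a^1][\mathcal D,a^2][\mathcal D,a^3]|\mathcal D|^{-3}\big).$$ The dimension spectrum of this triple is simple, so the $\tau_1$ term is zero and $\phi_3$ is given by the $\tau_0$ term. Here $a^0da^1da^2da^3$ denotes an element of $\Omega^3(\mathcal A)=\mathcal A\otimes(\mathcal A/\mathbb C1)^{\otimes3}$, $\mathcal A=C^\infty(SU_q(2))$. The Hilbert space: for half-integers write $j^\pm=j\pm\frac12$, $\mu^\pm=\mu\pm\frac12$, $n^\pm=n\pm\frac12$. $\mathcal H$ has orthonormal basis $|j\mu n\uparrow\rangle$ for $j=0,\frac12,1,\dots$, $\mu=-j,\dots,j$, $n=-j^+,\dots,j^+$, together with $|j\mu n\downarrow\rangle$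 for $j=\frac12,1,\dots$, $\mu=-j,\dots,j$, $n=-j^-,\dots,j^-$ (steps of $1$). Vectors with indices outside these ranges are $0$. The Dirac operator: $\mathcal D|j\mu n\uparrow\rangle=(2j+\frac32)|j\mu n\uparrow\rangle$, $\mathcal D|j\mu n\downarrow\rangle=-(2j+\frac12)|j\mu n\downarrow\rangle$. The algebra: $C^\infty(SU_q(2))$ is the pre-$C^*$-algebra generated by elements $a,b$ with $ba=qab$, $b^*a=qab^*$, $bb^*=b^*b$, $a^*a+q^2b^*b=1$, $aa^*+bb^*=1$ (in the notation with generators $\alpha,\beta$ satisfying $\alpha^*\alpha+\beta^*\beta=1$, $\alpha\alpha^*+q^2\beta\beta^*=1$, $\alpha\beta=q\beta\alpha$, $\alpha\beta^*=q\beta^*\alpha$, $\beta\beta^*=\beta^*\beta$, take $\alpha=a^*$, $\beta=b$). The representation: with $[x]=(q^{-x}-q^x)/(q^{-1}-q)$, $\kappa=q^{(\mu+n-\frac12)/2}$, one has $a=a_++a_-$, $b=b_++b_-$ with $$a_+|j\mu n\uparrow\rangle=\kappa[j+\mu+1]^{\frac12}\Big(q^{-j-\frac12}\tfrac{[j+n+\frac32]^{1/2}}{[2j+2]}|j^+\mu^+n^+\uparrow\rangle+q^{\frac12}\tfrac{[j-n+\frac12]^{1/2}}{[2j+1][2j+2]}|j^+\mu^+n^+\downarrow\rangle\Big),$$ $$a_+|j\mu n\downarrow\rangle=\kappa[j+\mu+1]^{\frac12}q^{-j}\tfrac{[j+n+\frac12]^{1/2}}{[2j+1]}|j^+\mu^+n^+\downarrow\rangle,$$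 $$a_-|j\mu n\uparrow\rangle=\kappa[j-\mu]^{\frac12}q^{j+1}\tfrac{[j-n+\frac12]^{1/2}}{[2j+1]}|j^-\mu^+n^+\uparrow\rangle,$$ $$a_-|j\mu n\downarrow\rangle=\kappa[j-\mu]^{\frac12}\Big(-q^{\frac12}\tfrac{[j+n+\frac12]^{1/2}}{[2j][2j+1]}|j^-\mu^+n^+\uparrow\rangle+q^{j+\frac12}\tfrac{[j-n-\frac12]^{1/2}}{[2j]}|j^-\mu^+n^+\downarrow\rangle\Big),$$ $$b_+|j\mu n\uparrow\rangle=\kappa[j+\mu+1]^{\frac12}\Big(\tfrac{[j-n+\frac32]^{1/2}}{[2j+2]}|j^+\mu^+n^-\uparrow\rangle-q^{-j-1}\tfrac{[j+n+\frac12]^{1/2}}{[2j+1][2j+2]}|j^+\mu^+n^-\downarrow\rangle\Big),$$ $$b_+|j\mu n\downarrow\rangle=\kappa[j+\mu+1]^{\frac12}q^{-\frac12}\tfrac{[j-n+\frac12]^{1/2}}{[2j+1]}|j^+\mu^+n^-\downarrow\rangle,$$ $$b_-|j\mu n\uparrow\rangle=-\kappa[j-\mu]^{\frac12}q^{-\frac12}\tfrac{[j+n+\frac12]^{1/2}}{[2j+1]}|j^-\mu^+n^-\uparrow\rangle,$$ $$b_-|j\mu n\downarrow\rangle=\kappa[j-\mu]^{\frac12}\Big(-q^{j}\tfrac{[j-n+\frac12]^{1/2}}{[2j][2j+1]}|j^-\mu^+n^-\uparrow\rangle-\tfrac{[j+n-\frac12]^{1/2}}{[2j]}|j^-\mu^+n^-\downarrow\rangle\Big).$$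 *)

(* Defs.v *)
From Stdlib Require Import Reals ZArith List Lra Lia FunctionalExtensionality
  ProofIrrelevance.
From Coquelicot Require Import Coquelicot.

Import ListNotations.
Set Implicit Arguments.
Unset Strict Implicit.
Unset Printing Implicit Defensive.

Open Scope R_scope.

Definition lsum {G : AbelianMonoid} {I : Type} (f : I -> G) (l : list I) : G :=
  fold_right (fun i s => plus (f i) s) zero l.

(** The filter of the net of finite subsets of [I], directed by inclusion. *)
Definition finsets {I : Type} (P : list I -> Prop) : Prop :=
  exists l0, forall l, NoDup l -> incl l0 l -> P l.

Definition is_sum {I : Type} (f : I -> C) (s : C) : Prop :=
  filterlim (lsum f) finsets (@locally C_UniformSpace s).

(** The value of the sum; meaningful for summable families only. *)
Definition Csum {I : Type} (f : I -> C) : C :=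
  @lim C_CompleteNormedModule (filtermap (lsum f) finsets).

Definition sumsq {I : Type} (x : I -> C) (l : list I) : R :=
  lsum (fun i => Cmod (x i) ^ 2) l.

Definition square_summable {I : Type} (x : I -> C) : Prop :=
  exists M, forall l, NoDup l -> sumsq x l <= M.

Definition ell2 (I : Type) : Type := {x : I -> C | square_summable x}.

Definition coord {I : Type} (x : ell2 I) : I -> C := proj1_sig x.

Lemma ell2_eq {I : Type} (x y : ell2 I) :
  (forall i, coord x i = coord y i) -> x = y.
Proof.
destruct x as [x Hx], y as [y Hy]; simpl; intro H.
assert (E : x = y) by (apply functional_extensionality; exact H).
subst y; f_equal; apply proof_irrelevance.
Qed.

Lemma sumsq_nil {I : Type} (x : I -> C) : sumsq x nil = 0.
Proof. reflexivity. Qed.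

Lemma sumsq_cons {I : Type} (x : I -> C) i l :
  sumsq x (i :: l) = Cmod (x i) ^ 2 + sumsq x l.
Proof. reflexivity. Qed.

Lemma sumsq_plus {I : Type} (x y : I -> C) l :
  sumsq (fun i => x i + y i)%C l <= 2 * sumsq x l + 2 * sumsq y l.
Proof.
induction l as [|i l IH]; [rewrite !sumsq_nil; lra|].
rewrite !sumsq_cons.
generalize (Cmod_triangle (x i) (y i)) (Cmod_ge_0 (x i + y i)%C)
  (Cmod_ge_0 (x i)) (Cmod_ge_0 (y i)) (pow2_ge_0 (Cmod (x i) - Cmod (y i))).
intros; nra.
Qed.

Lemma sumsq_scal {I : Type} (c : C) (x : I -> C) l :
  sumsq (fun i => c * x i)%C l = Cmod c ^ 2 * sumsq x l.
Proof.
induction l as [|i l IH]; [rewrite !sumsq_nil; ring|].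
rewrite !sumsq_cons, IH, Cmod_mult; ring.
Qed.

Lemma square_summable_plus {I : Type} (x y : ell2 I) :
  square_summable (fun i => coord x i + coord y i)%C.
Proof.
destruct (proj2_sig x) as [M HM], (proj2_sig y) as [N HN].
exists (2 * M + 2 * N); intros l Hl.
generalize (sumsq_plus (coord x) (coord y) l) (HM l Hl) (HN l Hl).
unfold coord; lra.
Qed.

Lemma square_summable_scal {I : Type} (c : C) (x : ell2 I) :
  square_summable (fun i => c * coord x i)%C.
Proof.
destruct (proj2_sig x) as [M HM]; exists (Cmod c ^ 2 * M); intros l Hl.
rewrite sumsq_scal; apply Rmult_le_compat_l; [apply pow2_ge_0|exact (HM l Hl)].
Qed.

Lemma square_summable_0 {I : Type} : square_summable (fun _ : I => RtoC 0).
Proof.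
exists 0; intros l _; induction l as [|i l IH]; [rewrite sumsq_nil; lra|].
rewrite sumsq_cons, Cmod_0; lra.
Qed.

Definition ell2_plus {I : Type} (x y : ell2 I) : ell2 I :=
  exist _ _ (square_summable_plus x y).

Definition ell2_scal {I : Type} (c : C) (x : ell2 I) : ell2 I :=
  exist _ _ (square_summable_scal c x).

Definition ell2_opp {I : Type} (x : ell2 I) : ell2 I :=
  ell2_scal (RtoC (-1)) x.

Definition ell2_zero {I : Type} : ell2 I := exist _ _ (@square_summable_0 I).

Section Ell2Module.
Context {I : Type}.

Lemma ell2_plus_comm (x y : ell2 I) : ell2_plus x y = ell2_plus y x.
Proof. apply ell2_eq; intro i; simpl; ring. Qed.

Lemma ell2_plus_assoc (x y z : ell2 I) :
  ell2_plus x (ell2_plus y z) = ell2_plus (ell2_plus x y) z.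
Proof. apply ell2_eq; intro i; simpl; ring. Qed.

Lemma ell2_plus_zero_r (x : ell2 I) : ell2_plus x ell2_zero = x.
Proof. apply ell2_eq; intro i; simpl; ring. Qed.

Lemma ell2_plus_opp_r (x : ell2 I) : ell2_plus x (ell2_opp x) = ell2_zero.
Proof. apply ell2_eq; intro i; simpl; ring. Qed.

Definition ell2_AbelianMonoid_mixin :=
  AbelianMonoid.Mixin (ell2 I) ell2_plus ell2_zero
    ell2_plus_comm ell2_plus_assoc ell2_plus_zero_r.

Canonical ell2_AbelianMonoid :=
  AbelianMonoid.Pack (ell2 I) ell2_AbelianMonoid_mixin (ell2 I).

Definition ell2_AbelianGroup_mixin :=
  AbelianGroup.Mixin ell2_AbelianMonoid ell2_opp ell2_plus_opp_r.

Canonical ell2_AbelianGroup :=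
  AbelianGroup.Pack (ell2 I)
    (AbelianGroup.Class _ ell2_AbelianMonoid_mixin ell2_AbelianGroup_mixin)
    (ell2 I).

Lemma ell2_scal_assoc (c d : C_Ring) (x : ell2 I) :
  ell2_scal c (ell2_scal d x) = ell2_scal (mult c d) x.
Proof. apply ell2_eq; intro i; simpl; unfold mult; simpl; ring. Qed.

Lemma ell2_scal_one (x : ell2 I) : ell2_scal (@one C_Ring) x = x.
Proof. apply ell2_eq; intro i; simpl; unfold one; simpl; ring. Qed.

Lemma ell2_scal_distr_l (c : C_Ring) (x y : ell2 I) :
  ell2_scal c (plus x y) = plus (ell2_scal c x) (ell2_scal c y).
Proof. apply ell2_eq; intro i; simpl; ring. Qed.

Lemma ell2_scal_distr_r (c d : C_Ring) (x : ell2 I) :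
  ell2_scal (plus c d) x = plus (ell2_scal c x) (ell2_scal d x).
Proof. apply ell2_eq; intro i; simpl; unfold plus; simpl; ring. Qed.

Definition ell2_ModuleSpace_mixin :=
  ModuleSpace.Mixin C_Ring ell2_AbelianGroup ell2_scal
    ell2_scal_assoc ell2_scal_one ell2_scal_distr_l ell2_scal_distr_r.

Canonical ell2_ModuleSpace :=
  ModuleSpace.Pack C_Ring (ell2 I)
    (ModuleSpace.Class C_Ring _ _ ell2_ModuleSpace_mixin) (ell2 I).

End Ell2Module.

(** Conjugate-linear in the first variable. *)
Definition inner {I : Type} (x y : ell2 I) : C :=
  Csum (fun i => Cconj (coord x i) * coord y i)%C.

Definition hnorm {I : Type} (x : ell2 I) : R :=
  sqrt (real (Lub_Rbar
    (fun s => exists l, NoDup l /\ s = sumsq (coord x) l))).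

Lemma hnorm_ge0 {I : Type} (x : ell2 I) : 0 <= hnorm x.
Proof. apply sqrt_pos. Qed.

Lemma sumsq_lub {I : Type} (x : ell2 I) :
  is_lub_Rbar (fun s => exists l, NoDup l /\ s = sumsq (coord x) l)
    (Finite (hnorm x ^ 2)).
Proof.
set (E := fun s => exists l, NoDup l /\ s = sumsq (coord x) l).
generalize (Lub_Rbar_correct E); intro HL.
destruct (proj2_sig x) as [M HM].
assert (H0 : Rbar_le (Finite 0) (Lub_Rbar E)).
{ apply (proj1 HL); exists nil; split; [apply NoDup_nil|reflexivity]. }
assert (H1 : Rbar_le (Lub_Rbar E) (Finite M)).
{ apply (proj2 HL); intros s [l [Hl ->]]; exact (HM l Hl). }
unfold hnorm; fold E; destruct (Lub_Rbar E) as [r| |]; simpl in H0, H1.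
- rewrite pow2_sqrt; [exact HL|exact H0].
- contradiction.
- contradiction.
Qed.

Lemma sumsq_le_hnorm {I : Type} (x : ell2 I) l :
  NoDup l -> sumsq (coord x) l <= hnorm x ^ 2.
Proof. intro Hl; apply (proj1 (sumsq_lub x)); exists l; split; trivial. Qed.

Lemma hnorm_le {I : Type} (x : ell2 I) B :
  0 <= B -> (forall l, NoDup l -> sumsq (coord x) l <= B ^ 2) -> hnorm x <= B.
Proof.
intros HB H.
assert (E : Rbar_le (Finite (hnorm x ^ 2)) (Finite (B ^ 2))).
{ apply (proj2 (sumsq_lub x)); intros s [l [Hl ->]]; exact (H l Hl). }
simpl in E; generalize (hnorm_ge0 x); intro; nra.
Qed.

Record bounded_op (I : Type) := BoundedOp {
  op_fun :> ell2 I -> ell2 I;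
  op_plus : forall x y, op_fun (plus x y) = plus (op_fun x) (op_fun y);
  op_scal : forall (c : C) x, op_fun (scal c x) = scal c (op_fun x);
  op_bounded : exists M, forall x, hnorm (op_fun x) <= M * hnorm x }.

Section Operators.
Context {I : Type}.
Implicit Types (T X : bounded_op I) (x y : ell2 I).

Lemma op_bounded_pos T :
  exists M, 0 <= M /\ forall x, hnorm (T x) <= M * hnorm x.
Proof.
destruct (op_bounded T) as [M HM]; exists (Rmax M 0); split; [apply Rmax_r|].
intro x; apply Rle_trans with (1 := HM x).
apply Rmult_le_compat_r; [apply hnorm_ge0|apply Rmax_l].
Qed.

Lemma one_bounded : exists M, forall x, hnorm x <= M * hnorm x.
Proof. exists 1; intro x; lra. Qed.

Definition one_op : bounded_op I :=
  @BoundedOp I (fun x => x) (fun _ _ => eq_refl) (fun _ _ => eq_refl) one_bounded.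

Lemma add_op_plus T X x y :
  plus (T (plus x y)) (X (plus x y)) = plus (plus (T x) (X x)) (plus (T y) (X y)).
Proof. rewrite !op_plus; apply ell2_eq; intro i; simpl; ring. Qed.

Lemma add_op_scal T X (c : C) x :
  plus (T (scal c x)) (X (scal c x)) = scal c (plus (T x) (X x)).
Proof. rewrite !op_scal; apply ell2_eq; intro i; simpl; ring. Qed.

Lemma add_op_bounded T X :
  exists M, forall x, hnorm (plus (T x) (X x)) <= M * hnorm x.
Proof.
destruct (op_bounded_pos T) as [M [HM0 HM]].
destruct (op_bounded_pos X) as [N [HN0 HN]].
exists (2 * M + 2 * N); intro x; generalize (hnorm_ge0 x); intro Hx.
apply hnorm_le; [apply Rmult_le_pos; lra|intros l Hl].
generalize (sumsq_plus (coord (T x)) (coord (X x)) l)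
  (sumsq_le_hnorm (T x) Hl) (sumsq_le_hnorm (X x) Hl); intros H1 H2 H3.
apply Rle_trans with (1 := H1).
assert (H4 : hnorm (T x) ^ 2 <= (M * hnorm x) ^ 2)
  by (apply pow_incr; split; [apply hnorm_ge0|apply HM]).
assert (H5 : hnorm (X x) ^ 2 <= (N * hnorm x) ^ 2)
  by (apply pow_incr; split; [apply hnorm_ge0|apply HN]).
assert (H6 : 0 <= M * hnorm x) by (apply Rmult_le_pos; lra).
assert (H7 : 0 <= N * hnorm x) by (apply Rmult_le_pos; lra).
nra.
Qed.

Definition add_op T X : bounded_op I :=
  @BoundedOp I (fun x => plus (T x) (X x))
    (add_op_plus T X) (add_op_scal T X) (add_op_bounded T X).

Lemma scal_op_plus (c : C) T x y :
  scal c (T (plus x y)) = plus (scal c (T x)) (scal c (T y)).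
Proof. rewrite op_plus; apply ell2_eq; intro i; simpl; ring. Qed.

Lemma scal_op_scal (c : C) T (d : C) x :
  scal c (T (scal d x)) = scal d (scal c (T x)).
Proof. rewrite op_scal; apply ell2_eq; intro i; simpl; ring. Qed.

Lemma scal_op_bounded (c : C) T :
  exists M, forall x, hnorm (scal c (T x)) <= M * hnorm x.
Proof.
destruct (op_bounded_pos T) as [M [HM0 HM]].
exists (Cmod c * M); intro x; generalize (hnorm_ge0 x) (Cmod_ge_0 c); intros.
apply hnorm_le; [apply Rmult_le_pos; [apply Rmult_le_pos|]; lra|intros l Hl].
change (sumsq (fun i => c * coord (T x) i)%C l <= (Cmod c * M * hnorm x) ^ 2).
rewrite sumsq_scal.
replace ((Cmod c * M * hnorm x) ^ 2)
  with (Cmod c ^ 2 * (M * hnorm x) ^ 2) by ring.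
apply Rmult_le_compat_l; [apply pow2_ge_0|].
apply Rle_trans with (1 := sumsq_le_hnorm (T x) Hl).
apply pow_incr; split; [apply hnorm_ge0|apply HM].
Qed.

Definition scal_op (c : C) T : bounded_op I :=
  @BoundedOp I (fun x => scal c (T x))
    (scal_op_plus c T) (scal_op_scal c T) (scal_op_bounded c T).

Lemma mul_op_plus T X x y : T (X (plus x y)) = plus (T (X x)) (T (X y)).
Proof. rewrite !op_plus; reflexivity. Qed.

Lemma mul_op_scal T X (c : C) x : T (X (scal c x)) = scal c (T (X x)).
Proof. rewrite !op_scal; reflexivity. Qed.

Lemma mul_op_bounded T X :
  exists M, forall x, hnorm (T (X x)) <= M * hnorm x.
Proof.
destruct (op_bounded_pos T) as [M [HM0 HM]].
destruct (op_bounded_pos X) as [N [HN0 HN]].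
exists (M * N); intro x; apply Rle_trans with (1 := HM (X x)).
rewrite Rmult_assoc; apply Rmult_le_compat_l; trivial.
Qed.

Definition mul_op T X : bounded_op I :=
  @BoundedOp I (fun x => T (X x))
    (mul_op_plus T X) (mul_op_scal T X) (mul_op_bounded T X).

Definition is_adjoint T X : Prop :=
  forall x y, inner (X x) y = inner x (T y).

Definition is_inverse T X : Prop :=
  mul_op T X = one_op /\ mul_op X T = one_op.

Definition shift_op (l : C) T : bounded_op I :=
  add_op (scal_op l one_op) (scal_op (RtoC (-1)) T).

Definition spectrum T (l : C) : Prop :=
  ~ exists X, is_inverse (shift_op l T) X.

End Operators.

Definition holomorphic_at (f : C -> C) (z : C) : Prop :=
  @ex_derive C_AbsRing C_NormedModule f z.

(** Closed C^1 paths on [0,1]. A piecewise C^1 closed path can be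
    reparametrized into this form by letting it stop at its corners. *)
Record loop := Loop {
  path : R -> C;
  velocity : R -> C;
  path_derive : forall t, 0 <= t <= 1 ->
    @is_derive R_AbsRing C_R_NormedModule path t (velocity t);
  velocity_continuous : forall t, 0 <= t <= 1 ->
    @continuous R_UniformSpace C_UniformSpace velocity t;
  path_closed : path 0 = path 1 }.

Definition cycle : Type := list loop.

Definition on_cycle (G : cycle) (l : C) : Prop :=
  exists g t, In g G /\ 0 <= t <= 1 /\ path g t = l.

Definition cycle_int (G : cycle) (h : C -> C) : C :=
  @lsum C_AbelianMonoid loop
    (fun g => @RInt C_R_CompleteNormedModule
       (fun t => (h (path g t) * velocity g t)%C) 0 1) G.

Definition two_pi_i : C := (0, 2 * PI).

Definition winding (G : cycle) (w : C) : C :=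
  (cycle_int G (fun l => / (l - w)) / two_pi_i)%C.

(** [X = f(T)] for [f] holomorphic on an open neighbourhood [U] of the spectrum
    of [T], by the Cauchy integral
    [f(T) = (2 pi i)^-1 \int_G f(l) (l - T)^-1 dl] (in the weak sense) along a
    cycle [G] in [U] surrounding the spectrum. *)
Definition is_hfc {I : Type} (f : C -> C) (T X : bounded_op I) : Prop :=
  exists (U : C -> Prop) (G : cycle) (res : C -> bounded_op I),
    @open C_UniformSpace U /\
    (forall l, spectrum T l -> U l) /\
    (forall l, U l -> holomorphic_at f l) /\
    (forall l, on_cycle G l -> U l /\ is_inverse (shift_op l T) (res l)) /\
    (forall w, spectrum T w -> winding G w = 1) /\
    (forall w, ~ U w -> winding G w = 0) /\
    (forall x y, inner x (X y) =
       (cycle_int G (fun l => f l * inner x (res l y)) / two_pi_i)%C).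

(** A unital *-subalgebra of B(l^2(I)), stable under the holomorphic functional
    calculus; by spectral permanence it does not matter whether spectra and
    resolvents are taken in B(l^2(I)) or in the norm closure of [S]. *)
Record pre_Cstar_algebra {I : Type} (S : bounded_op I -> Prop) : Prop := {
  pre_Cstar_one : S one_op;
  pre_Cstar_add : forall T X, S T -> S X -> S (add_op T X);
  pre_Cstar_scal : forall c T, S T -> S (scal_op c T);
  pre_Cstar_mul : forall T X, S T -> S X -> S (mul_op T X);
  pre_Cstar_adjoint : forall T X, S T -> is_adjoint T X -> S X;
  pre_Cstar_hfc : forall f T X, S T -> is_hfc f T X -> S X }.

Definition pre_Cstar_generated {I : Type} (a b T : bounded_op I) : Prop :=
  forall S : bounded_op I -> Prop, pre_Cstar_algebra S -> S a -> S b -> S T.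

Section Basis.
Context {I : Type} (I_dec : forall i j : I, {i = j} + {i <> j}).

Definition delta (P : I -> bool) (i : I) : C := if P i then RtoC 1 else RtoC 0.

Lemma delta_summable (P : I -> bool) :
  (forall i j, P i = true -> P j = true -> i = j) ->
  square_summable (delta P).
Proof.
intro HP; exists 1; intros l Hl.
cut (sumsq (delta P) l <= 1 /\
     ((forall i, In i l -> P i = false) -> sumsq (delta P) l = 0));
  [intros [H _]; exact H|].
induction Hl as [|i l Hi Hl [IH1 IH2]].
- rewrite sumsq_nil; split; [lra|trivial].
- rewrite sumsq_cons; unfold delta at 1 3; destruct (P i) eqn:E.
  + assert (H : forall j, In j l -> P j = false).
    { intros j Hj; destruct (P j) eqn:Ej; trivial.
      exfalso; apply Hi; rewrite (HP i j E Ej); exact Hj. }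
    rewrite (IH2 H), Cmod_1; split; [lra|].
    intro H'; rewrite (H' i (or_introl eq_refl)) in E; discriminate.
  + rewrite Cmod_0; split; [lra|].
    intro H; rewrite IH2; [lra|intros j Hj; apply H; right; exact Hj].
Qed.

Lemma dec_unique (i j k : I) :
  (if I_dec j i then true else false) = true ->
  (if I_dec k i then true else false) = true -> j = k.
Proof. destruct (I_dec j i), (I_dec k i); congruence. Qed.

Definition basis_vector (i : I) : ell2 I :=
  exist _ (delta (fun j => if I_dec j i then true else false))
    (delta_summable (dec_unique (i := i))).

Definition hilbert_schmidt (T : bounded_op I) : Prop :=
  exists M, forall l, NoDup l ->
    lsum (fun i => hnorm (T (basis_vector i)) ^ 2) l <= M.

Definition trace_class (T : bounded_op I) : Prop :=
  exists A B, hilbert_schmidt A /\ hilbert_schmidt B /\ T = mul_op A B.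

Definition is_trace (T : bounded_op I) (v : C) : Prop :=
  trace_class T /\
  is_sum (fun i => inner (basis_vector i) (T (basis_vector i))) v.

End Basis.

Definition meromorphic_on (V : C -> Prop) (g : C -> C) : Prop :=
  forall z0, V z0 -> exists (n : nat) (h : C -> C),
    @locally C_UniformSpace z0 (holomorphic_at h) /\
    @locally' C_UniformSpace z0 (fun z => (g z * (z - z0) ^ n = h z)%C).

(** [v] is the coefficient of [(z - z0)^-1] in the Laurent expansion of [g]. *)
Definition is_residue (g : C -> C) (z0 v : C) : Prop :=
  exists (n : nat) (c : nat -> C) (h : C -> C),
    @locally C_UniformSpace z0 (holomorphic_at h) /\
    @locally' C_UniformSpace z0 (fun z =>
      g z = (h z + @sum_n C_AbelianMonoid
                     (fun m => c m / (z - z0) ^ (S m)) n)%C) /\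
    c 0%nat = v.

Definition cpow (r : R) (w : C) : C :=
  (exp (Re w * ln r) * cos (Im w * ln r), exp (Re w * ln r) * sin (Im w * ln r)).

Inductive spin := up | down.

(** The label (j, mu, n, spin), with the half-integers doubled. *)
Record label := Label { twoj : Z; twomu : Z; twon : Z; spin_of : spin }.

Definition valid (k : label) : bool :=
  match k with
  | Label J M N up =>
      ((0 <=? J) && (Z.abs M <=? J) && Z.even (J - M)
       && (Z.abs N <=? J + 1) && Z.even (J + 1 - N))%Z%bool
  | Label J M N down =>
      ((1 <=? J) && (Z.abs M <=? J) && Z.even (J - M)
       && (Z.abs N <=? J - 1) && Z.even (J - 1 - N))%Z%bool
  end.

Definition spinor_index : Type := {k : label | valid k = true}.

Definition label_dec (k l : label) : {k = l} + {k <> l}.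
Proof. repeat decide equality. Defined.

Lemma spinor_index_eq (i j : spinor_index) : proj1_sig i = proj1_sig j -> i = j.
Proof.
destruct i as [k Hk], j as [l Hl]; simpl; intro E; subst l.
f_equal; apply proof_irrelevance.
Qed.

Definition spinor_index_dec (i j : spinor_index) : {i = j} + {i <> j}.
Proof.
destruct (label_dec (proj1_sig i) (proj1_sig j)) as [E|E].
- left; apply spinor_index_eq; exact E.
- right; intro H; apply E; rewrite H; reflexivity.
Defined.

Definition spinor_space : Type := ell2 spinor_index.

Lemma label_unique (k : label) (i j : spinor_index) :
  (if label_dec (proj1_sig i) k then true else false) = true ->
  (if label_dec (proj1_sig j) k then true else false) = true -> i = j.
Proof.
destruct (label_dec (proj1_sig i) k), (label_dec (proj1_sig j) k);
  try discriminate; intros _ _; apply spinor_index_eq; congruence.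
Qed.

(** The vector |j mu n spin>; it is 0 when the label is not valid. *)
Definition ket (J M N : Z) (s : spin) : spinor_space :=
  exist _
    (delta (fun i : spinor_index =>
       if label_dec (proj1_sig i) (Label J M N s) then true else false))
    (delta_summable (label_unique (k := Label J M N s))).

Definition dirac_eigenvalue (i : spinor_index) : R :=
  match proj1_sig i with
  | Label J _ _ up => IZR J + 3 / 2
  | Label J _ _ down => - (IZR J + 1 / 2)
  end.

(** [dirac x y] means that [x] is in the domain of D and [D x = y]. *)
Definition dirac (x y : spinor_space) : Prop :=
  forall i, coord y i = (RtoC (dirac_eigenvalue i) * coord x i)%C.

(** The graph of |D|^w, with |D| = sqrt (D^2). *)
Definition abs_dirac_pow (w : C) (x y : spinor_space) : Prop :=
  forall i, coord y i = (cpow (sqrt (dirac_eigenvalue i ^ 2)) w * coord x i)%C.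

(** [X] is the bounded extension of [D, T], where T preserves the domain of D. *)
Definition is_commutator (T X : bounded_op spinor_index) : Prop :=
  forall x y, dirac x y -> exists z, dirac (T x) z /\ X x = minus z (T y).

(** [X] is the bounded extension of [T |D|^w]. *)
Definition is_mul_abs_dirac_pow (T : bounded_op spinor_index) (w : C)
    (X : bounded_op spinor_index) : Prop :=
  forall x y, abs_dirac_pow w x y -> X x = T y.

Section SpinorRepresentation.
Context (q : R).

Definition qnum (x : R) : R :=
  (Rpower q (- x) - Rpower q x) / (/ q - q).

Local Notation "[ x ]" := (qnum x).
Local Notation "c ** v" := (@scal C_Ring ell2_ModuleSpace (RtoC c) v)
  (at level 40).
Local Notation "v ++ w" := (plus v w).
Local Notation q_ := (Rpower q).

(** [a = a_+ + a_-] and [b = b_+ + b_-] on the basis vectors, which determines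
    these bounded operators; [J], [M], [N] are 2j, 2mu, 2n. The relations
    [ba = q ab], [b^*a = q ab^*], [bb^* = b^*b], [a^*a + q^2 b^*b = 1] and
    [aa^* + bb^* = 1] are consequences of these formulas. *)
Definition acts_as_a (a : bounded_op spinor_index) : Prop :=
  forall J M N,
  let j := IZR J / 2 in let mu := IZR M / 2 in let n := IZR N / 2 in
  let kappa := q_ ((mu + n - 1 / 2) / 2) in
  (valid (Label J M N up) = true ->
   a (ket J M N up) =
     (kappa * sqrt [j + mu + 1]) **
       ((q_ (- j - 1 / 2) * (sqrt [j + n + 3 / 2] / [2 * j + 2])) **
          ket (J + 1) (M + 1) (N + 1) up ++
        (q_ (1 / 2) * (sqrt [j - n + 1 / 2] / ([2 * j + 1] * [2 * j + 2]))) **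
          ket (J + 1) (M + 1) (N + 1) down) ++
     (kappa * sqrt [j - mu] * q_ (j + 1)
        * (sqrt [j - n + 1 / 2] / [2 * j + 1])) **
       ket (J - 1) (M + 1) (N + 1) up) /\
  (valid (Label J M N down) = true ->
   a (ket J M N down) =
     (kappa * sqrt [j + mu + 1] * q_ (- j)
        * (sqrt [j + n + 1 / 2] / [2 * j + 1])) **
       ket (J + 1) (M + 1) (N + 1) down ++
     (kappa * sqrt [j - mu]) **
       ((- q_ (1 / 2) * (sqrt [j + n + 1 / 2] / ([2 * j] * [2 * j + 1]))) **
          ket (J - 1) (M + 1) (N + 1) up ++
        (q_ (j + 1 / 2) * (sqrt [j - n - 1 / 2] / [2 * j])) **
          ket (J - 1) (M + 1) (N + 1) down)).

Definition acts_as_b (b : bounded_op spinor_index) : Prop :=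
  forall J M N,
  let j := IZR J / 2 in let mu := IZR M / 2 in let n := IZR N / 2 in
  let kappa := q_ ((mu + n - 1 / 2) / 2) in
  (valid (Label J M N up) = true ->
   b (ket J M N up) =
     (kappa * sqrt [j + mu + 1]) **
       ((sqrt [j - n + 3 / 2] / [2 * j + 2]) **
          ket (J + 1) (M + 1) (N - 1) up ++
        (- q_ (- j - 1) * (sqrt [j + n + 1 / 2]
           / ([2 * j + 1] * [2 * j + 2]))) **
          ket (J + 1) (M + 1) (N - 1) down) ++
     (- kappa * sqrt [j - mu] * q_ (- 1 / 2)
        * (sqrt [j + n + 1 / 2] / [2 * j + 1])) **
       ket (J - 1) (M + 1) (N - 1) up) /\
  (valid (Label J M N down) = true ->
   b (ket J M N down) =
     (kappa * sqrt [j + mu + 1] * q_ (- 1 / 2)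
        * (sqrt [j - n + 1 / 2] / [2 * j + 1])) **
       ket (J + 1) (M + 1) (N - 1) down ++
     (kappa * sqrt [j - mu]) **
       ((- q_ j * (sqrt [j - n + 1 / 2] / ([2 * j] * [2 * j + 1]))) **
          ket (J - 1) (M + 1) (N - 1) up ++
        (- (sqrt [j + n - 1 / 2] / [2 * j])) **
          ket (J - 1) (M + 1) (N - 1) down)).

End SpinorRepresentation.

(** [v = tau_k (T |D|^y) = Res_{z=0} z^k Trace (T |D|^(y - 2z))], where the
    trace, defined for [Re z] large, is continued meromorphically to a
    half-plane containing 0. *)
Definition is_tau (k : nat) (T : bounded_op spinor_index) (y v : C) : Prop :=
  exists (eps r : R) (g : C -> C),
    0 < eps /\
    meromorphic_on (fun z => - eps < Re z) g /\
    (forall z, r < Re z ->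
       exists X, is_mul_abs_dirac_pow T (y - 2 * z)%C X /\
                 is_trace spinor_index_dec X (g z)) /\
    is_residue (fun z => (z ^ k * g z)%C) (RtoC 0) v.

Definition is_phi3 (a0 a1 a2 a3 : bounded_op spinor_index) (v : C) : Prop :=
  exists (d1 d2 d3 : bounded_op spinor_index) (t0 t1 : C),
    is_commutator a1 d1 /\ is_commutator a2 d2 /\ is_commutator a3 d3 /\
    is_tau 0 (mul_op a0 (mul_op d1 (mul_op d2 d3))) (RtoC (-3)) t0 /\
    is_tau 1 (mul_op a0 (mul_op d1 (mul_op d2 d3))) (RtoC (-3)) t1 /\
    v = (/ 12 * t0 - / 6 * t1)%C.

(* Main.v *)
(** Let W be the self-adjoint unitary exchanging |j mu n up> and
    |j^+ n mu down>. It commutes with |D| and anticommutes with D. Let x be one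
    plus the distance of (mu, n) to the faces mu = -j and n = -j^+ (or -j^-); it
    is invariant under W. Away from these faces a acts as a shift that commutes
    with W, while b and the components of a and b that flip the spin are
    exponentially small. So WTW - T and W[D,T]W + [D,T] become bounded even
    after multiplication by x, first for T = a, b, then, by the derivation
    property of commutators, for all T in the pre-C*-algebra they generate.

    For P = a0 [D,a1] [D,a2] [D,a3] the three sign changes give
    P_ii + P_(Wi)(Wi) = O(1/x_i). In the trace of P |D|^(-3-2z) one may
    average the terms of i and Wi; the averaged series converges absolutely for
    Re z > -1/8, so the trace continues holomorphically to a neighbourhood of 0
    and both residues vanish. *)
From Stdlib Require Import Reals ZArith List Bool Permutation Lra Lia Classical
  FunctionalExtensionality ProofIrrelevance.
From Coquelicot Require Import Coquelicot.
Require Import Defs.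
Import ListNotations.

Open Scope R_scope.

(** * Finite sums *)

(** A general element of the algebra is known only through minimality: it lies in every
    pre-C*-algebra that contains a and b. The estimates are therefore packaged as a property whose
    operators form such an algebra. The delicate closure is the holomorphic functional calculus,
    which is given weakly and without bounds; it rests on [E, R] = R [E, T] R for a resolvent R of
    T, and on estimates uniform along the contour.

    The exponents come from counting. About L^2 labels have |D| near L, so the sum of |D|^(-s) needs
    s > 3, and with s = 3 + 2 Re z the series stops exactly at z = 0. The factor 1/x moves this
    boundary. The comparison series is the product of (1 + c)^(-5/4) over three label coordinates c,
    of total degree 15/4; since x is one of the factors 1 + c, dividing by x lowers the exponent
    required to 11/4 < 3, and 3 + 2 Re z > 11/4 reads Re z > -1/8.

    The target predicate also asserts existence: bounded commutators, trace-class operators for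
    large Re z and a continuation have to be exhibited, not only a vanishing value. *)

Lemma lsum_cons {G : AbelianMonoid} {I : Type} (f : I -> G) i l :
  lsum f (i :: l) = plus (f i) (lsum f l).
Proof. reflexivity. Qed.

Lemma lsum_ext {G : AbelianMonoid} {I : Type} (f g : I -> G) l :
  (forall i, In i l -> f i = g i) -> lsum f l = lsum g l.
Proof.
induction l as [|i l IH]; intro H; [reflexivity|].
rewrite !lsum_cons, (H i), IH; [reflexivity| |left; reflexivity].
intros j Hj; apply H; right; exact Hj.
Qed.

Lemma lsum_app {G : AbelianMonoid} {I : Type} (f : I -> G) l l' :
  lsum f (l ++ l') = plus (lsum f l) (lsum f l').
Proof.
induction l as [|i l IH]; simpl; [symmetry; apply plus_zero_l|].
rewrite IH; apply plus_assoc.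
Qed.

Lemma lsum_map {G : AbelianMonoid} {I J : Type} (f : J -> G) (s : I -> J) l :
  lsum f (map s l) = lsum (fun i => f (s i)) l.
Proof. induction l as [|i l IH]; simpl; [|rewrite IH]; reflexivity. Qed.

Lemma lsum_zero {G : AbelianMonoid} {I : Type} (f : I -> G) l :
  (forall i, In i l -> f i = zero) -> lsum f l = zero.
Proof.
induction l as [|i l IH]; intro H; [reflexivity|].
rewrite lsum_cons, (H i), IH; [apply plus_zero_l| |left; reflexivity].
intros j Hj; apply H; right; exact Hj.
Qed.

Lemma lsum_plus {G : AbelianMonoid} {I : Type} (f g : I -> G) l :
  lsum (fun i => plus (f i) (g i)) l = plus (lsum f l) (lsum g l).
Proof.
induction l as [|i l IH]; simpl; [symmetry; apply plus_zero_l|].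
rewrite IH, !plus_assoc; f_equal.
rewrite <- !plus_assoc; f_equal; apply plus_comm.
Qed.

Lemma lsum_swap {G : AbelianMonoid} {I J : Type} (f : I -> J -> G) l l' :
  lsum (fun i => lsum (f i) l') l = lsum (fun j => lsum (fun i => f i j) l) l'.
Proof.
induction l as [|i l IH]; simpl.
- symmetry; apply lsum_zero; reflexivity.
- rewrite IH, <- lsum_plus; reflexivity.
Qed.

Lemma lsum_permutation {G : AbelianMonoid} {I : Type} (f : I -> G) l l' :
  Permutation l l' -> lsum f l = lsum f l'.
Proof.
induction 1 as [| |x y l|]; simpl; [reflexivity|congruence| |congruence].
rewrite !plus_assoc; f_equal; apply plus_comm.
Qed.

Lemma NoDup_extend {I : Type} (l l' : list I) :
  NoDup l -> NoDup l' -> incl l l' ->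
  exists l'', NoDup l'' /\ Permutation l' (l ++ l'').
Proof.
intros Hl; revert l'; induction Hl as [|i l Hi Hl IH]; intros l' Hl' Hinc.
- exists l'; split; [exact Hl'|apply Permutation_refl].
- destruct (in_split i l') as [l1 [l2 E]]; [apply Hinc; left; reflexivity|].
  subst l'.
  destruct (IH (l1 ++ l2)) as [l'' [H1 H2]].
  + exact (NoDup_remove_1 _ _ _ Hl').
  + intros j Hj; assert (H := Hinc j (or_intror Hj)).
    apply in_app_or in H; apply in_or_app; destruct H as [H|[H|H]]; auto.
    subst j; contradiction.
  + exists l''; split; [exact H1|].
    apply Permutation_sym, (Permutation_trans (l' := i :: l1 ++ l2)).
    * simpl; apply perm_skip, Permutation_sym; exact H2.
    * apply Permutation_middle.
Qed.

Lemma lsum_cons_R {I : Type} (f : I -> R) i l :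
  lsum f (i :: l) = f i + lsum f l :> R.
Proof. reflexivity. Qed.

Lemma lsum_cons_C {I : Type} (f : I -> C) i l :
  lsum f (i :: l) = (f i + lsum f l)%C :> C.
Proof. reflexivity. Qed.

Lemma lsum_nil_R {I : Type} (f : I -> R) : lsum f nil = 0 :> R.
Proof. reflexivity. Qed.

Lemma lsum_nil_C {I : Type} (f : I -> C) : lsum f nil = RtoC 0 :> C.
Proof. reflexivity. Qed.

Lemma lsum_scal_R {I : Type} (c : R) (f : I -> R) l :
  lsum (fun i => c * f i) l = c * lsum f l :> R.
Proof.
induction l as [|i l IH]; [symmetry; apply Rmult_0_r|].
rewrite !lsum_cons_R, IH; ring.
Qed.

Lemma lsum_scal_C {I : Type} (c : C) (f : I -> C) l :
  lsum (fun i => c * f i)%C l = (c * lsum f l)%C :> C.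
Proof.
induction l as [|i l IH]; [symmetry; apply Cmult_0_r|].
rewrite !lsum_cons_C, IH; ring.
Qed.

Lemma lsum_conj {I : Type} (f : I -> C) l :
  Cconj (lsum f l) = lsum (fun i => Cconj (f i)) l.
Proof.
induction l as [|i l IH].
- apply injective_projections; simpl; [reflexivity|apply Ropp_0].
- rewrite !lsum_cons_C, <- IH.
  apply injective_projections; simpl; ring.
Qed.

Lemma lsum_le {I : Type} (f g : I -> R) l :
  (forall i, In i l -> f i <= g i) -> lsum f l <= lsum g l.
Proof.
induction l as [|i l IH]; intro H; [apply Rle_refl|].
rewrite !lsum_cons_R; apply Rplus_le_compat; [apply H; left; reflexivity|].
apply IH; intros j Hj; apply H; right; exact Hj.
Qed.

Lemma lsum_ge0 {I : Type} (f : I -> R) l :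
  (forall i, 0 <= f i) -> 0 <= lsum f l.
Proof.
intro H; induction l as [|i l IH]; [apply Rle_refl|].
rewrite lsum_cons_R; apply Rplus_le_le_0_compat; trivial.
Qed.

Lemma lsum_incl {I : Type} (f : I -> R) l l' :
  (forall i, 0 <= f i) -> NoDup l -> NoDup l' -> incl l l' ->
  lsum f l <= lsum f l'.
Proof.
intros H Hl Hl' Hi; destruct (NoDup_extend l l' Hl Hl' Hi) as [l'' [H1 H2]].
rewrite (lsum_permutation f _ _ H2), lsum_app.
generalize (lsum_ge0 f l'' H); unfold plus; simpl; lra.
Qed.

Lemma Cmod_lsum {I : Type} (f : I -> C) l :
  Cmod (lsum f l) <= lsum (fun i => Cmod (f i)) l.
Proof.
induction l as [|i l IH]; [rewrite lsum_nil_C, lsum_nil_R, Cmod_0; lra|].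
rewrite lsum_cons_C, lsum_cons_R; eapply Rle_trans; [apply Cmod_triangle|].
apply Rplus_le_compat_l; exact IH.
Qed.

Lemma sumsq_ge0 {I : Type} (x : I -> C) l : 0 <= sumsq x l.
Proof. apply lsum_ge0; intro i; apply pow2_ge_0. Qed.

Lemma lsum_Cauchy_Schwarz {I : Type} (x y : I -> C) l :
  lsum (fun i => Cmod (x i) * Cmod (y i)) l <= sqrt (sumsq x l) * sqrt (sumsq y l).
Proof.
assert (H : forall l, (lsum (fun i => Cmod (x i) * Cmod (y i)) l) ^ 2
   <= sumsq x l * sumsq y l).
{ clear l; induction l as [|i l IH]; [rewrite lsum_nil_R, !sumsq_nil; lra|].
  rewrite lsum_cons_R, !sumsq_cons.
  generalize (sumsq_ge0 x l) (sumsq_ge0 y l); intros HX HY.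
  set (s := lsum _ l) in *.
  set (X := sumsq x l) in *; set (Y := sumsq y l) in *.
  set (a := Cmod (x i)); set (b := Cmod (y i)).
  assert (Ha : 0 <= a) by apply Cmod_ge_0.
  assert (Hb : 0 <= b) by apply Cmod_ge_0.
  assert (Hs : 0 <= s).
  { apply lsum_ge0; intro j; apply Rmult_le_pos; apply Cmod_ge_0. }
  (* Compare squares: (a^2 Y + b^2 X)^2 >= 4 a^2 b^2 X Y >= (2 a b s)^2, the last step by the
     induction hypothesis. *)
  assert (K : 2 * a * b * s <= a ^ 2 * Y + b ^ 2 * X).
  { apply Rsqr_incr_0_var.
    2:{ apply Rplus_le_le_0_compat; apply Rmult_le_pos; trivial; apply pow2_ge_0. }
    unfold Rsqr.
    generalize (pow2_ge_0 (a ^ 2 * Y - b ^ 2 * X)); intro.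
    assert (4 * (a * b) ^ 2 * s ^ 2 <= 4 * (a * b) ^ 2 * (X * Y)).
    { apply Rmult_le_compat_l; [|exact IH]. generalize (pow2_ge_0 (a * b)); lra. }
    nra. }
  nra. }
rewrite <- sqrt_mult; try apply sumsq_ge0.
rewrite <- (sqrt_pow2 (lsum _ l)).
- apply sqrt_le_1_alt, H.
- apply lsum_ge0; intro j; apply Rmult_le_pos; apply Cmod_ge_0.
Qed.

Lemma sumsq_le_le {I : Type} (x y : I -> C) l :
  (forall i, In i l -> Cmod (x i) <= Cmod (y i)) -> sumsq x l <= sumsq y l.
Proof.
intro H; apply lsum_le; intros i Hi; apply pow_incr; split; [apply Cmod_ge_0|auto].
Qed.

(** The uniform structure of [C] is that of a product, so its balls are squares. They compare with
    discs up to sqrt 2, which the converse below rounds up to 2. *)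
Lemma ball_Cmod (x y : C) (eps : R) : Cmod (y - x) < eps -> @ball C_UniformSpace x eps y.
Proof.
intro H; split; simpl; unfold AbsRing_ball; simpl;
  (eapply Rle_lt_trans; [|exact H]);
  (eapply Rle_trans; [|apply Rmax_Cmod]); [apply Rmax_l|apply Rmax_r].
Qed.

Lemma Cmod_ball (x y : C) (eps : R) : @ball C_UniformSpace x eps y -> Cmod (y - x) < 2 * eps.
Proof.
intros [H1 H2]; simpl in H1, H2; unfold AbsRing_ball in H1, H2; simpl in H1, H2.
unfold minus, plus, opp in H1, H2; simpl in H1, H2; unfold abs in H1, H2; simpl in H1, H2.
eapply Rle_lt_trans; [apply Cmod_2Rmax|]; simpl.
assert (Hs : 0 < sqrt 2 < 2).
{ split; [apply sqrt_lt_R0; lra|]. rewrite <- (sqrt_pow2 2) at 2 by lra.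
  apply sqrt_lt_1; lra. }
assert (Rmax (Rabs (fst y + - fst x)) (Rabs (snd y + - snd x)) < eps).
{ apply Rmax_case; assumption. }
assert (0 <= Rmax (Rabs (fst y + - fst x)) (Rabs (snd y + - snd x))).
{ eapply Rle_trans; [apply Rabs_pos|apply Rmax_l]. }
nra.
Qed.

Lemma lsum_plus_C {I : Type} (f g : I -> C) l :
  lsum (fun i => f i + g i)%C l = (lsum f l + lsum g l)%C :> C.
Proof. exact (lsum_plus f g l). Qed.

Lemma lsum_app_C {I : Type} (f : I -> C) l l' :
  lsum f (l ++ l') = (lsum f l + lsum f l')%C :> C.
Proof. exact (lsum_app f l l'). Qed.

Lemma lsum_app_R {I : Type} (f : I -> R) l l' :
  lsum f (l ++ l') = lsum f l + lsum f l' :> R.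
Proof. exact (lsum_app f l l'). Qed.

Lemma Cminus_0_r (z : C) : (z - 0)%C = z.
Proof. ring. Qed.

Lemma Cmod_dist_triangle (a b c : C) : Cmod (a - b) <= Cmod (a - c) + Cmod (b - c).
Proof.
replace (a - b)%C with ((a - c) + - (b - c))%C by ring.
eapply Rle_trans; [apply Cmod_triangle|]; rewrite Cmod_opp; lra.
Qed.

Lemma Cplus_minus_l (a b : C) : (a + b - a)%C = b.
Proof. ring. Qed.

Lemma Cconj_R (r : R) : Cconj (RtoC r) = RtoC r.
Proof. apply injective_projections; simpl; ring. Qed.

(** * Unordered sums and the inner product *)

Section Sums.
Context {I : Type} (I_dec : forall i j : I, {i = j} + {i <> j}).

(** Decidable equality enters here: [nodup] turns an arbitrary list into an admissible index of the
    net. *)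
Local Instance finsets_proper : ProperFilter (@finsets I).
Proof.
constructor.
- intros P [l0 H]; exists (nodup I_dec l0); apply H; [apply NoDup_nodup|].
  intros i Hi; apply nodup_In; exact Hi.
- constructor.
  + exists nil; trivial.
  + intros P Q [l HP] [l' HQ]; exists (l ++ l'); intros m Hm Hi; split.
    * apply HP; trivial; intros i H; apply Hi, in_or_app; auto.
    * apply HQ; trivial; intros i H; apply Hi, in_or_app; auto.
  + intros P Q H [l HP]; exists l; auto.
Qed.

Lemma is_sum_eps (f : I -> C) (s : C) :
  is_sum f s <-> forall eps, 0 < eps ->
    exists l0, forall l, NoDup l -> incl l0 l -> Cmod (lsum f l - s) < eps.
Proof.
unfold is_sum; split.
- intros H eps Heps.
  assert (Heps' : 0 < eps / 2) by lra.
  destruct (proj1 (filterlim_locally _ _) H (mkposreal _ Heps')) as [l0 Hl0].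
  exists l0; intros l Hl Hi; generalize (Cmod_ball _ _ _ (Hl0 l Hl Hi)); simpl; lra.
- intro H; apply filterlim_locally; intro eps.
  destruct (H eps (cond_pos eps)) as [l0 Hl0]; exists l0; intros l Hl Hi.
  apply ball_Cmod; auto.
Qed.

Lemma is_sum_Csum (f : I -> C) (s : C) : is_sum f s -> Csum f = s.
Proof.
intro H; unfold Csum.
set (F := filtermap (lsum f) finsets).
assert (FF : ProperFilter F) by (apply filtermap_proper_filter; apply finsets_proper).
assert (Hc : @cauchy C_UniformSpace F).
{ intro eps; exists s; exact (proj1 (filterlim_locally _ _) H eps). }
assert (HL : filterlim (lsum f) finsets (@locally C_UniformSpace (@lim C_CompleteNormedModule F))).
{ apply filterlim_locally; intro eps.
  exact (@complete_cauchy C_CompleteNormedModule F FF Hc eps). }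
exact (@filterlim_locally_unique _ _ C_NormedModule finsets _ _ _ _ HL H).
Qed.

Lemma is_sum_unique (f : I -> C) (s t : C) : is_sum f s -> is_sum f t -> s = t.
Proof. intros Hs Ht; rewrite <- (is_sum_Csum _ _ Hs); apply is_sum_Csum; exact Ht. Qed.

Lemma is_sum_ext (f g : I -> C) (s : C) :
  (forall i, f i = g i) -> is_sum f s -> is_sum g s.
Proof.
intros H; replace g with f; [trivial|apply functional_extensionality; exact H].
Qed.

Lemma is_sum_plus (f g : I -> C) (s t : C) :
  is_sum f s -> is_sum g t -> is_sum (fun i => f i + g i)%C (s + t)%C.
Proof.
rewrite !is_sum_eps; intros Hf Hg eps Heps.
destruct (Hf (eps / 2)) as [l Hl]; [lra|]; destruct (Hg (eps / 2)) as [l' Hl']; [lra|].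
exists (l ++ l'); intros m Hm Hi.
rewrite lsum_plus_C.
replace (lsum f m + lsum g m - (s + t))%C
  with ((lsum f m - s) + (lsum g m - t))%C by ring.
eapply Rle_lt_trans; [apply Cmod_triangle|].
assert (H1 := Hl m Hm (fun i H => Hi i (in_or_app _ _ _ (or_introl H)))).
assert (H2 := Hl' m Hm (fun i H => Hi i (in_or_app _ _ _ (or_intror H)))).
lra.
Qed.

Lemma is_sum_scal (c : C) (f : I -> C) (s : C) :
  is_sum f s -> is_sum (fun i => c * f i)%C (c * s)%C.
Proof.
rewrite !is_sum_eps; intros Hf eps Heps.
assert (Hc := Cmod_ge_0 c).
destruct (Hf (eps / (Cmod c + 1))) as [l Hl]; [apply Rdiv_lt_0_compat; lra|].
exists l; intros m Hm Hi; rewrite lsum_scal_C.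
replace (c * lsum f m - c * s)%C with (c * (lsum f m - s))%C by ring.
rewrite Cmod_mult.
assert (H := Hl m Hm Hi); assert (H0 := Cmod_ge_0 (lsum f m - s)).
apply Rle_lt_trans with ((Cmod c) * (eps / (Cmod c + 1))).
- apply Rmult_le_compat_l; lra.
- apply Rmult_lt_reg_r with (Cmod c + 1); [lra|].
  field_simplify; [|lra]. nra.
Qed.

Lemma is_sum_conj (f : I -> C) (s : C) :
  is_sum f s -> is_sum (fun i => Cconj (f i)) (Cconj s).
Proof.
rewrite !is_sum_eps; intros Hf eps Heps.
destruct (Hf eps Heps) as [l Hl]; exists l; intros m Hm Hi.
rewrite <- lsum_conj; replace (Cconj (lsum f m) - Cconj s)%C
  with (Cconj (lsum f m - s)).
- rewrite Cmod_conj; auto.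
- apply injective_projections; simpl; ring.
Qed.

Lemma is_sum_le (f : I -> C) (s t : C) (B : R) :
  is_sum f s -> (forall l, NoDup l -> Cmod (lsum f l - t) <= B) -> Cmod (s - t) <= B.
Proof.
intros Hs H; apply le_epsilon; intros eps Heps.
destruct (proj1 (is_sum_eps f s) Hs eps Heps) as [l0 Hl0].
pose (l := nodup I_dec l0).
assert (Hn : NoDup l) by apply NoDup_nodup.
assert (H1 := Hl0 l Hn (fun i => proj2 (nodup_In I_dec l0 i))).
assert (H2 := H l Hn).
replace (s - t)%C with (-(lsum f l - s) + (lsum f l - t))%C by ring.
eapply Rle_trans; [apply Cmod_triangle|]; rewrite Cmod_opp; lra.
Qed.

Lemma is_sum_Cmod_le (f : I -> C) (s : C) (B : R) :
  is_sum f s -> (forall l, NoDup l -> Cmod (lsum f l) <= B) -> Cmod s <= B.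
Proof.
intros Hs H; rewrite <- (Cminus_0_r s); apply is_sum_le with (1 := Hs).
intros l Hl; rewrite Cminus_0_r; auto.
Qed.

Lemma is_sum_single (f : I -> C) (i : I) :
  (forall j, j <> i -> f j = RtoC 0) -> is_sum f (f i).
Proof.
intro H; apply is_sum_eps; intros eps Heps; exists [i]; intros l Hl Hi.
destruct (NoDup_extend [i] l) as [l'' [H1 H2]]; trivial.
{ constructor; [intros []|constructor]. }
assert (Hn : NoDup ([i] ++ l'')) by (apply (Permutation_NoDup H2); exact Hl).
rewrite (lsum_permutation f _ _ H2); simpl app; rewrite lsum_cons_C.
rewrite (lsum_zero f l'').
- replace (f i + zero - f i)%C with (RtoC 0); [rewrite Cmod_0; exact Heps|].
  unfold zero; simpl; ring.
- intros j Hj; apply H; intros ->; inversion Hn; contradiction.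
Qed.

Lemma summable (f : I -> C) (M : R) :
  (forall l, NoDup l -> lsum (fun i => Cmod (f i)) l <= M) -> exists s, is_sum f s.
Proof.
intro H; set (E := fun r => exists l, NoDup l /\ r = lsum (fun i => Cmod (f i)) l).
destruct (completeness E) as [m [Hm1 Hm2]].
{ exists M; intros r [l [Hl ->]]; auto. }
{ exists 0, nil; split; [constructor|reflexivity]. }
apply (proj1 (@filterlim_locally_cauchy _ C_CompleteNormedModule finsets _ (lsum f))).
intro eps.
assert (Hex : exists l0, NoDup l0 /\ m - eps / 2 < lsum (fun i => Cmod (f i)) l0).
{ apply NNPP; intro Hn.
  assert (m <= m - eps / 2); [|generalize (cond_pos eps); lra].
  apply Hm2; intros r [l [Hl ->]]; apply Rnot_lt_le; intro; apply Hn; exists l; auto. }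
destruct Hex as [l0 [Hl0 Hl0m]].
(* Absolute sums over larger lists stay below the supremum [m], so the terms outside [l0] have total
   absolute value less than [eps / 2]. *)
assert (K : forall l, NoDup l -> incl l0 l -> Cmod (lsum f l - lsum f l0) < eps / 2).
{ intros l Hl Hi; destruct (NoDup_extend l0 l Hl0 Hl Hi) as [l'' [H1 H2]].
  rewrite (lsum_permutation f _ _ H2), lsum_app_C.
  rewrite Cplus_minus_l.
  eapply Rle_lt_trans; [apply Cmod_lsum|].
  assert (Hl' : lsum (fun i => Cmod (f i)) l <= m) by (apply Hm1; exists l; auto).
  rewrite (lsum_permutation _ _ _ H2), lsum_app_R in Hl'.
  lra. }
exists (fun z => exists l, NoDup l /\ incl l0 l /\ z = l); split.
- exists l0; intros l Hl Hi; exists l; auto.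
- intros u v [l [Hl [Hi ->]]] [l' [Hl' [Hi' ->]]]; apply ball_Cmod.
  eapply Rle_lt_trans; [apply (Cmod_dist_triangle _ _ (lsum f l0))|].
  generalize (K l Hl Hi) (K l' Hl' Hi'); lra.
Qed.

Lemma is_sum_involution (s : I -> I) (f : I -> C) (v : C) :
  (forall i, s (s i) = i) -> is_sum f v -> is_sum (fun i => f (s i)) v.
Proof.
intro Hs; rewrite !is_sum_eps; intros Hf eps Heps.
destruct (Hf eps Heps) as [l0 Hl0]; exists (map s l0); intros l Hl Hi.
rewrite <- (lsum_map f s); apply Hl0.
- apply FinFun.Injective_map_NoDup; [|exact Hl].
  intros x y E; rewrite <- (Hs x), E; apply Hs.
- intros i H; apply in_map_iff; exists (s i); split; [apply Hs|].
  apply Hi, in_map; exact H.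
Qed.

Definition basis := basis_vector I_dec.

Lemma coord_basis_same i : coord (basis i) i = RtoC 1.
Proof. simpl; unfold delta; destruct (I_dec i i); congruence. Qed.

Lemma coord_basis_other i j : j <> i -> coord (basis i) j = RtoC 0.
Proof. intro H; simpl; unfold delta; destruct (I_dec j i); congruence. Qed.

Lemma coord_plus (x y : ell2 I) i : coord (plus x y) i = (coord x i + coord y i)%C.
Proof. reflexivity. Qed.

Lemma coord_scal (c : C) (x : ell2 I) i :
  coord (@scal C_Ring ell2_ModuleSpace c x) i = (c * coord x i)%C.
Proof. reflexivity. Qed.

Lemma coord_zero i : coord (@zero (@ell2_AbelianMonoid I)) i = RtoC 0.
Proof. reflexivity. Qed.

Lemma inner_summable (x y : ell2 I) l : NoDup l ->
  lsum (fun i => Cmod (Cconj (coord x i) * coord y i)) l <= hnorm x * hnorm y.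
Proof.
intro Hl.
rewrite (lsum_ext _ (fun i => Cmod (coord x i) * Cmod (coord y i))).
2:{ intros i _; rewrite Cmod_mult, Cmod_conj; reflexivity. }
eapply Rle_trans; [apply lsum_Cauchy_Schwarz|].
apply Rmult_le_compat; try apply sqrt_pos;
  (rewrite <- (sqrt_pow2 (hnorm _)) by apply hnorm_ge0);
  apply sqrt_le_1_alt, sumsq_le_hnorm; exact Hl.
Qed.

Lemma is_sum_inner (x y : ell2 I) :
  is_sum (fun i => Cconj (coord x i) * coord y i)%C (inner x y).
Proof.
destruct (summable _ _ (inner_summable x y)) as [s Hs].
unfold inner; rewrite (is_sum_Csum _ _ Hs); exact Hs.
Qed.

Lemma inner_le (x y : ell2 I) : Cmod (inner x y) <= hnorm x * hnorm y.
Proof.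
apply is_sum_Cmod_le with (1 := is_sum_inner x y); intros l Hl.
eapply Rle_trans; [apply Cmod_lsum|apply inner_summable; exact Hl].
Qed.

Lemma inner_conj (x y : ell2 I) : Cconj (inner x y) = inner y x.
Proof.
apply is_sum_unique with (2 := is_sum_inner y x).
eapply is_sum_ext; [|apply is_sum_conj, is_sum_inner]; intro i; simpl.
rewrite Cmult_conj, Cconj_conj; ring.
Qed.

Lemma inner_plus_r (x y z : ell2 I) : inner x (plus y z) = (inner x y + inner x z)%C.
Proof.
apply is_sum_unique with (1 := is_sum_inner x (plus y z)).
eapply is_sum_ext; [|apply is_sum_plus; apply is_sum_inner].
intro i; rewrite coord_plus; simpl; ring.
Qed.

Lemma inner_scal_r (c : C) (x y : ell2 I) :
  inner x (@scal C_Ring ell2_ModuleSpace c y) = (c * inner x y)%C.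
Proof.
apply is_sum_unique with (1 := is_sum_inner x (@scal C_Ring ell2_ModuleSpace c y)).
eapply is_sum_ext; [|apply is_sum_scal; apply is_sum_inner].
intro i; rewrite coord_scal; simpl; ring.
Qed.

Lemma inner_plus_l (x y z : ell2 I) : inner (plus x y) z = (inner x z + inner y z)%C.
Proof.
rewrite <- inner_conj, inner_plus_r, Cplus_conj, !inner_conj; reflexivity.
Qed.

Lemma inner_scal_l (c : C) (x y : ell2 I) :
  inner (@scal C_Ring ell2_ModuleSpace c x) y = (Cconj c * inner x y)%C.
Proof.
rewrite <- inner_conj, inner_scal_r, Cmult_conj, !inner_conj; reflexivity.
Qed.

Lemma inner_basis_l (i : I) (x : ell2 I) : inner (basis i) x = coord x i.
Proof.
apply is_sum_Csum.
assert (H := is_sum_single (fun j => Cconj (coord (basis i) j) * coord x j)%C i).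
cbv beta in H; replace (coord x i) with (Cconj (coord (basis i) i) * coord x i)%C.
- apply H; intros j Hj; rewrite coord_basis_other by exact Hj.
  rewrite Cconj_R; ring.
- rewrite coord_basis_same, Cconj_R; ring.
Qed.

Lemma inner_basis_r (i : I) (x : ell2 I) : inner x (basis i) = Cconj (coord x i).
Proof. rewrite <- inner_conj, inner_basis_l; reflexivity. Qed.

Lemma hnorm_inner (x : ell2 I) : inner x x = RtoC (hnorm x ^ 2).
Proof.
apply is_sum_Csum, is_sum_eps; intros eps Heps.
destruct (sumsq_lub x) as [H1 H2].
assert (Hex : exists l, NoDup l /\ hnorm x ^ 2 - eps < sumsq (coord x) l).
{ apply NNPP; intro Hn.
  assert (Rbar_le (hnorm x ^ 2) (hnorm x ^ 2 - eps)); [|simpl in H; lra].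
  apply H2; intros r [l [Hl ->]]; simpl; apply Rnot_lt_le; intro; apply Hn.
  exists l; auto. }
destruct Hex as [l0 [Hl0 Hl0m]]; exists l0; intros l Hl Hi.
assert (E : lsum (fun i => Cconj (coord x i) * coord x i)%C l = RtoC (sumsq (coord x) l)).
{ clear; induction l as [|i l IH]; [reflexivity|].
  rewrite lsum_cons_C, IH, sumsq_cons, RtoC_plus, Cmod2_conj; f_equal; ring. }
rewrite E, <- RtoC_minus, Cmod_R.
generalize (sumsq_le_hnorm x Hl); intro H3.
assert (H4 : sumsq (coord x) l0 <= sumsq (coord x) l).
{ apply lsum_incl; trivial; intro i; apply pow2_ge_0. }
apply Rabs_lt_between; lra.
Qed.

Lemma coord_le (x : ell2 I) i : Cmod (coord x i) <= hnorm x.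
Proof.
assert (H : sumsq (coord x) [i] <= hnorm x ^ 2).
{ apply sumsq_le_hnorm; constructor; [intros []|constructor]. }
rewrite sumsq_cons, sumsq_nil, Rplus_0_r in H.
apply Rsqr_incr_0_var; [unfold Rsqr; lra|apply hnorm_ge0].
Qed.

Lemma hnorm_basis i : hnorm (basis i) = 1.
Proof.
assert (H : RtoC (hnorm (basis i) ^ 2) = RtoC 1).
{ rewrite <- hnorm_inner, inner_basis_l; apply coord_basis_same. }
apply RtoC_inj in H; assert (H0 := hnorm_ge0 (basis i)); nra.
Qed.

Lemma hnorm_scal (c : C) (x : ell2 I) :
  hnorm (@scal C_Ring ell2_ModuleSpace c x) = Cmod c * hnorm x.
Proof.
assert (H : RtoC (hnorm (@scal C_Ring ell2_ModuleSpace c x) ^ 2)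
            = RtoC ((Cmod c * hnorm x) ^ 2)).
{ rewrite <- hnorm_inner, inner_scal_l, inner_scal_r, hnorm_inner.
  rewrite Rpow_mult_distr, RtoC_mult, Cmod2_conj; ring. }
apply RtoC_inj in H.
apply Rsqr_inj; [apply hnorm_ge0| |unfold Rsqr; lra].
apply Rmult_le_pos; [apply Cmod_ge_0|apply hnorm_ge0].
Qed.

Lemma hnorm_triangle (x y : ell2 I) : hnorm (plus x y) <= hnorm x + hnorm y.
Proof.
assert (H : RtoC (hnorm (plus x y) ^ 2)
  = (RtoC (hnorm x ^ 2) + (inner x y + inner y x) + RtoC (hnorm y ^ 2))%C).
{ rewrite <- !hnorm_inner, inner_plus_l, !inner_plus_r; ring. }
apply (f_equal Cmod) in H; rewrite Cmod_R, Rabs_pos_eq in H by apply pow2_ge_0.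
assert (H1 := inner_le x y); assert (H2 := inner_le y x).
assert (H3 : hnorm (plus x y) ^ 2 <= (hnorm x + hnorm y) ^ 2).
{ rewrite H; eapply Rle_trans; [apply Cmod_triangle|].
  eapply Rle_trans; [apply Rplus_le_compat_r, Cmod_triangle|].
  rewrite !Cmod_R, !Rabs_pos_eq by apply pow2_ge_0.
  generalize (Cmod_triangle (inner x y) (inner y x)); lra. }
generalize (hnorm_ge0 x) (hnorm_ge0 y) (hnorm_ge0 (plus x y)); intros.
apply Rsqr_incr_0_var; unfold Rsqr; lra.
Qed.

End Sums.

(** * Matrices of bounded operators *)

Lemma op_ext {I : Type} (A B : bounded_op I) : (forall x, A x = B x) -> A = B.
Proof.
destruct A as [f H1 H2 H3], B as [g K1 K2 K3]; simpl; intro H.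
assert (E : f = g) by (apply functional_extensionality; exact H); subst g.
f_equal; apply proof_irrelevance.
Qed.

Definition opbound {I : Type} (A : bounded_op I) (M : R) : Prop :=
  forall x, hnorm (A x) <= M * hnorm x.

Section Matrix.
Context {I : Type} (I_dec : forall i j : I, {i = j} + {i <> j}).
Local Notation basis := (basis I_dec).

Definition ent (A : bounded_op I) (i k : I) : C := coord (A (basis k)) i.

Lemma coord_lsum {J : Type} (f : J -> ell2 I) l i :
  coord (lsum f l) i = lsum (fun k => coord (f k) i) l.
Proof.
induction l as [|k l IH]; [reflexivity|].
rewrite lsum_cons, coord_plus, IH; reflexivity.
Qed.

Lemma op_zero (A : bounded_op I) : A zero = zero.
Proof.
replace (@zero (@ell2_AbelianMonoid I)) with (@scal C_Ring ell2_ModuleSpace (RtoC 0) (@zero (@ell2_AbelianMonoid I))).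
- rewrite op_scal; apply ell2_eq; intro i; rewrite !coord_scal, coord_zero; ring.
- apply ell2_eq; intro i; rewrite coord_scal, coord_zero; ring.
Qed.

Lemma op_lsum {J : Type} (A : bounded_op I) (f : J -> ell2 I) l :
  A (lsum f l) = lsum (fun k => A (f k)) l.
Proof.
induction l as [|k l IH]; [apply op_zero|].
rewrite !lsum_cons, op_plus, IH; reflexivity.
Qed.

Definition combination (y : I -> C) (l : list I) : ell2 I :=
  lsum (fun k => @scal C_Ring ell2_ModuleSpace (y k) (basis k)) l.

Lemma coord_combination y l i :
  NoDup l -> coord (combination y l) i = if in_dec I_dec i l then y i else RtoC 0.
Proof.
intro Hl; unfold combination; rewrite coord_lsum.
induction Hl as [|k l Hk Hl IH]; [reflexivity|].
rewrite lsum_cons_C, IH, coord_scal.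
destruct (I_dec i k) as [E|E].
- subst k; rewrite coord_basis_same.
  destruct (in_dec I_dec i l); [contradiction|].
  destruct (in_dec I_dec i (i :: l)) as [_|n']; [|exfalso; apply n'; left; reflexivity].
  ring.
- rewrite coord_basis_other by exact E.
  destruct (in_dec I_dec i l) as [H|H], (in_dec I_dec i (k :: l)) as [H'|H']; try ring.
  + exfalso; apply H'; right; exact H.
  + destruct H' as [H'|H']; [congruence|contradiction].
Qed.

Lemma coord_op_combination (A : bounded_op I) y l i :
  coord (A (combination y l)) i = lsum (fun k => ent A i k * y k)%C l.
Proof.
unfold combination; rewrite op_lsum, coord_lsum; apply lsum_ext; intros k _.
rewrite op_scal, coord_scal; unfold ent; apply Cmult_comm.
Qed.

Lemma sumsq_app {J : Type} (x : J -> C) l l' : sumsq x (l ++ l') = sumsq x l + sumsq x l'.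
Proof. apply lsum_app_R. Qed.

Lemma sumsq_filter_off (x : I -> C) (l m : list I) :
  sumsq (fun i => if in_dec I_dec i l then RtoC 0 else x i) m
  = sumsq x (filter (fun i => if in_dec I_dec i l then false else true) m).
Proof.
induction m as [|i m IH]; [reflexivity|].
rewrite sumsq_cons, IH; simpl filter.
destruct (in_dec I_dec i l); [rewrite Cmod_0; ring|rewrite sumsq_cons; reflexivity].
Qed.

Lemma hnorm_off (x : ell2 I) (l : list I) (y : ell2 I) : NoDup l ->
  (forall i, coord y i = if in_dec I_dec i l then RtoC 0 else coord x i) ->
  hnorm y <= sqrt (hnorm x ^ 2 - sumsq (coord x) l).
Proof.
intros Hl Hy; apply hnorm_le; [apply sqrt_pos|]; intros m Hm.
rewrite pow2_sqrt.
2:{ generalize (sumsq_le_hnorm x Hl); lra. }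
replace (coord y) with (fun i => if in_dec I_dec i l then RtoC 0 else coord x i)
  by (symmetry; apply functional_extensionality; exact Hy).
rewrite sumsq_filter_off.
set (m' := filter _ m).
assert (H : NoDup (l ++ m')).
{ apply NoDup_app; trivial; [apply NoDup_filter; exact Hm|].
  intros i Hi Hi'; apply filter_In in Hi'; destruct Hi' as [_ Hi'].
  destruct (in_dec I_dec i l); [discriminate|contradiction]. }
generalize (sumsq_le_hnorm x H); rewrite sumsq_app; lra.
Qed.

Lemma hnorm_combination y l : NoDup l -> hnorm (combination y l) ^ 2 = sumsq y l.
Proof.
intro Hl; apply Rle_antisym.
- assert (H : hnorm (combination y l) <= sqrt (sumsq y l)).
  { apply hnorm_le; [apply sqrt_pos|]; intros m Hm.
    rewrite pow2_sqrt by apply sumsq_ge0.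
    set (p := fun i => if in_dec I_dec i l then true else false).
    apply Rle_trans with (sumsq y (filter p m)).
    - clear Hm; induction m as [|i m IH]; [apply Rle_refl|].
      rewrite sumsq_cons, coord_combination by exact Hl; simpl filter; unfold p at 1.
      destruct (in_dec I_dec i l); [rewrite sumsq_cons; lra|rewrite Cmod_0; lra].
    - apply lsum_incl; trivial; [intro; apply pow2_ge_0|apply NoDup_filter; exact Hm|].
      intros i Hi; apply filter_In in Hi; destruct Hi as [_ Hi]; unfold p in Hi.
      destruct (in_dec I_dec i l); [trivial|discriminate]. }
  apply (fun H0 => pow_incr _ _ 2 (conj (hnorm_ge0 _) H0)) in H.
  rewrite pow2_sqrt in H by apply sumsq_ge0; exact H.
- eapply Rle_trans; [|apply (sumsq_le_hnorm (combination y l) Hl)].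
  apply sumsq_le_le; intros i Hi; rewrite coord_combination by exact Hl.
  destruct (in_dec I_dec i l); [apply Rle_refl|contradiction].
Qed.

(** Restricting [x] to a large finite list changes it little in norm, and [A] is bounded.
    Consequently a bounded operator is determined by its matrix entries. *)
Lemma is_sum_row (A : bounded_op I) (x : ell2 I) (i : I) :
  is_sum (fun k => ent A i k * coord x k)%C (coord (A x) i).
Proof.
apply (is_sum_eps I_dec); intros eps Heps.
destruct (op_bounded_pos A) as [M [HM0 HM]].
set (e := eps / (M + 1)).
assert (He : 0 < e) by (apply Rdiv_lt_0_compat; lra).
assert (He2 : 0 < e ^ 2) by (apply pow_lt; exact He).
assert (Hex : exists l, NoDup l /\ hnorm x ^ 2 - e ^ 2 < sumsq (coord x) l).
{ apply NNPP; intro Hn; destruct (sumsq_lub x) as [_ H2].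
  assert (Rbar_le (hnorm x ^ 2) (hnorm x ^ 2 - e ^ 2)); [|simpl in H; lra].
  apply H2; intros r [l [Hl ->]]; simpl; apply Rnot_lt_le; intro; apply Hn.
  exists l; auto. }
destruct Hex as [l0 [Hl0 Hl0e]]; exists l0; intros l Hl Hi.
rewrite <- coord_op_combination.
set (y := combination (coord x) l).
set (z := plus x (@scal C_Ring ell2_ModuleSpace (RtoC (-1)) y)).
assert (Hz : hnorm z < e).
{ eapply Rle_lt_trans; [apply (hnorm_off x l z Hl)|].
  - intro j; unfold z, y; rewrite coord_plus, coord_scal, coord_combination by exact Hl.
    destruct (in_dec I_dec j l); ring.
  - rewrite <- (sqrt_pow2 e) by lra; apply sqrt_lt_1_alt.
    assert (sumsq (coord x) l0 <= sumsq (coord x) l).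
    { apply lsum_incl; trivial; intro; apply pow2_ge_0. }
    generalize (sumsq_le_hnorm x Hl); lra. }
replace (coord (A y) i - coord (A x) i)%C with (- coord (A z) i)%C.
2:{ unfold z; rewrite op_plus, op_scal, coord_plus, coord_scal; ring. }
rewrite Cmod_opp; eapply Rle_lt_trans; [apply coord_le|].
eapply Rle_lt_trans; [apply HM|].
replace eps with ((M + 1) * e) by (unfold e; field; lra).
generalize (hnorm_ge0 z); nra.
Qed.

Lemma op_ent_ext (A B : bounded_op I) : (forall i k, ent A i k = ent B i k) -> A = B.
Proof.
intro H; apply op_ext; intro x; apply ell2_eq; intro i.
apply (is_sum_unique I_dec _ _ _ (is_sum_row A x i)).
eapply is_sum_ext; [|apply is_sum_row]; intro k; cbv beta; rewrite H; reflexivity.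
Qed.

(** The norm bound tested on finite sections. It involves finitely many entries at a time, so it
    makes sense before an operator exists and survives entrywise limits. *)
Definition matrix_bound (m : I -> I -> C) (M : R) : Prop :=
  forall l l' (y : I -> C), NoDup l -> NoDup l' ->
    sumsq (fun i => lsum (fun k => m i k * y k)%C l') l <= M ^ 2 * sumsq y l'.

Lemma opbound_matrix A M : 0 <= M -> opbound A M -> matrix_bound (ent A) M.
Proof.
intros HM H l l' y Hl Hl'.
rewrite <- (hnorm_combination y l' Hl').
replace (fun i => _) with (coord (A (combination y l'))).
2:{ apply functional_extensionality; intro i; apply coord_op_combination. }
eapply Rle_trans; [apply sumsq_le_hnorm; exact Hl|].
rewrite <- Rpow_mult_distr; apply pow_incr; split; [apply hnorm_ge0|apply H].
Qed.

Section OfMatrix.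
Context (m : I -> I -> C) (M : R) (HM : 0 <= M) (Hm : matrix_bound m M).

Lemma matrix_row_summable i : square_summable (fun k => Cconj (m i k)).
Proof.
exists (M ^ 2); intros l Hl.
assert (Hi : NoDup [i]) by (constructor; [intros []|constructor]).
(* Testing row [i] against its own conjugate gives [s ^ 2 <= M ^ 2 * s], hence [s <= M ^ 2]. *)
assert (H := Hm [i] l (fun k => Cconj (m i k)) Hi Hl).
set (s := sumsq _ l) in *; assert (Hs : 0 <= s) by apply sumsq_ge0.
rewrite sumsq_cons, sumsq_nil in H.
replace (lsum (fun k => m i k * Cconj (m i k))%C l) with (RtoC s) in H.
- rewrite Cmod_R, Rabs_pos_eq in H by exact Hs.
  destruct (Req_dec s 0) as [E|E]; [rewrite E; apply pow2_ge_0|nra].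
- unfold s; clear; induction l as [|k l IH]; [reflexivity|].
  rewrite lsum_cons_C, sumsq_cons, RtoC_plus, <- IH, Cmod_conj, Cmod2_conj; reflexivity.
Qed.

Definition matrix_row i : ell2 I := exist _ _ (matrix_row_summable i).

Lemma is_sum_matrix_row i (x : ell2 I) :
  is_sum (fun k => m i k * coord x k)%C (inner (matrix_row i) x).
Proof.
eapply is_sum_ext; [|apply (is_sum_inner I_dec)]; intro k; simpl.
rewrite Cconj_conj; reflexivity.
Qed.

Lemma matrix_apply_bound (x : ell2 I) l :
  NoDup l -> sumsq (fun i => inner (matrix_row i) x) l <= (M * hnorm x) ^ 2.
Proof.
intro Hl.
(* Each row is an infinite sum, but only the rows in [l] matter: one finite column list [F]
   approximates all of them at once, and on [F] the hypothesis [Hm] applies. *)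
assert (H : forall eps, 0 < eps -> exists F, NoDup F /\ forall i, In i l ->
   Cmod (lsum (fun k => m i k * coord x k)%C F - inner (matrix_row i) x) < eps).
{ intros eps Heps.
  cut (exists F, forall G, NoDup G -> incl F G -> forall i, In i l ->
   Cmod (lsum (fun k => m i k * coord x k)%C G - inner (matrix_row i) x) < eps).
  { intros [F HF]; exists (nodup I_dec F); split; [apply NoDup_nodup|].
    apply HF; [apply NoDup_nodup|intros j Hj; apply nodup_In; exact Hj]. }
  clear Hl; induction l as [|i l' IH]; [exists nil; intros G _ _ j []|].
  destruct IH as [F HF].
  destruct (proj1 (is_sum_eps I_dec _ _) (is_sum_matrix_row i x) eps Heps) as [F' HF'].
  exists (F ++ F'); intros G HG Hi j [E|Hj].
  - subst j; apply HF'; trivial; intros k Hk; apply Hi, in_or_app; auto.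
  - apply HF; trivial; intros k Hk; apply Hi, in_or_app; auto. }
apply le_epsilon; intros eps Heps.
set (B := M * hnorm x).
assert (HB : 0 <= B) by (apply Rmult_le_pos; [exact HM|apply hnorm_ge0]).
set (n := INR (length l)); assert (Hn : 0 <= n) by apply pos_INR.
(* |v|^2 <= |u|^2 + 2 B d + d^2 termwise, for |v - u| < d and |u| <= B. *)
set (d := Rmin 1 (eps / (n * (2 * B + 1) + 1))).
assert (Hden : 0 < n * (2 * B + 1) + 1) by nra.
assert (Hd : 0 < d) by (apply Rmin_glb_lt; [lra|apply Rdiv_lt_0_compat; lra]).
assert (Hd1 : d <= 1) by apply Rmin_l.
assert (Hd2 : d <= eps / (n * (2 * B + 1) + 1)) by apply Rmin_r.
clearbody d.
destruct (H d Hd) as [F [HF HFd]].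
set (u := fun i => lsum (fun k => m i k * coord x k)%C F) in *.
assert (Hu : sumsq u l <= B ^ 2).
{ eapply Rle_trans; [apply (Hm l F (coord x) Hl HF)|].
  unfold B; rewrite Rpow_mult_distr; apply Rmult_le_compat_l; [apply pow2_ge_0|].
  apply sumsq_le_hnorm; exact HF. }
assert (K : sumsq (fun i => inner (matrix_row i) x) l
  <= sumsq u l + n * (2 * B * d + d ^ 2)).
{ assert (Hub : forall i, In i l -> Cmod (u i) <= B).
  { intros i Hi; apply Rsqr_incr_0_var; [|exact HB]; unfold Rsqr.
    apply Rle_trans with (sumsq u l); [|lra].
    destruct (in_split i l Hi) as [l1 [l2 E]]; rewrite E, sumsq_app, sumsq_cons.
    generalize (sumsq_ge0 u l1) (sumsq_ge0 u l2); lra. }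
  assert (Hdd : forall i, In i l -> Cmod (u i - inner (matrix_row i) x) < d) by (exact HFd).
  unfold n; clear -Hub Hdd HB Hd; induction l as [|i l' IH].
  - rewrite !sumsq_nil; simpl; lra.
  - rewrite !sumsq_cons; simpl length; rewrite S_INR.
    assert (IH' := IH (fun j Hj => Hub j (or_intror Hj)) (fun j Hj => Hdd j (or_intror Hj))).
    assert (Hv : Cmod (inner (matrix_row i) x) ^ 2 <= Cmod (u i) ^ 2 + (2 * B * d + d ^ 2)).
    { assert (H1 := Hub i (or_introl eq_refl)); assert (H2 := Hdd i (or_introl eq_refl)).
      set (v := inner (matrix_row i) x) in *.
      assert (H3 : Cmod v <= Cmod (u i) + d).
      { replace v with (u i + - (u i - v))%C by ring.
        eapply Rle_trans; [apply Cmod_triangle|]; rewrite Cmod_opp; lra. }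
      generalize (Cmod_ge_0 v) (Cmod_ge_0 (u i)); intros.
      apply Rle_trans with ((Cmod (u i) + d) ^ 2); [apply pow_incr; lra|nra]. }
    nra. }
assert (Hd3 : n * (2 * B + 1) * d <= eps).
{ apply Rle_trans with ((n * (2 * B + 1) + 1) * d); [nra|].
  apply Rle_trans with ((n * (2 * B + 1) + 1) * (eps / (n * (2 * B + 1) + 1))).
  - apply Rmult_le_compat_l; [lra|exact Hd2].
  - right; field; lra. }
assert (Hd4 : n * (2 * B * d + d ^ 2) <= n * (2 * B + 1) * d).
{ rewrite (Rmult_assoc n); apply Rmult_le_compat_l; [exact Hn|nra]. }
lra.
Qed.

Lemma matrix_apply_summable (x : ell2 I) : square_summable (fun i => inner (matrix_row i) x).
Proof. eexists; intros l Hl; apply matrix_apply_bound; exact Hl. Qed.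

Definition matrix_apply (x : ell2 I) : ell2 I := exist _ _ (matrix_apply_summable x).

Lemma matrix_apply_plus x y :
  matrix_apply (plus x y) = plus (matrix_apply x) (matrix_apply y).
Proof. apply ell2_eq; intro i; simpl; apply (inner_plus_r I_dec). Qed.

Lemma matrix_apply_scal (c : C) x :
  matrix_apply (scal c x) = scal c (matrix_apply x).
Proof. apply ell2_eq; intro i; simpl; apply (inner_scal_r I_dec). Qed.

Lemma matrix_apply_hnorm x : hnorm (matrix_apply x) <= M * hnorm x.
Proof.
apply hnorm_le; [apply Rmult_le_pos; [exact HM|apply hnorm_ge0]|].
intros l Hl; apply matrix_apply_bound; exact Hl.
Qed.

Definition matrix_op : bounded_op I :=
  BoundedOp matrix_apply_plus matrix_apply_scal (ex_intro _ M matrix_apply_hnorm).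

Lemma ent_matrix_op i k : ent matrix_op i k = m i k.
Proof.
unfold ent; simpl; rewrite (inner_basis_r I_dec); simpl; apply Cconj_conj.
Qed.

End OfMatrix.

Lemma op_of_matrix (m : I -> I -> C) (M : R) : 0 <= M -> matrix_bound m M ->
  exists A, (forall i k, ent A i k = m i k) /\ opbound A M.
Proof.
intros HM Hm; exists (matrix_op m M HM Hm); split; [apply ent_matrix_op|].
exact (matrix_apply_hnorm m M HM Hm).
Qed.

Lemma opbound_of_matrix (A : bounded_op I) (M : R) :
  0 <= M -> matrix_bound (ent A) M -> opbound A M.
Proof.
intros HM Hm; destruct (op_of_matrix _ M HM Hm) as [B [HB HBM]].
replace A with B by (apply op_ent_ext; exact HB); exact HBM.
Qed.

(** Entries are required to stabilise, not merely to converge. Clipped diagonal operators provide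
    this, and a finite section of [m] is then exactly a section of some [A n]. *)
Lemma matrix_bound_limit (A : nat -> bounded_op I) (m : I -> I -> C) (M : R) :
  0 <= M -> (forall n, opbound (A n) M) ->
  (forall i k, exists N, forall n, (N <= n)%nat -> ent (A n) i k = m i k) ->
  matrix_bound m M.
Proof.
intros HM HA Hlim l l' y Hl Hl'.
assert (H : exists N, forall n, (N <= n)%nat -> forall i, In i l -> forall k, In k l' ->
   ent (A n) i k = m i k).
{ clear Hl; induction l as [|i l IH]; [exists 0%nat; intros n _ i []|].
  destruct IH as [N HN].
  assert (H : exists N', forall n, (N' <= n)%nat -> forall k, In k l' ->
     ent (A n) i k = m i k).
  { clear Hl'; induction l' as [|k l' IH]; [exists 0%nat; intros n _ k []|].
    destruct IH as [N1 HN1].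
    { intros n Hn j Hj k' Hk'; apply HN; trivial; right; exact Hk'. }
    destruct (Hlim i k) as [N2 HN2].
    exists (N1 + N2)%nat; intros n Hn k' [<-|Hk']; [apply HN2|apply HN1]; trivial; lia. }
  destruct H as [N' HN'].
  exists (N + N')%nat; intros n Hn j [<-|Hj] k Hk; [apply HN'|apply HN]; trivial; lia. }
destruct H as [N HN].
eapply Rle_trans; [|apply (opbound_matrix _ _ HM (HA N) l l' y Hl Hl')].
right; apply lsum_ext; intros i Hi; do 2 f_equal; apply lsum_ext; intros k Hk.
rewrite HN; trivial.
Qed.

Lemma opbound_limit (A : nat -> bounded_op I) (B : bounded_op I) (M : R) :
  0 <= M -> (forall n, opbound (A n) M) ->
  (forall i k, exists N, forall n, (N <= n)%nat -> ent (A n) i k = ent B i k) ->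
  opbound B M.
Proof.
intros HM HA Hlim; apply opbound_of_matrix; [exact HM|].
apply matrix_bound_limit with A; trivial.
Qed.

Lemma ent_le A M i k : opbound A M -> Cmod (ent A i k) <= M.
Proof.
intro H; eapply Rle_trans; [apply coord_le|]; eapply Rle_trans; [apply H|].
rewrite hnorm_basis; lra.
Qed.

(** Cauchy-Schwarz on each row, with the 0-1 indicator [chi] of the neighbour relation, costs one
    factor [c]; exchanging the two sums counts neighbours once more and costs the other. Symmetry of
    [near] makes rows as sparse as columns. *)
Lemma schur_test (near : I -> list I) (m : I -> I -> C) (B : R) (c : nat) :
  0 <= B ->
  (forall i, (length (near i) <= c)%nat) ->
  (forall i k, In i (near k) -> In k (near i)) ->
  (forall i k, Cmod (m i k) <= B) ->
  (forall i k, ~ In i (near k) -> m i k = RtoC 0) ->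
  matrix_bound m (INR c * B).
Proof.
intros HB Hc Hs Hm Hz l l' y Hl Hl'.
assert (Hcnt : forall k l, NoDup l ->
  lsum (fun i => if in_dec I_dec i (near k) then 1 else 0) l <= INR c).
{ clear -Hc; intros k l Hl.
  replace (lsum _ l) with (INR (length (filter (fun i => if in_dec I_dec i (near k) then true else false) l))).
  - apply le_INR; eapply Nat.le_trans; [|apply (Hc k)].
    apply NoDup_incl_length; [apply NoDup_filter; exact Hl|].
    intros i Hi; apply filter_In in Hi; destruct Hi as [_ Hi].
    destruct (in_dec I_dec i (near k)); [trivial|discriminate].
  - clear; induction l as [|i l IH]; [reflexivity|].
    rewrite lsum_cons_R, <- IH; simpl filter.
    destruct (in_dec I_dec i (near k)); [simpl length; rewrite S_INR|]; ring. }
set (chi := fun i k => if in_dec I_dec i (near k) then 1 else 0).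
assert (Hchi : forall i k, chi i k = chi k i).
{ intros i k; unfold chi.
  destruct (in_dec I_dec i (near k)), (in_dec I_dec k (near i)); trivial; exfalso; auto. }
assert (Hchi2 : forall i k, chi i k = chi i k ^ 2 /\ 0 <= chi i k).
{ intros i k; unfold chi; destruct (in_dec I_dec i (near k)); lra. }
assert (Hchim : forall i k, Cmod (m i k) <= B * chi i k).
{ intros i k; unfold chi; destruct (in_dec I_dec i (near k)); [rewrite Rmult_1_r; auto|].
  rewrite Hz, Cmod_0; trivial; lra. }
assert (Hrow : forall i, Cmod (lsum (fun k => m i k * y k)%C l') ^ 2
  <= B ^ 2 * INR c * lsum (fun k => chi i k * Cmod (y k) ^ 2) l').
{ intro i.
  assert (H1 : Cmod (lsum (fun k => m i k * y k)%C l')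
     <= B * lsum (fun k => Cmod (RtoC (chi i k)) * Cmod (RtoC (chi i k) * y k)%C) l').
  { eapply Rle_trans; [apply Cmod_lsum|]; rewrite <- lsum_scal_R; apply lsum_le.
    intros k _; rewrite !Cmod_mult, Cmod_R, Rabs_pos_eq by apply Hchi2.
    replace (B * (chi i k * (chi i k * Cmod (y k)))) with (B * chi i k ^ 2 * Cmod (y k)) by ring.
    rewrite <- (proj1 (Hchi2 i k)); apply Rmult_le_compat_r; [apply Cmod_ge_0|apply Hchim]. }
  assert (H2 := lsum_Cauchy_Schwarz (fun k => RtoC (chi i k)) (fun k => RtoC (chi i k) * y k)%C l').
  assert (E1 : sumsq (fun k => RtoC (chi i k)) l' <= INR c).
  { eapply Rle_trans; [|apply (Hcnt i l' Hl')]; apply lsum_le; intros k _.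
    rewrite Cmod_R, Rabs_pos_eq by apply Hchi2; rewrite <- (proj1 (Hchi2 i k)).
    rewrite Hchi; apply Rle_refl. }
  assert (E2 : sumsq (fun k => RtoC (chi i k) * y k)%C l' = lsum (fun k => chi i k * Cmod (y k) ^ 2) l').
  { apply lsum_ext; intros k _; rewrite Cmod_mult, Cmod_R, Rabs_pos_eq by apply Hchi2.
    rewrite Rpow_mult_distr, <- (proj1 (Hchi2 i k)); reflexivity. }
  rewrite E2 in H2; set (s := lsum (fun k => chi i k * Cmod (y k) ^ 2) l') in *.
  assert (Hs0 : 0 <= s).
  { apply lsum_ge0; intro k; apply Rmult_le_pos; [apply Hchi2|apply pow2_ge_0]. }
  apply Rle_trans with ((B * (sqrt (INR c) * sqrt s)) ^ 2).
  - apply pow_incr; split; [apply Cmod_ge_0|].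
    eapply Rle_trans; [exact H1|]; apply Rmult_le_compat_l; [exact HB|].
    eapply Rle_trans; [exact H2|]; apply Rmult_le_compat_r; [apply sqrt_pos|].
    apply sqrt_le_1_alt; exact E1.
  - rewrite !Rpow_mult_distr, !pow2_sqrt; [lra|exact Hs0|apply pos_INR]. }
apply Rle_trans with (B ^ 2 * INR c * lsum (fun i => lsum (fun k => chi i k * Cmod (y k) ^ 2) l') l).
{ rewrite <- lsum_scal_R; apply lsum_le; intros i _; apply Hrow. }
rewrite lsum_swap.
replace ((INR c * B) ^ 2 * sumsq y l') with (B ^ 2 * INR c * (INR c * sumsq y l')) by ring.
apply Rmult_le_compat_l; [apply Rmult_le_pos; [apply pow2_ge_0|apply pos_INR]|].
unfold sumsq; rewrite <- lsum_scal_R; apply lsum_le; intros k _.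
rewrite (lsum_ext _ (fun i => Cmod (y k) ^ 2 * chi i k)) by (intros; apply Rmult_comm).
rewrite lsum_scal_R, Rmult_comm; apply Rmult_le_compat_r; [apply pow2_ge_0|].
apply Hcnt; exact Hl.
Qed.

End Matrix.

(** * Commutators and uniformly bounded families *)

Ltac op_ring := apply op_ext; intro; simpl; rewrite ?op_plus, ?op_scal, ?op_plus, ?op_scal, ?op_plus, ?op_scal;
  apply ell2_eq; intro; rewrite ?coord_plus, ?coord_scal, ?coord_plus, ?coord_scal; try ring.

Section Algebra.
Context {I : Type} (I_dec : forall i j : I, {i = j} + {i <> j}).
Implicit Types A B E R T : bounded_op I.

Definition sub_op A B := add_op A (scal_op (RtoC (-1)) B).
Definition zero_op : bounded_op I := scal_op (RtoC 0) one_op.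
Definition comm E A := sub_op (mul_op E A) (mul_op A E).
Definition acomm E A := add_op (mul_op E A) (mul_op A E).

Lemma opp_opp_op A : scal_op (RtoC (-1)) (scal_op (RtoC (-1)) A) = A.
Proof. op_ring. Qed.
Lemma comm_one E : comm E one_op = zero_op.
Proof. op_ring. Qed.
Lemma comm_zero E : comm E zero_op = zero_op.
Proof. op_ring. Qed.
Lemma acomm_zero E : acomm E zero_op = zero_op.
Proof. op_ring. Qed.
Lemma comm_add E A B : comm E (add_op A B) = add_op (comm E A) (comm E B).
Proof. op_ring. Qed.
Lemma acomm_add E A B : acomm E (add_op A B) = add_op (acomm E A) (acomm E B).
Proof. op_ring. Qed.
Lemma comm_scal E c A : comm E (scal_op c A) = scal_op c (comm E A).
Proof. op_ring. Qed.
Lemma acomm_scal E c A : acomm E (scal_op c A) = scal_op c (acomm E A).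
Proof. op_ring. Qed.
Lemma comm_mul E A B : comm E (mul_op A B) = add_op (mul_op (comm E A) B) (mul_op A (comm E B)).
Proof. op_ring. Qed.
(** Sign rules of a grading: with [comm] measuring evenness and [acomm] oddness, a product of an odd
    and an even operator is odd, and a product of two odd ones is even. *)
Lemma acomm_mul_l E A B : acomm E (mul_op A B) = sub_op (mul_op (acomm E A) B) (mul_op A (comm E B)).
Proof. op_ring. Qed.
Lemma acomm_mul_r E A B : acomm E (mul_op A B) = add_op (mul_op (comm E A) B) (mul_op A (acomm E B)).
Proof. op_ring. Qed.
Lemma comm_mul_acomm E A B : comm E (mul_op A B) = sub_op (mul_op (acomm E A) B) (mul_op A (acomm E B)).
Proof. op_ring. Qed.

Lemma comm_comm_mul E F A B : comm F (comm E (mul_op A B)) =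
  add_op (add_op (mul_op (comm F (comm E A)) B) (mul_op (comm E A) (comm F B)))
    (add_op (mul_op (comm F A) (comm E B)) (mul_op A (comm F (comm E B)))).
Proof. rewrite !comm_mul, comm_add, !comm_mul; reflexivity. Qed.

Lemma acomm_comm_mul E F A B : acomm F (comm E (mul_op A B)) =
  add_op (sub_op (mul_op (acomm F (comm E A)) B) (mul_op (comm E A) (comm F B)))
    (add_op (mul_op (comm F A) (comm E B)) (mul_op A (acomm F (comm E B)))).
Proof. rewrite comm_mul, acomm_add, acomm_mul_l, acomm_mul_r; reflexivity. Qed.

(** Insert [l - T] next to [R] on the free side of each term: E R - R E = R ((l - T) E - E (l - T))
    R, and the scalar [l] cancels. *)
Lemma comm_resolvent l T R E : is_inverse (shift_op l T) R ->
  comm E R = mul_op R (mul_op (comm E T) R).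
Proof.
intros [H1 H2].
assert (K1 : forall x, shift_op l T (R x) = x).
{ intro x; exact (f_equal (fun A : bounded_op I => A x) H1). }
assert (K2 : forall x, R (shift_op l T x) = x).
{ intro x; exact (f_equal (fun A : bounded_op I => A x) H2). }
apply op_ext; intro x.
transitivity (plus (R (shift_op l T (E (R x))))
  (@scal C_Ring ell2_ModuleSpace (RtoC (-1)) (R (E (shift_op l T (R x)))))).
{ rewrite K1, K2; reflexivity. }
simpl; rewrite ?op_plus, ?op_scal, ?op_plus, ?op_scal.
apply ell2_eq; intro; rewrite ?coord_plus, ?coord_scal, ?coord_plus, ?coord_scal; ring.
Qed.

Lemma comm_comm_resolvent l T R E F : is_inverse (shift_op l T) R ->
  comm F (comm E R) = add_op (mul_op (comm F R) (mul_op (comm E T) R))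
    (mul_op R (add_op (mul_op (comm F (comm E T)) R) (mul_op (comm E T) (comm F R)))).
Proof. intro H; rewrite (comm_resolvent l T R E H), !comm_mul; reflexivity. Qed.

Lemma acomm_comm_resolvent l T R E F : is_inverse (shift_op l T) R ->
  acomm F (comm E R) = add_op (mul_op (comm F R) (mul_op (comm E T) R))
    (mul_op R (sub_op (mul_op (acomm F (comm E T)) R) (mul_op (comm E T) (comm F R)))).
Proof. intro H; rewrite (comm_resolvent l T R E H), acomm_mul_r, acomm_mul_l; reflexivity. Qed.

Lemma opbound_add A B M N : opbound A M -> opbound B N -> opbound (add_op A B) (M + N).
Proof.
intros HA HB x; simpl; eapply Rle_trans; [apply (hnorm_triangle I_dec)|].
generalize (HA x) (HB x); lra.
Qed.

Lemma opbound_scal c A M : opbound A M -> opbound (scal_op c A) (Cmod c * M).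
Proof.
intros HA x; simpl; rewrite (hnorm_scal I_dec), Rmult_assoc.
apply Rmult_le_compat_l; [apply Cmod_ge_0|apply HA].
Qed.

Lemma opbound_mul A B M N : 0 <= M -> opbound A M -> opbound B N -> opbound (mul_op A B) (M * N).
Proof.
intros HM HA HB x; simpl; eapply Rle_trans; [apply HA|].
rewrite Rmult_assoc; apply Rmult_le_compat_l; [exact HM|apply HB].
Qed.

Lemma opbound_le A M N : M <= N -> opbound A M -> opbound A N.
Proof.
intros H HA x; eapply Rle_trans; [apply HA|].
apply Rmult_le_compat_r; [apply hnorm_ge0|exact H].
Qed.

(** The index type varies: truncation levels, pairs of levels, and later such levels together with a
    point of a contour. *)
Definition ubounded {P : Type} (A : P -> bounded_op I) : Prop :=
  exists M, 0 <= M /\ forall p, opbound (A p) M.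

Lemma ubounded_const {P : Type} A : ubounded (fun _ : P => A).
Proof. destruct (op_bounded_pos A) as [M [HM HA]]; exists M; split; [|intro p]; trivial. Qed.

Lemma ubounded_comp {P Q : Type} (A : P -> bounded_op I) (f : Q -> P) :
  ubounded A -> ubounded (fun p => A (f p)).
Proof. intros [M [HM HA]]; exists M; split; [trivial|intro p; apply HA]. Qed.

Lemma ubounded_add {P : Type} (A B : P -> bounded_op I) :
  ubounded A -> ubounded B -> ubounded (fun p => add_op (A p) (B p)).
Proof.
intros [M [HM HA]] [N [HN HB]]; exists (M + N); split; [lra|intro p].
apply opbound_add; trivial.
Qed.

Lemma ubounded_scal {P : Type} c (A : P -> bounded_op I) :
  ubounded A -> ubounded (fun p => scal_op c (A p)).
Proof.
intros [M [HM HA]]; exists (Cmod c * M); split.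
- apply Rmult_le_pos; [apply Cmod_ge_0|exact HM].
- intro p; apply opbound_scal; trivial.
Qed.

Lemma ubounded_sub {P : Type} (A B : P -> bounded_op I) :
  ubounded A -> ubounded B -> ubounded (fun p => sub_op (A p) (B p)).
Proof. intros HA HB; apply ubounded_add; [exact HA|apply ubounded_scal; exact HB]. Qed.

Lemma ubounded_mul {P : Type} (A B : P -> bounded_op I) :
  ubounded A -> ubounded B -> ubounded (fun p => mul_op (A p) (B p)).
Proof.
intros [M [HM HA]] [N [HN HB]]; exists (M * N); split; [apply Rmult_le_pos; trivial|].
intro p; apply opbound_mul; trivial.
Qed.

Lemma ubounded_ext {P : Type} (A B : P -> bounded_op I) :
  (forall p, A p = B p) -> ubounded A -> ubounded B.
Proof. intros H [M [HM HA]]; exists M; split; [trivial|intro p; rewrite <- H; apply HA]. Qed.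

End Algebra.

(** * Adjoints and weakly continuous functionals *)

Section Adjoint.
Context {I : Type} (I_dec : forall i j : I, {i = j} + {i <> j}).
Implicit Types A B E R T X : bounded_op I.

Lemma adjoint_add A A' B B' : is_adjoint A A' -> is_adjoint B B' ->
  is_adjoint (add_op A B) (add_op A' B').
Proof.
intros HA HB x y; simpl.
rewrite (inner_plus_l I_dec), (inner_plus_r I_dec), HA, HB; reflexivity.
Qed.

Lemma adjoint_opp A A' : is_adjoint A A' ->
  is_adjoint (scal_op (RtoC (-1)) A) (scal_op (RtoC (-1)) A').
Proof.
intros HA x y; simpl.
rewrite (inner_scal_l I_dec), (inner_scal_r I_dec), HA, Cconj_R; reflexivity.
Qed.

Lemma adjoint_mul A A' B B' : is_adjoint A A' -> is_adjoint B B' ->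
  is_adjoint (mul_op A B) (mul_op B' A').
Proof. intros HA HB x y; simpl; rewrite HB, HA; reflexivity. Qed.

Lemma adjoint_sub A A' B B' : is_adjoint A A' -> is_adjoint B B' ->
  is_adjoint (sub_op A B) (sub_op A' B').
Proof. intros HA HB; apply adjoint_add; [exact HA|apply adjoint_opp; exact HB]. Qed.

Lemma adjoint_comm E A A' : is_adjoint E E -> is_adjoint A A' ->
  is_adjoint (comm E A) (scal_op (RtoC (-1)) (comm E A')).
Proof.
intros HE HA.
replace (scal_op (RtoC (-1)) (comm E A')) with (sub_op (mul_op A' E) (mul_op E A'))
  by op_ring.
apply adjoint_sub; apply adjoint_mul; trivial.
Qed.

Lemma adjoint_acomm E A A' : is_adjoint E E -> is_adjoint A A' ->
  is_adjoint (acomm E A) (acomm E A').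
Proof.
intros HE HA.
replace (acomm E A') with (add_op (mul_op A' E) (mul_op E A')) by op_ring.
apply adjoint_add; apply adjoint_mul; trivial.
Qed.

Lemma opbound_adjoint A B M : 0 <= M -> is_adjoint A B -> opbound A M -> opbound B M.
Proof.
intros HM H HA x.
assert (H1 : hnorm (B x) ^ 2 <= hnorm x * (M * hnorm (B x))).
{ rewrite <- (Rabs_pos_eq (hnorm (B x) ^ 2)), <- Cmod_R by apply pow2_ge_0.
  rewrite <- (hnorm_inner I_dec), H.
  eapply Rle_trans; [apply (inner_le I_dec)|].
  apply Rmult_le_compat_l; [apply hnorm_ge0|apply HA]. }
generalize (hnorm_ge0 (B x)) (hnorm_ge0 x); intros H2 H3.
destruct (Req_dec (hnorm (B x)) 0) as [E|E].
- rewrite E; apply Rmult_le_pos; trivial.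
- apply Rmult_le_reg_r with (hnorm (B x)); [lra|nra].
Qed.

Lemma ubounded_adjoint {P : Type} (A B : P -> bounded_op I) :
  (forall p, is_adjoint (A p) (B p)) -> ubounded A -> ubounded B.
Proof.
intros H [M [HM HA]]; exists M; split; [trivial|intro p].
apply opbound_adjoint with (A p); trivial.
Qed.

Lemma ubounded_opp {P : Type} (A : P -> bounded_op I) :
  ubounded (fun p => scal_op (RtoC (-1)) (A p)) -> ubounded A.
Proof.
intro H; apply ubounded_ext with (fun p => scal_op (RtoC (-1)) (scal_op (RtoC (-1)) (A p))).
- intro p; apply opp_opp_op.
- apply (ubounded_scal I_dec); exact H.
Qed.

(** Functionals of this form commute with the weak contour integral that
    defines the holomorphic functional calculus. *)
Definition weak_sum (L : list (ell2 I * ell2 I)) A : C :=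
  lsum (fun p => inner (fst p) (A (snd p))) L.

Definition weakly_linear (Psi : bounded_op I -> bounded_op I) : Prop :=
  forall x y, exists L, forall A, inner x (Psi A y) = weak_sum L A.

Lemma weakly_linear_id : weakly_linear (fun A => A).
Proof.
intros x y; exists [(x, y)]; intro A; unfold weak_sum.
rewrite lsum_cons_C, lsum_nil_C; simpl; ring.
Qed.

Lemma weakly_linear_add F G : weakly_linear F -> weakly_linear G ->
  weakly_linear (fun A => add_op (F A) (G A)).
Proof.
intros HF HG x y; destruct (HF x y) as [L HL], (HG x y) as [K HK].
exists (L ++ K); intro A; unfold weak_sum; rewrite lsum_app_C.
simpl; rewrite (inner_plus_r I_dec), HL, HK; reflexivity.
Qed.

Lemma weakly_linear_opp F : weakly_linear F ->
  weakly_linear (fun A => scal_op (RtoC (-1)) (F A)).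
Proof.
intros HF x y; destruct (HF (@scal C_Ring ell2_ModuleSpace (RtoC (-1)) x) y) as [L HL].
exists L; intro A; rewrite <- HL; simpl.
rewrite (inner_scal_l I_dec), (inner_scal_r I_dec), Cconj_R; reflexivity.
Qed.

Lemma weakly_linear_mul_l E F : is_adjoint E E -> weakly_linear F ->
  weakly_linear (fun A => mul_op E (F A)).
Proof.
intros HE HF x y; destruct (HF (E x) y) as [L HL]; exists L; intro A.
simpl; rewrite <- HE; apply HL.
Qed.

Lemma weakly_linear_mul_r E F : weakly_linear F ->
  weakly_linear (fun A => mul_op (F A) E).
Proof. intros HF x y; destruct (HF x (E y)) as [L HL]; exists L; exact HL. Qed.

Lemma weakly_linear_comm E F : is_adjoint E E -> weakly_linear F ->
  weakly_linear (fun A => comm E (F A)).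
Proof.
intros HE HF; apply weakly_linear_add; [apply weakly_linear_mul_l; trivial|].
apply weakly_linear_opp, weakly_linear_mul_r; exact HF.
Qed.

Lemma weakly_linear_acomm E F : is_adjoint E E -> weakly_linear F ->
  weakly_linear (fun A => acomm E (F A)).
Proof.
intros HE HF; apply weakly_linear_add; [apply weakly_linear_mul_l; trivial|].
apply weakly_linear_mul_r; exact HF.
Qed.

Lemma opbound_weak A M : 0 <= M ->
  (forall x y, Cmod (inner x (A y)) <= M * (hnorm x * hnorm y)) -> opbound A M.
Proof.
intros HM H x.
assert (H1 := H (A x) x); rewrite (hnorm_inner I_dec), Cmod_R in H1.
rewrite Rabs_pos_eq in H1 by apply pow2_ge_0.
generalize (hnorm_ge0 (A x)) (hnorm_ge0 x); intros.
destruct (Req_dec (hnorm (A x)) 0) as [E|E].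
- rewrite E; apply Rmult_le_pos; trivial.
- apply Rmult_le_reg_r with (hnorm (A x)); [lra|nra].
Qed.

End Adjoint.

(** * Compactness, continuity and integration on [0,1] *)

Section Contour.

(** Compactness by a supremum argument: monotonicity of [P] in the bound lets the bound up to a
    point below [m] merge with the local bound around [m], which pushes the reachable set past [m]
    unless [m] is 1. *)
Lemma local_bound_01 (P : R -> R -> Prop) :
  (forall s M N, M <= N -> P s M -> P s N) ->
  (forall t, 0 <= t <= 1 -> exists d M, 0 < d /\
     forall s, 0 <= s <= 1 -> Rabs (s - t) < d -> P s M) ->
  exists M, forall s, 0 <= s <= 1 -> P s M.
Proof.
intros Hmono Hloc.
set (E := fun x => 0 <= x <= 1 /\ exists M, forall s, 0 <= s <= x -> P s M).
destruct (completeness E) as [m [Hm1 Hm2]].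
{ exists 1; intros x [Hx _]; lra. }
{ exists 0; split; [lra|].
  destruct (Hloc 0) as [d [M [Hd HM]]]; [lra|]; exists M; intros s Hs; apply HM; [lra|].
  replace (s - 0) with 0 by lra; rewrite Rabs_R0; exact Hd. }
assert (Hm : 0 <= m <= 1).
{ split; [|apply Hm2; intros x [Hx _]; lra].
  apply Hm1; split; [lra|].
  destruct (Hloc 0) as [d [M [Hd HM]]]; [lra|]; exists M; intros s Hs; apply HM; [lra|].
  replace (s - 0) with 0 by lra; rewrite Rabs_R0; exact Hd. }
destruct (Hloc m Hm) as [d [M [Hd HM]]].
assert (Hex : exists x, E x /\ m - d < x).
{ apply NNPP; intro Hn; assert (m <= m - d); [|lra].
  apply Hm2; intros x Hx; apply Rnot_lt_le; intro; apply Hn; exists x; auto. }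
destruct Hex as [x [[Hx [N HN]] Hxm]].
assert (Hxm' : x <= m) by (apply Hm1; split; [exact Hx|exists N; exact HN]).
set (y := Rmin 1 (m + d / 2)).
assert (Hy1 : y <= 1) by apply Rmin_l.
assert (Hy2 : y <= m + d / 2) by apply Rmin_r.
assert (HP : forall s, 0 <= s <= y -> P s (Rmax M N)).
{ intros s Hs; destruct (Rle_dec s x) as [H|H].
  - apply Hmono with N; [apply Rmax_r|apply HN; lra].
  - apply Hmono with M; [apply Rmax_l|apply HM; [lra|apply Rabs_def1; lra]]. }
assert (Hy3 : 0 <= y) by (apply Rmin_glb; lra).
assert (Hym : y <= m) by (apply Hm1; split; [lra|exists (Rmax M N); exact HP]).
assert (Hy : y = 1).
{ unfold y, Rmin in *; destruct (Rle_dec 1 (m + d / 2)); lra. }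
exists (Rmax M N); intros s Hs; apply HP; lra.
Qed.

Definition cont01 (F : R -> C) : Prop :=
  forall t, 0 <= t <= 1 -> forall eps, 0 < eps -> exists d, 0 < d /\
    forall s, 0 <= s <= 1 -> Rabs (s - t) < d -> Cmod (F s - F t) < eps.

Lemma cont01_bounded F : cont01 F ->
  exists M, forall s, 0 <= s <= 1 -> Cmod (F s) <= M.
Proof.
intro HF; apply local_bound_01; [intros s M N; lra|].
intros t Ht; destruct (HF t Ht 1) as [d [Hd H]]; [lra|].
exists d, (Cmod (F t) + 1); split; [exact Hd|intros s Hs Hst].
replace (F s) with (F t + (F s - F t))%C by ring.
eapply Rle_trans; [apply Cmod_triangle|]; generalize (H s Hs Hst); lra.
Qed.

Lemma cont01_mult F G : cont01 F -> cont01 G -> cont01 (fun t => F t * G t)%C.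
Proof.
intros HF HG t Ht eps Heps.
set (a := Cmod (F t)); set (b := Cmod (G t)).
assert (Ha : 0 <= a) by apply Cmod_ge_0; assert (Hb : 0 <= b) by apply Cmod_ge_0.
set (e := Rmin 1 (eps / (a + b + 2))).
assert (He : 0 < e) by (apply Rmin_glb_lt; [lra|apply Rdiv_lt_0_compat; lra]).
assert (He1 : e <= 1) by apply Rmin_l.
assert (He2 : (a + b + 2) * e <= eps).
{ apply Rle_trans with ((a + b + 2) * (eps / (a + b + 2))); [|right; field; lra].
  apply Rmult_le_compat_l; [lra|apply Rmin_r]. }
destruct (HF t Ht e He) as [d [Hd H]], (HG t Ht e He) as [d' [Hd' H']].
exists (Rmin d d'); split; [apply Rmin_glb_lt; trivial|intros s Hs Hst].
assert (H1 := H s Hs (Rlt_le_trans _ _ _ Hst (Rmin_l _ _))).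
assert (H2 := H' s Hs (Rlt_le_trans _ _ _ Hst (Rmin_r _ _))).
replace (F s * G s - F t * G t)%C
  with ((F s - F t) * (G s - G t) + ((F s - F t) * G t + F t * (G s - G t)))%C by ring.
eapply Rle_lt_trans; [apply Cmod_triangle|].
eapply Rle_lt_trans; [apply Rplus_le_compat_l, Cmod_triangle|].
rewrite !Cmod_mult; fold a b.
generalize (Cmod_ge_0 (F s - F t)) (Cmod_ge_0 (G s - G t)); intros; nra.
Qed.

Lemma cont01_of_continuous (F : R -> C) :
  (forall t, 0 <= t <= 1 -> @continuous R_UniformSpace C_UniformSpace F t) -> cont01 F.
Proof.
intros H t Ht eps Heps.
assert (Heps' : 0 < eps / 2) by lra.
destruct (proj1 (filterlim_locally _ _) (H t Ht) (mkposreal _ Heps')) as [d Hd].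
exists d; split; [apply cond_pos|intros s Hs Hst].
generalize (Cmod_ball _ _ _ (Hd s Hst)); simpl; lra.
Qed.

(** A path is tied to the cycle on [0,1] only, but [ex_RInt_continuous] needs
    two-sided continuity at the end points. *)
Definition clamp01 (t : R) : R := Rmax 0 (Rmin 1 t).

Lemma clamp01_range t : 0 <= clamp01 t <= 1.
Proof. unfold clamp01, Rmax, Rmin; destruct (Rle_dec 1 t);
  match goal with |- context [Rle_dec ?a ?b] => destruct (Rle_dec a b) end; lra. Qed.

Lemma clamp01_id t : 0 <= t <= 1 -> clamp01 t = t.
Proof. unfold clamp01, Rmax, Rmin; destruct (Rle_dec 1 t);
  match goal with |- context [Rle_dec ?a ?b] => destruct (Rle_dec a b) end; lra. Qed.

Lemma clamp01_dist s t : Rabs (clamp01 s - clamp01 t) <= Rabs (s - t).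
Proof.
unfold clamp01, Rmax, Rmin, Rabs; destruct (Rle_dec 1 s), (Rle_dec 1 t);
repeat match goal with |- context [Rle_dec ?a ?b] => destruct (Rle_dec a b) end;
repeat match goal with |- context [Rcase_abs ?a] => destruct (Rcase_abs a) end; lra.
Qed.

Lemma cont01_ex_RInt F : cont01 F -> @ex_RInt C_R_NormedModule F 0 1.
Proof.
intro HF.
apply (@ex_RInt_ext C_R_NormedModule (fun t => F (clamp01 t))).
{ intros t Ht; rewrite Rmin_left, Rmax_right in Ht by lra.
  rewrite clamp01_id by lra; reflexivity. }
apply (@ex_RInt_continuous C_R_CompleteNormedModule).
intros t Ht; rewrite Rmin_left, Rmax_right in Ht by lra.
apply filterlim_locally; intro eps.
destruct (HF t Ht eps (cond_pos eps)) as [d [Hd H]].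
exists (mkposreal d Hd); intros s Hs; apply ball_Cmod.
rewrite (clamp01_id t) by exact Ht; apply H; [apply clamp01_range|].
rewrite <- (clamp01_id t) by exact Ht.
eapply Rle_lt_trans; [apply clamp01_dist|exact Hs].
Qed.

Lemma norm_C_R (z : C) : @norm R_AbsRing C_R_NormedModule z = Cmod z.
Proof.
unfold norm; simpl; unfold prod_norm, Cmod; f_equal.
unfold norm; simpl; unfold abs; simpl. rewrite !Rmult_1_r.
rewrite <- !Rabs_mult, !Rabs_pos_eq; [reflexivity| |]; apply Rle_0_sqr.
Qed.

End Contour.

(** * Contour integrals of resolvents *)

Section Resolvent.
Context {I : Type} (I_dec : forall i j : I, {i = j} + {i <> j}).
Implicit Types A B E R T X : bounded_op I.

Lemma resolvent_identity T l m R S :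
  is_inverse (shift_op l T) R -> is_inverse (shift_op m T) S ->
  forall x, S x = plus (R x) (@scal C_Ring ell2_ModuleSpace (l - m)%C (R (S x))).
Proof.
intros [_ H1] [H2 _] x.
assert (K1 : forall x, R (shift_op l T x) = x).
{ intro y; exact (f_equal (fun A : bounded_op I => A y) H1). }
assert (K2 : shift_op m T (S x) = x).
{ exact (f_equal (fun A : bounded_op I => A x) H2). }
transitivity (plus (R (shift_op m T (S x)))
  (@scal C_Ring ell2_ModuleSpace (l - m)%C (R (S x)))); [|rewrite K2; reflexivity].
rewrite <- (K1 (S x)) at 1; simpl; rewrite !op_plus, !op_scal.
apply ell2_eq; intro; rewrite ?coord_plus, ?coord_scal, ?coord_plus, ?coord_scal; ring.
Qed.

(** The second resolvent [S] is already given, so no Neumann series is summed: in S x = R x + (l -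
    m) R S x the last term has norm at most half that of S x and is absorbed on the left. *)
Lemma resolvent_bound_near T l m R S N :
  is_inverse (shift_op l T) R -> is_inverse (shift_op m T) S ->
  0 <= N -> opbound R N -> Cmod (l - m) * N <= / 2 -> opbound S (2 * N).
Proof.
intros HR HS HN HB Hd x.
assert (H : hnorm (S x) <= N * hnorm x + / 2 * hnorm (S x)).
{ rewrite (resolvent_identity T l m R S HR HS x) at 1.
  eapply Rle_trans; [apply (hnorm_triangle I_dec)|].
  apply Rplus_le_compat; [apply HB|].
  rewrite (hnorm_scal I_dec).
  apply Rle_trans with (Cmod (l - m) * (N * hnorm (S x))).
  - apply Rmult_le_compat_l; [apply Cmod_ge_0|apply HB].
  - rewrite <- Rmult_assoc; apply Rmult_le_compat_r; [apply hnorm_ge0|exact Hd]. }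
lra.
Qed.

Section Loop.
Context (T : bounded_op I) (res : C -> bounded_op I) (p : R -> C).
Hypothesis p_cont : cont01 p.
Hypothesis res_inv : forall t, 0 <= t <= 1 -> is_inverse (shift_op (p t) T) (res (p t)).

(** [is_hfc] supplies inverses along the cycle without any common bound. Local boundedness around
    each parameter and compactness of [0,1] produce one. *)
Lemma resolvent_path_bounded :
  exists M, 0 <= M /\ forall t, 0 <= t <= 1 -> opbound (res (p t)) M.
Proof.
destruct (local_bound_01 (fun t M => 0 <= M /\ opbound (res (p t)) M)) as [M HM].
- intros s M N HMN [H0 H]; split; [lra|apply opbound_le with M; trivial].
- intros t Ht; destruct (op_bounded_pos (res (p t))) as [N [HN0 HN]].
  destruct (p_cont t Ht (/ (2 * (N + 1)))) as [d [Hd H]].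
  { apply Rinv_0_lt_compat; lra. }
  exists d, (2 * N); split; [exact Hd|intros s Hs Hst; split; [lra|]].
  apply resolvent_bound_near with T (p t) (p s) (res (p t)); auto.
  replace (p t - p s)%C with (- (p s - p t))%C by ring; rewrite Cmod_opp.
  assert (H1 := H s Hs Hst); assert (H2 := Cmod_ge_0 (p s - p t)).
  apply Rle_trans with (/ (2 * (N + 1)) * (N + 1)).
  + apply Rmult_le_compat; lra.
  + right; field; lra.
- exists M; split; [|intros t Ht; apply HM; exact Ht].
  apply (HM 0); lra.
Qed.

Lemma resolvent_path_cont x y : cont01 (fun t => inner x (res (p t) y)).
Proof.
destruct resolvent_path_bounded as [M [HM0 HM]].
intros t Ht eps Heps.
set (K := hnorm x * (M * (M * hnorm y))).
assert (HK : 0 <= K).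
{ repeat apply Rmult_le_pos; trivial; apply hnorm_ge0. }
destruct (p_cont t Ht (eps / (K + 1))) as [d [Hd H]]; [apply Rdiv_lt_0_compat; lra|].
exists d; split; [exact Hd|intros s Hs Hst].
rewrite (resolvent_identity T (p t) (p s) (res (p t)) (res (p s))
  (res_inv t Ht) (res_inv s Hs) y).
rewrite (inner_plus_r I_dec), (inner_scal_r I_dec), Cplus_minus_l, Cmod_mult.
replace (p t - p s)%C with (- (p s - p t))%C by ring; rewrite Cmod_opp.
assert (H1 : Cmod (inner x (res (p t) (res (p s) y))) <= K).
{ eapply Rle_trans; [apply (inner_le I_dec)|].
  apply Rmult_le_compat_l; [apply hnorm_ge0|].
  eapply Rle_trans; [apply HM; exact Ht|].
  apply Rmult_le_compat_l; [exact HM0|apply HM; exact Hs]. }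
assert (H2 := H s Hs Hst); assert (H3 := Cmod_ge_0 (p s - p t)).
apply Rle_lt_trans with (Cmod (p s - p t) * K); [apply Rmult_le_compat_l; trivial|].
apply Rle_lt_trans with (eps / (K + 1) * K); [apply Rmult_le_compat_r; lra|].
apply Rmult_lt_reg_r with (K + 1); [lra|]; field_simplify; [nra|lra].
Qed.

(** Additivity of the integral requires integrable summands, and this is the purpose of the
    continuity of the resolvent along the path. *)
Lemma loop_int_weak_sum (h : R -> C) (L : list (ell2 I * ell2 I)) : cont01 h ->
  @is_RInt C_R_NormedModule (fun t => h t * weak_sum L (res (p t)))%C 0 1
    (@lsum C_AbelianMonoid _ (fun q => @RInt C_R_CompleteNormedModule
       (fun t => (h t * inner (fst q) (res (p t) (snd q)))%C) 0 1) L : C).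
Proof.
intro Hh; induction L as [|q L IH].
- rewrite lsum_nil_C.
  assert (H := @is_RInt_const C_R_NormedModule 0 1 (RtoC 0)).
  assert (E : @scal R_AbsRing C_R_NormedModule (1 - 0) (RtoC 0) = RtoC 0).
  { apply injective_projections; apply Rmult_0_r. }
  cbv beta in H; apply (eq_ind _ (@is_RInt C_R_NormedModule (fun _ => RtoC 0) 0 1) H) in E.
  revert E; apply is_RInt_ext; intros t _; unfold weak_sum.
  rewrite lsum_nil_C; symmetry; apply Cmult_0_r.
- rewrite lsum_cons_C.
  apply (@is_RInt_ext C_R_NormedModule (fun t => @plus C_R_NormedModule
    (h t * inner (fst q) (res (p t) (snd q)))%C (h t * weak_sum L (res (p t)))%C)).
  { intros t _; unfold weak_sum; rewrite lsum_cons_C.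
    symmetry; apply Cmult_plus_distr_l. }
  apply (@is_RInt_plus C_R_NormedModule); [|exact IH].
  apply (@RInt_correct C_R_CompleteNormedModule), cont01_ex_RInt.
  apply cont01_mult; [exact Hh|apply resolvent_path_cont].
Qed.

End Loop.

Lemma two_pi_i_neq0 : two_pi_i <> RtoC 0.
Proof. intro H; apply (f_equal snd) in H; simpl in H; generalize PI_RGT_0; lra. Qed.

Lemma path_cont01 (g : loop) : cont01 (path g).
Proof.
apply cont01_of_continuous; intros t Ht.
exact (@ex_derive_continuous R_AbsRing C_R_NormedModule (path g) t
  (ex_intro _ _ (@path_derive g t Ht))).
Qed.

Lemma holomorphic_cont01 (f : C -> C) (p : R -> C) :
  cont01 p -> (forall t, 0 <= t <= 1 -> holomorphic_at f (p t)) -> cont01 (fun t => f (p t)).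
Proof.
intros Hp Hf t Ht eps Heps.
assert (Hc := @ex_derive_continuous C_AbsRing C_NormedModule f (p t) (Hf t Ht)).
assert (Heps' : 0 < eps / 2) by lra.
destruct (proj1 (filterlim_locally _ _) Hc (mkposreal _ Heps')) as [d Hd].
destruct (Hp t Ht d (cond_pos d)) as [d' [Hd' H]].
exists d'; split; [exact Hd'|intros s Hs Hst].
assert (K : @ball C_UniformSpace (f (p t)) (eps / 2) (f (p s))).
{ apply Hd; exact (H s Hs Hst). }
generalize (Cmod_ball _ _ _ K); lra.
Qed.

(** [K] is fixed before [L] and [B]: it adds up bounds of f times the velocity over the loops,
    divided by |2 pi i|. One constant therefore serves every truncated commutator, whatever vectors
    it is tested on. *)
Lemma hfc_estimate f T X : is_hfc f T X ->
  exists (Lam : C -> Prop) (res : C -> bounded_op I) (M K : R),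
    0 <= M /\ 0 <= K /\
    (forall l, Lam l -> is_inverse (shift_op l T) (res l) /\ opbound (res l) M) /\
    forall L (B : R), 0 <= B -> (forall l, Lam l -> Cmod (weak_sum L (res l)) <= B) ->
      Cmod (weak_sum L X) <= K * B.
Proof.
intros (U & G & res & _ & _ & Hf & Hres & _ & _ & HX).
exists (on_cycle G), res.
assert (HL : forall g t, In g G -> 0 <= t <= 1 -> on_cycle G (path g t)).
{ intros g t Hg Ht; exists g, t; auto. }
assert (Hinv : forall g t, In g G -> 0 <= t <= 1 ->
  is_inverse (shift_op (path g t) T) (res (path g t))).
{ intros g t Hg Ht; apply Hres, HL; trivial. }
assert (HM : forall H, incl H G -> exists M, 0 <= M /\ forall g t, In g H -> 0 <= t <= 1 ->
  opbound (res (path g t)) M).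
{ induction H as [|g H IH]; intro Hi.
  - exists 0; split; [lra|intros g t []].
  - destruct IH as [M [HM0 HM]]; [intros k Hk; apply Hi; right; exact Hk|].
    destruct (resolvent_path_bounded T res (path g) (path_cont01 g)) as [N [HN0 HN]].
    { intros t Ht; apply Hinv; [apply Hi; left; reflexivity|exact Ht]. }
    exists (Rmax M N); split; [eapply Rle_trans; [exact HM0|apply Rmax_l]|].
    intros k t [<-|Hk] Ht.
    + apply opbound_le with N; [apply Rmax_r|auto].
    + apply opbound_le with M; [apply Rmax_l|auto]. }
destruct (HM G (incl_refl G)) as [M [HM0 HMG]]; clear HM.
set (h := fun g t => (f (path g t) * velocity g t)%C).
assert (Hh : forall g, In g G -> cont01 (h g)).
{ intros g Hg; apply cont01_mult.
  - apply holomorphic_cont01; [apply path_cont01|]; intros t Ht; apply Hf, Hres, HL; trivial.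
  - apply cont01_of_continuous; exact (@velocity_continuous g). }
assert (HK : forall H, incl H G -> exists K, 0 <= K /\ forall L (B : R), 0 <= B ->
   (forall l, on_cycle G l -> Cmod (weak_sum L (res l)) <= B) ->
   Cmod (@lsum C_AbelianMonoid _ (fun g => @lsum C_AbelianMonoid _ (fun q => @RInt C_R_CompleteNormedModule
       (fun t => (h g t * inner (fst q) (res (path g t) (snd q)))%C) 0 1) L : C) H) <= K * B).
{ induction H as [|g H IH]; intro Hi.
  - exists 0; split; [lra|intros L B HB _]; rewrite lsum_nil_C, Cmod_0; lra.
  - destruct IH as [K [HK0 HK]]; [intros k Hk; apply Hi; right; exact Hk|].
    assert (Hg : In g G) by (apply Hi; left; reflexivity).
    destruct (cont01_bounded _ (Hh g Hg)) as [N HN].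
    assert (HN0 : 0 <= N) by (eapply Rle_trans; [apply Cmod_ge_0|apply (HN 0); lra]).
    exists (N + K); split; [lra|intros L B HB HLB].
    rewrite lsum_cons_C; eapply Rle_trans; [apply Cmod_triangle|].
    rewrite Rmult_plus_distr_r; apply Rplus_le_compat; [|apply HK; trivial].
    rewrite <- norm_C_R.
    replace (N * B) with ((1 - 0) * (N * B)) by ring.
    eapply norm_RInt_le_const; [lra| |
      exact (loop_int_weak_sum T res (path g) (path_cont01 g) (fun t Ht => Hinv g t Hg Ht) (h g) L (Hh g Hg))].
    intros t Ht; rewrite norm_C_R, Cmod_mult; apply Rmult_le_compat;
      try apply Cmod_ge_0; auto. }
destruct (HK G (incl_refl G)) as [K [HK0 HKG]]; clear HK.
assert (Hpi : 0 < Cmod two_pi_i) by (apply Cmod_gt_0, two_pi_i_neq0).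
exists M, (K / Cmod two_pi_i); split; [exact HM0|split; [|split]].
- apply Rmult_le_pos; [exact HK0|apply Rlt_le, Rinv_0_lt_compat; exact Hpi].
- intros l Hl; split; [apply Hres; exact Hl|].
  destruct Hl as [g [t [Hg [Ht <-]]]]; apply HMG; trivial.
- intros L B HB HLB.
  assert (E : weak_sum L X = (/ two_pi_i * @lsum C_AbelianMonoid _ (fun g => @lsum C_AbelianMonoid _ (fun q => @RInt C_R_CompleteNormedModule
       (fun t => (h g t * inner (fst q) (res (path g t) (snd q)))%C) 0 1) L : C) G)%C).
  { rewrite lsum_swap, <- lsum_scal_C; unfold weak_sum; apply lsum_ext; intros q _.
    rewrite HX; unfold Cdiv; rewrite Cmult_comm; f_equal.
    unfold cycle_int; apply lsum_ext; intros g _.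
    apply (f_equal (fun F => @RInt C_R_CompleteNormedModule F 0 1)).
    apply functional_extensionality; intro t.
    unfold h; rewrite <- !Cmult_assoc; f_equal; apply Cmult_comm. }
  rewrite E, Cmod_mult, Cmod_inv by apply two_pi_i_neq0.
  apply Rle_trans with (/ Cmod two_pi_i * (K * B)).
  + apply Rmult_le_compat_l; [apply Rlt_le, Rinv_0_lt_compat; exact Hpi|].
    apply HKG; trivial.
  + right; field; lra.
Qed.

End Resolvent.

(** * A pre-C*-algebra of smooth operators *)

Section Smooth.
Context {I : Type} (I_dec : forall i j : I, {i = j} + {i <> j}).
Context (D X Z : nat -> bounded_op I).
Hypothesis D_adj : forall n, is_adjoint (D n) (D n).
Hypothesis X_adj : forall n, is_adjoint (X n) (X n).
Hypothesis Z_adj : forall n, is_adjoint (Z n) (Z n).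

(** [D n], [X n] and [Z n] stand for truncations of the Dirac operator, of the
    weight x and of W x. Asking for bounds uniform in the truncation, rather
    than for unbounded operators, makes all commutators genuine derivations of
    the bounded operators, so that no domain has to be followed through
    products and resolvents. *)
Record even_op (T : bounded_op I) : Prop := {
  even_X : ubounded (fun m => comm (X m) T);
  even_Z : ubounded (fun m => comm (Z m) T) }.

Record odd_op (T : bounded_op I) : Prop := {
  odd_X : ubounded (fun m => comm (X m) T);
  odd_Z : ubounded (fun m => acomm (Z m) T) }.

(** In short: T is even, and [D, T] is bounded and odd. The two truncation levels in a pair are
    independent, so that the level of D can tend to infinity while that of the weight stays
    fixed. *)
Record smooth (T : bounded_op I) : Prop := {
  smooth_even : even_op T;
  smooth_D : ubounded (fun n => comm (D n) T);
  smooth_XD : ubounded (fun p : nat * nat => comm (X (snd p)) (comm (D (fst p)) T));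
  smooth_ZD : ubounded (fun p : nat * nat => acomm (Z (snd p)) (comm (D (fst p)) T)) }.

Local Opaque comm acomm sub_op add_op mul_op scal_op zero_op.

Ltac ub := cbv beta in *; lazymatch goal with
  | |- ubounded (fun m => sub_op _ _) => apply (ubounded_sub I_dec); ub
  | |- ubounded (fun m => add_op _ _) => apply (ubounded_add I_dec); ub
  | |- ubounded (fun m => scal_op _ _) => apply (ubounded_scal I_dec); ub
  | |- ubounded (fun m => mul_op _ _) => apply ubounded_mul; ub
  | H : ?G |- ?G => exact H
  | |- ubounded _ => apply ubounded_const
  end.

Lemma even_mul A B : even_op A -> even_op B -> even_op (mul_op A B).
Proof.
intros [A1 A2] [B1 B2]; split.
- eapply ubounded_ext; [intro m; symmetry; apply comm_mul|]; cbv beta; ub.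
- eapply ubounded_ext; [intro m; symmetry; apply comm_mul|]; cbv beta; ub.
Qed.

Lemma odd_mul_l A B : even_op A -> odd_op B -> odd_op (mul_op A B).
Proof.
intros [A1 A2] [B1 B2]; split.
- eapply ubounded_ext; [intro m; symmetry; apply comm_mul|]; cbv beta; ub.
- eapply ubounded_ext; [intro m; symmetry; apply acomm_mul_r|]; cbv beta; ub.
Qed.

Lemma odd_mul_r A B : odd_op A -> even_op B -> odd_op (mul_op A B).
Proof.
intros [A1 A2] [B1 B2]; split.
- eapply ubounded_ext; [intro m; symmetry; apply comm_mul|]; cbv beta; ub.
- eapply ubounded_ext; [intro m; symmetry; apply acomm_mul_l|]; cbv beta; ub.
Qed.

Lemma even_mul_odd A B : odd_op A -> odd_op B -> even_op (mul_op A B).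
Proof.
intros [A1 A2] [B1 B2]; split.
- eapply ubounded_ext; [intro m; symmetry; apply comm_mul|]; cbv beta; ub.
- eapply ubounded_ext; [intro m; symmetry; apply comm_mul_acomm|]; cbv beta; ub.
Qed.

Lemma smooth_one : smooth one_op.
Proof.
split; [split| | |];
  (apply ubounded_ext with (fun _ => zero_op); [intro m; symmetry|apply ubounded_const]);
  rewrite ?comm_one; first [reflexivity|apply comm_zero|apply acomm_zero].
Qed.

Lemma smooth_add A B : smooth A -> smooth B -> smooth (add_op A B).
Proof.
intros [[A1 A2] A3 A4 A5] [[B1 B2] B3 B4 B5]; split; [split| | |];
  (eapply ubounded_ext;
    [intro m; symmetry;
     first [apply comm_add|rewrite comm_add; first [apply comm_add|apply acomm_add]]|]); ub.
Qed.

Lemma smooth_scal c A : smooth A -> smooth (scal_op c A).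
Proof.
intros [[A1 A2] A3 A4 A5]; split; [split| | |];
  (eapply ubounded_ext;
    [intro m; symmetry;
     first [apply comm_scal|rewrite comm_scal; first [apply comm_scal|apply acomm_scal]]|]); ub.
Qed.

Lemma smooth_mul A B : smooth A -> smooth B -> smooth (mul_op A B).
Proof.
intros [A2 A3 A4 A5] [B2 B3 B4 B5]; split; [apply even_mul; trivial| | |];
  destruct A2 as [A1 A2], B2 as [B1 B2];
  assert (A1' := ubounded_comp _ (@snd nat nat) A1);
  assert (A2' := ubounded_comp _ (@snd nat nat) A2);
  assert (A3' := ubounded_comp _ (@fst nat nat) A3);
  assert (B1' := ubounded_comp _ (@snd nat nat) B1);
  assert (B2' := ubounded_comp _ (@snd nat nat) B2);
  assert (B3' := ubounded_comp _ (@fst nat nat) B3).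
- eapply ubounded_ext; [intro m; symmetry; apply comm_mul|]; cbv beta; ub.
- eapply ubounded_ext.
  { intro m; symmetry; apply comm_comm_mul. }
  cbv beta; ub.
- eapply ubounded_ext.
  { intro m; symmetry; apply acomm_comm_mul. }
  cbv beta; ub.
Qed.

Lemma smooth_adjoint A B : smooth A -> is_adjoint A B -> smooth B.
Proof.
intros [[A1 A2] A3 A4 A5] H.
assert (HC : forall n, is_adjoint (comm (D n) A) (scal_op (RtoC (-1)) (comm (D n) B))).
{ intro n; apply (adjoint_comm I_dec); trivial. }
split; [split| | |].
- apply (ubounded_opp I_dec), (ubounded_adjoint I_dec) with (2 := A1).
  intro m; apply (adjoint_comm I_dec); trivial.
- apply (ubounded_opp I_dec), (ubounded_adjoint I_dec) with (2 := A2).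
  intro m; apply (adjoint_comm I_dec); trivial.
- apply (ubounded_opp I_dec), (ubounded_adjoint I_dec) with (2 := A3).
  intro m; apply (adjoint_comm I_dec); trivial.
- apply (ubounded_adjoint I_dec) with (2 := A4); intro m.
  replace (comm (X (snd m)) (comm (D (fst m)) B))
    with (scal_op (RtoC (-1)) (comm (X (snd m)) (scal_op (RtoC (-1)) (comm (D (fst m)) B)))).
  + apply (adjoint_comm I_dec); trivial.
  + rewrite comm_scal; apply opp_opp_op.
- apply (ubounded_opp I_dec), (ubounded_adjoint I_dec) with (2 := A5); intro m.
  rewrite <- acomm_scal; apply (adjoint_acomm I_dec); trivial.
Qed.

(** The resolvents on the cycle have uniformly bounded commutators by [comm_resolvent]. Every
    expression in [smooth] is weakly linear in the operator, so these bounds pass through the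
    contour integral. *)
Lemma smooth_hfc f T S : smooth T -> is_hfc f T S -> smooth S.
Proof.
intros [[T1 T2] T3 T4 T5] H.
destruct (hfc_estimate I_dec f T S H) as (Lam & res & M & K & HM & HK & Hres & Hest).
set (P := {l : C | Lam l}); set (Rs := fun l : P => res (proj1_sig l)).
assert (Hinv : forall l : P, is_inverse (shift_op (proj1_sig l) T) (Rs l)).
{ intros [l Hl]; apply Hres; exact Hl. }
assert (HR : ubounded Rs).
{ exists M; split; [exact HM|intros [l Hl]; apply Hres; exact Hl]. }
(* The contour point is treated as one more index of a uniformly bounded family; integration removes
   it at the cost of the factor [K]. *)
assert (transfer : forall (Q : Type) (Psi : Q -> bounded_op I -> bounded_op I),
  (forall q, weakly_linear (Psi q)) ->
  ubounded (fun p : Q * P => Psi (fst p) (Rs (snd p))) -> ubounded (fun q => Psi q S)).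
{ intros Q Psi Hw [B [HB HPsi]]; exists (K * B); split; [apply Rmult_le_pos; trivial|].
  intro q; apply (opbound_weak I_dec); [apply Rmult_le_pos; trivial|]; intros x y.
  destruct (Hw q x y) as [L HL]; rewrite HL, Rmult_assoc; apply Hest.
  - repeat apply Rmult_le_pos; trivial; apply hnorm_ge0.
  - intros l Hl; rewrite <- HL; eapply Rle_trans; [apply (inner_le I_dec)|].
    apply Rle_trans with (hnorm x * (B * hnorm y)); [|right; ring].
    apply Rmult_le_compat_l; [apply hnorm_ge0|].
    exact (HPsi (q, exist _ l Hl) y). }
assert (comm_R : forall (Q : Type) (E : Q -> bounded_op I),
  ubounded (fun q => comm (E q) T) ->
  ubounded (fun p : Q * P => comm (E (fst p)) (Rs (snd p)))).
{ intros Q E HE; assert (HE' := ubounded_comp _ (@fst Q P) HE);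
  assert (HR' := ubounded_comp _ (@snd Q P) HR);  eapply ubounded_ext.
  { intro p; symmetry; apply (comm_resolvent _ _ _ _ (Hinv (snd p))). }
  cbv beta; ub. }
assert (D_w : forall n, weakly_linear (fun A => comm (D n) A)).
{ intro n; apply (weakly_linear_comm I_dec _ (fun A => A)); [trivial|].
  apply weakly_linear_id. }
assert (R1 := comm_R _ _ T1); assert (R2 := comm_R _ _ T2); assert (R3 := comm_R _ _ T3).
split; [split| | |].
- apply (transfer nat (fun n A => comm (X n) A)); [|exact R1].
  intro n; apply (weakly_linear_comm I_dec _ (fun A => A)); [trivial|apply weakly_linear_id].
- apply (transfer nat (fun n A => comm (Z n) A)); [|exact R2].
  intro n; apply (weakly_linear_comm I_dec _ (fun A => A)); [trivial|apply weakly_linear_id].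
- apply (transfer nat (fun n A => comm (D n) A)); [exact D_w|exact R3].
- apply (transfer (nat * nat)%type (fun p A => comm (X (snd p)) (comm (D (fst p)) A))).
  + intro p; apply (weakly_linear_comm I_dec _ _ (X_adj _) (D_w _)).
  + eapply ubounded_ext.
    { intro p; symmetry; apply (comm_comm_resolvent _ _ _ _ _ (Hinv (snd p))). }
    cbv beta.
    assert (U1 := ubounded_comp _ (fun p : nat * nat * P => (snd (fst p), snd p)) R1).
    assert (U2 := ubounded_comp _ (fun p : nat * nat * P => fst (fst p)) T3).
    assert (U3 := ubounded_comp _ (fun p : nat * nat * P => fst p) T4).
     simpl in U1;
    assert (HR' := ubounded_comp _ (@snd (nat * nat) P) HR); ub.
- apply (transfer (nat * nat)%type (fun p A => acomm (Z (snd p)) (comm (D (fst p)) A))).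
  + intro p; apply (weakly_linear_acomm I_dec _ _ (Z_adj _) (D_w _)).
  + eapply ubounded_ext.
    { intro p; symmetry; apply (acomm_comm_resolvent _ _ _ _ _ (Hinv (snd p))). }
    cbv beta.
    assert (U1 := ubounded_comp _ (fun p : nat * nat * P => (snd (fst p), snd p)) R2).
    assert (U2 := ubounded_comp _ (fun p : nat * nat * P => fst (fst p)) T3).
    assert (U3 := ubounded_comp _ (fun p : nat * nat * P => fst p) T5).
     simpl in U1;
    assert (HR' := ubounded_comp _ (@snd (nat * nat) P) HR); ub.
Qed.

Lemma smooth_pre_Cstar_algebra : pre_Cstar_algebra smooth.
Proof.
split.
- apply smooth_one.
- apply smooth_add.
- apply smooth_scal.
- apply smooth_mul.
- apply smooth_adjoint.
- apply smooth_hfc.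
Qed.

End Smooth.

(** * Diagonal and permutation operators *)

Section Diagonal.
Context {I : Type} (I_dec : forall i j : I, {i = j} + {i <> j}).
Context (h : I -> C) (B : R) (hB : forall i, Cmod (h i) <= B).

Lemma diag_sumsq (x : ell2 I) l : NoDup l ->
  sumsq (fun i => h i * coord x i)%C l <= (Rabs B * hnorm x) ^ 2.
Proof.
intro Hl; rewrite Rpow_mult_distr.
apply Rle_trans with (Rabs B ^ 2 * sumsq (coord x) l).
- unfold sumsq; rewrite <- lsum_scal_R; apply lsum_le; intros i _.
  rewrite Cmod_mult, Rpow_mult_distr; apply Rmult_le_compat_r; [apply pow2_ge_0|].
  apply pow_incr; split; [apply Cmod_ge_0|].
  eapply Rle_trans; [apply hB|apply Rle_abs].
- apply Rmult_le_compat_l; [apply pow2_ge_0|apply sumsq_le_hnorm; exact Hl].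
Qed.

Definition diag_apply (x : ell2 I) : ell2 I :=
  exist _ (fun i => h i * coord x i)%C (ex_intro _ _ (diag_sumsq x)).

Lemma diag_apply_plus x y : diag_apply (plus x y) = plus (diag_apply x) (diag_apply y).
Proof. apply ell2_eq; intro i; simpl; ring. Qed.

Lemma diag_apply_scal (c : C) x : diag_apply (scal c x) = scal c (diag_apply x).
Proof. apply ell2_eq; intro i; simpl; ring. Qed.

Lemma diag_apply_bounded : exists M, forall x, hnorm (diag_apply x) <= M * hnorm x.
Proof.
exists (Rabs B); intro x; apply hnorm_le.
- apply Rmult_le_pos; [apply Rabs_pos|apply hnorm_ge0].
- exact (diag_sumsq x).
Qed.

Definition diag_op : bounded_op I :=
  BoundedOp diag_apply_plus diag_apply_scal diag_apply_bounded.

Lemma coord_diag x i : coord (diag_op x) i = (h i * coord x i)%C.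
Proof. reflexivity. Qed.

Lemma diag_basis k : diag_op (basis I_dec k) = @scal C_Ring ell2_ModuleSpace (h k) (basis I_dec k).
Proof.
apply ell2_eq; intro i; rewrite coord_diag, coord_scal.
destruct (I_dec i k) as [->|E]; [reflexivity|].
rewrite coord_basis_other by exact E; ring.
Qed.

Lemma diag_adjoint : (forall i, Cconj (h i) = h i) -> is_adjoint diag_op diag_op.
Proof.
intros H x y; unfold inner; f_equal; apply functional_extensionality; intro i.
rewrite !coord_diag, Cmult_conj, H; ring.
Qed.

Lemma ent_diag_l A i k : ent I_dec (mul_op diag_op A) i k = (h i * ent I_dec A i k)%C.
Proof. reflexivity. Qed.

Lemma ent_diag_r A i k : ent I_dec (mul_op A diag_op) i k = (ent I_dec A i k * h k)%C.
Proof.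
unfold ent; change (mul_op A diag_op (basis I_dec k)) with (A (diag_op (basis I_dec k))).
rewrite diag_basis, op_scal, coord_scal; apply Cmult_comm.
Qed.

End Diagonal.

Section Involution.
Context {I : Type} (I_dec : forall i j : I, {i = j} + {i <> j}).
Context (s : I -> I) (s_inv : forall i, s (s i) = i).

Lemma invol_NoDup l : NoDup l -> NoDup (map s l).
Proof.
apply FinFun.Injective_map_NoDup; intros x y E; rewrite <- (s_inv x), E; apply s_inv.
Qed.

Lemma invol_sumsq (x : ell2 I) l : NoDup l ->
  sumsq (fun i => coord x (s i)) l <= (1 * hnorm x) ^ 2.
Proof.
intro Hl; rewrite Rmult_1_l.
replace (sumsq (fun i => coord x (s i)) l) with (sumsq (coord x) (map s l)).
- apply sumsq_le_hnorm, invol_NoDup; exact Hl.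
- unfold sumsq; rewrite lsum_map; reflexivity.
Qed.

Definition invol_apply (x : ell2 I) : ell2 I :=
  exist _ (fun i => coord x (s i)) (ex_intro _ _ (invol_sumsq x)).

Lemma invol_apply_plus x y : invol_apply (plus x y) = plus (invol_apply x) (invol_apply y).
Proof. apply ell2_eq; intro i; reflexivity. Qed.

Lemma invol_apply_scal (c : C) x : invol_apply (scal c x) = scal c (invol_apply x).
Proof. apply ell2_eq; intro i; reflexivity. Qed.

Lemma invol_apply_hnorm x : hnorm (invol_apply x) <= 1 * hnorm x.
Proof.
apply hnorm_le; [generalize (hnorm_ge0 x); lra|exact (invol_sumsq x)].
Qed.

Definition invol_op : bounded_op I :=
  BoundedOp invol_apply_plus invol_apply_scal (ex_intro _ _ invol_apply_hnorm).

Lemma invol_basis k : invol_op (basis I_dec k) = basis I_dec (s k).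
Proof.
apply ell2_eq; intro i; change (coord (basis I_dec k) (s i) = coord (basis I_dec (s k)) i).
destruct (I_dec i (s k)) as [->|E].
- rewrite s_inv, !coord_basis_same; reflexivity.
- rewrite !coord_basis_other; trivial; intro E'; apply E; rewrite <- E', s_inv; reflexivity.
Qed.

Lemma invol_adjoint : is_adjoint invol_op invol_op.
Proof.
intros x y.
apply (is_sum_unique I_dec) with (1 := is_sum_inner I_dec (invol_op x) y).
eapply is_sum_ext; [|apply (is_sum_involution I_dec s _ _ s_inv (is_sum_inner I_dec x (invol_op y)))].
intro i; cbv beta; change (coord (invol_op x) i) with (coord x (s i)).
change (coord (invol_op y) (s i)) with (coord y (s (s i))); rewrite s_inv; reflexivity.
Qed.

Lemma ent_invol_l A i k : ent I_dec (mul_op invol_op A) i k = ent I_dec A (s i) k.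
Proof. reflexivity. Qed.

Lemma ent_invol_r A i k : ent I_dec (mul_op A invol_op) i k = ent I_dec A i (s k).
Proof.
unfold ent; change (mul_op A invol_op (basis I_dec k)) with (A (invol_op (basis I_dec k))).
rewrite invol_basis; reflexivity.
Qed.

Lemma opbound_invol A M : opbound (mul_op invol_op A) M -> opbound A M.
Proof.
intros H x; replace (A x) with (invol_op (mul_op invol_op A x)).
- eapply Rle_trans; [apply invol_apply_hnorm|]; rewrite Rmult_1_l; apply H.
- apply ell2_eq; intro i; change (coord (A x) (s (s i)) = coord (A x) i).
  rewrite s_inv; reflexivity.
Qed.

End Involution.

Lemma ent_add {I : Type} (I_dec : forall i j : I, {i = j} + {i <> j}) A B i k :
  ent I_dec (add_op A B) i k = (ent I_dec A i k + ent I_dec B i k)%C.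
Proof. reflexivity. Qed.

Lemma ent_sub {I : Type} (I_dec : forall i j : I, {i = j} + {i <> j}) A B i k :
  ent I_dec (sub_op A B) i k = (ent I_dec A i k - ent I_dec B i k)%C.
Proof.
change (ent I_dec A i k + RtoC (-1) * ent I_dec B i k = ent I_dec A i k - ent I_dec B i k)%C.
ring.
Qed.

(** Clipping is preferred to a sharp cut-off for three reasons: it is 1-Lipschitz, so differences of
    clipped eigenvalues never exceed the true ones; it is odd, so the truncated D still changes sign
    under W; and it is eventually the identity at each point. *)
Definition clip (n : nat) (r : R) : R := Rmax (- INR n) (Rmin (INR n) r).

Lemma clip_bound n r : Rabs (clip n r) <= INR n.
Proof.
assert (H := pos_INR n); unfold clip.
apply Rabs_le; split; [apply Rmax_l|]; apply Rmax_lub; [lra|apply Rmin_l].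
Qed.

Lemma clip_dist n r t : Rabs (clip n r - clip n t) <= Rabs (r - t).
Proof.
assert (H := pos_INR n); unfold clip, Rmax, Rmin; destruct (Rle_dec (INR n) r), (Rle_dec (INR n) t);
repeat match goal with |- context [Rle_dec ?a ?b] => destruct (Rle_dec a b) end;
unfold Rabs; repeat match goal with |- context [Rcase_abs ?a] => destruct (Rcase_abs a) end; lra.
Qed.

Lemma clip_opp n r : clip n (- r) = - clip n r.
Proof.
assert (H := pos_INR n); unfold clip, Rmax, Rmin; destruct (Rle_dec (INR n) r), (Rle_dec (INR n) (- r));
repeat match goal with |- context [Rle_dec ?a ?b] => destruct (Rle_dec a b) end; lra.
Qed.

Lemma clip_id n r : Rabs r <= INR n -> clip n r = r.
Proof.
intro H; apply Rabs_le_between in H; unfold clip; rewrite Rmin_right, Rmax_right; lra.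
Qed.

Lemma clip_nonneg n r : 0 <= r -> 0 <= clip n r <= r.
Proof.
assert (H := pos_INR n); intro Hr; unfold clip; split.
- eapply Rle_trans; [|apply Rmax_r]; apply Rmin_glb; lra.
- apply Rmax_lub; [lra|apply Rmin_r].
Qed.

Lemma clip_eventually r : exists N, forall n, (N <= n)%nat -> clip n r = r.
Proof.
destruct (nfloor_ex (Rabs r) (Rabs_pos r)) as [N [_ HN]].
exists (S N); intros n Hn; apply clip_id; apply le_INR in Hn; rewrite S_INR in Hn; lra.
Qed.

(** * Smoothness read off from matrix entries *)

Section Weights.
Context {I : Type} (I_dec : forall i j : I, {i = j} + {i <> j}).
Context (s : I -> I) (s_inv : forall i, s (s i) = i).
Context (d w : I -> R) (ds : forall i, d (s i) = - d i) (ws : forall i, w (s i) = w i)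
  (w_ge0 : forall i, 0 <= w i).

Lemma clip_diag_bound (f : I -> R) n i : Cmod (RtoC (clip n (f i))) <= INR n.
Proof. rewrite Cmod_R; apply clip_bound. Qed.

Definition clip_op (f : I -> R) (n : nat) : bounded_op I :=
  diag_op _ _ (clip_diag_bound f n).

Definition swap_op : bounded_op I := invol_op s s_inv.

Definition swap_weight_op (n : nat) : bounded_op I := mul_op swap_op (clip_op w n).

Lemma clip_op_adjoint f n : is_adjoint (clip_op f n) (clip_op f n).
Proof. apply diag_adjoint; intro i; apply Cconj_R. Qed.

(** Invariance of the weight under the involution makes W x self-adjoint, as required for passing to
    adjoints and for moving it across inner products. *)
Lemma swap_weight_commute n : mul_op (clip_op w n) swap_op = swap_weight_op n.
Proof.
apply op_ext; intro x; apply ell2_eq; intro i; simpl; rewrite ws; reflexivity.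
Qed.

Lemma swap_weight_adjoint n : is_adjoint (swap_weight_op n) (swap_weight_op n).
Proof.
rewrite <- swap_weight_commute at 2; apply (adjoint_mul).
- apply (invol_adjoint I_dec).
- apply clip_op_adjoint.
Qed.

Local Notation E := (ent I_dec).

Lemma ent_comm_clip f n A i k :
  E (comm (clip_op f n) A) i k = (RtoC (clip n (f i) - clip n (f k)) * E A i k)%C.
Proof.
unfold comm; rewrite ent_sub; unfold clip_op; rewrite ent_diag_l, ent_diag_r, RtoC_minus; ring.
Qed.

Lemma ent_swap_weight_l n A i k :
  E (mul_op (swap_weight_op n) A) i k = (RtoC (clip n (w i)) * E A (s i) k)%C.
Proof.
unfold ent; simpl; rewrite ws; reflexivity.
Qed.

Lemma ent_swap_weight_r n A i k :
  E (mul_op A (swap_weight_op n)) i k = (E A i (s k) * RtoC (clip n (w k)))%C.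
Proof.
transitivity (E (mul_op (mul_op A swap_op) (clip_op w n)) i k); [reflexivity|].
unfold clip_op; rewrite ent_diag_r; unfold swap_op; rewrite ent_invol_r; reflexivity.
Qed.

Local Notation smooth_ := (smooth (clip_op d) (clip_op w) swap_weight_op).
Local Notation odd_ := (odd_op (clip_op w) swap_weight_op).

(** After multiplication by W, each commutator with W x has entries of two kinds: a weight
    difference times an entry of [T], and a weight times the failure of [T] to commute with W. The
    hypotheses bound both kinds, also in the presence of a Dirac gap, and the Schur test turns entry
    bounds into norm bounds. *)
Lemma smooth_of_entries (T : bounded_op I) (near : I -> list I) (c : nat) (K : R) :
  (forall i, (length (near i) <= c)%nat) ->
  (forall i k, In i (near k) -> In k (near i)) ->
  (forall i k, ~ In i (near k) -> E T i k = RtoC 0 /\ E T (s i) (s k) = RtoC 0) ->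
  (forall i k, Rabs (d i - d k) * Cmod (E T i k) <= K) ->
  (forall i k, In i (near k) -> Rabs (w i - w k) <= K) ->
  (forall i k, Cmod (E T i k - E T (s i) (s k)) * w k <= K) ->
  (forall i k, Rabs (d i - d k) * (Cmod (E T i k - E T (s i) (s k)) * w k) <= K) ->
  smooth_ T.
Proof.
intros Hc Hsym Hz Hd Hw Hs Hds.
destruct (op_bounded_pos T) as [M [HM0 HM]].
assert (HT : forall i k, Cmod (E T i k) <= M) by (intros i k; apply ent_le; exact HM).
assert (schur : forall (P : Type) (A : P -> bounded_op I) B, 0 <= B ->
  (forall p i k, Cmod (E (A p) i k) <= B) ->
  (forall p i k, ~ In i (near k) -> E (A p) i k = RtoC 0) -> ubounded A).
{ intros P A B HB HA HA0; exists (INR c * B); split.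
  - apply Rmult_le_pos; [apply pos_INR|exact HB].
  - intro p; apply (opbound_of_matrix I_dec).
    + apply Rmult_le_pos; [apply pos_INR|exact HB].
    + apply (schur_test I_dec) with near; auto. }
assert (HK : forall i : I, 0 <= K).
{ intro i; eapply Rle_trans; [|apply (Hd i i)].
  apply Rmult_le_pos; [apply Rabs_pos|apply Cmod_ge_0]. }
(* Nonnegativity of [K] can be read off only from an index; [Rabs K] takes its place where none is
   at hand, and [HKi] identifies the two otherwise. *)
assert (HKK : 0 <= Rabs K) by apply Rabs_pos.
assert (HKi : forall i : I, Rabs K = K) by (intro i; apply Rabs_pos_eq, (HK i)).
assert (HD : forall n i k, Rabs (clip n (d i) - clip n (d k)) <= Rabs (d i - d k)).
{ intros; apply clip_dist. }
assert (HW : forall n i k, In i (near k) -> Rabs (clip n (w i) - clip n (w k)) <= K).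
{ intros n i k H; eapply Rle_trans; [apply clip_dist|apply Hw; exact H]. }
(* W is an isometric involution, so it suffices to bound W A. This matters because W [W x, T] is
   supported near the diagonal, whereas [W x, T] is supported near the graph of [s]. *)
assert (swap : forall (P : Type) (A : P -> bounded_op I),
  ubounded (fun p => mul_op swap_op (A p)) -> ubounded A).
{ intros P A [B [HB HA]]; exists B; split; [exact HB|intro p].
  apply (opbound_invol s s_inv), HA. }
assert (E0 : forall r, (RtoC r * 0 = 0)%C) by (intro; ring).
split; [split| | |].
- apply (schur _ _ (Rabs K * M)); [apply Rmult_le_pos; trivial| |].
  + intros n i k; rewrite ent_comm_clip, Cmod_mult, Cmod_R.
    destruct (in_dec I_dec i (near k)) as [H|H].
    * apply Rmult_le_compat; try apply Rabs_pos; try apply Cmod_ge_0; auto.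
      rewrite (HKi i); auto.
    * rewrite (proj1 (Hz i k H)), Cmod_0, Rmult_0_r; apply Rmult_le_pos; trivial.
  + intros n i k H; rewrite ent_comm_clip, (proj1 (Hz i k H)); apply E0.
- apply swap.
  assert (Ee : forall n i k, E (mul_op swap_op (comm (swap_weight_op n) T)) i k
    = (RtoC (clip n (w i) - clip n (w k)) * E T i k
       + RtoC (clip n (w k)) * (E T i k - E T (s i) (s k)))%C).
  { intros n i k; unfold swap_op at 1; rewrite ent_invol_l; unfold comm.
    rewrite ent_sub, ent_swap_weight_l, ent_swap_weight_r, s_inv, ws, RtoC_minus; ring. }
  apply (schur _ _ (Rabs K * M + Rabs K)).
  + apply Rplus_le_le_0_compat; [apply Rmult_le_pos|]; trivial.
  + intros n i k; rewrite Ee.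
    destruct (in_dec I_dec i (near k)) as [H|H].
    * eapply Rle_trans; [apply Cmod_triangle|]; rewrite !Cmod_mult, !Cmod_R, (HKi i).
      apply Rplus_le_compat.
      -- apply Rmult_le_compat; try apply Rabs_pos; try apply Cmod_ge_0; auto.
      -- rewrite Rabs_pos_eq by (apply clip_nonneg; auto).
         eapply Rle_trans; [|apply (Hs i k)]; rewrite Rmult_comm.
         apply Rmult_le_compat_l; [apply Cmod_ge_0|apply clip_nonneg; auto].
    * rewrite (proj1 (Hz i k H)), (proj2 (Hz i k H)), E0.
      replace (0 + RtoC (clip n (w k)) * (0 - 0))%C with (RtoC 0) by ring.
      rewrite Cmod_0; apply Rplus_le_le_0_compat; [apply Rmult_le_pos|]; trivial.
  + intros n i k H; rewrite Ee, (proj1 (Hz i k H)), (proj2 (Hz i k H)); ring.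
- apply (schur _ _ (Rabs K)); [trivial| |].
  + intros n i k; rewrite ent_comm_clip, Cmod_mult, Cmod_R, (HKi i).
    eapply Rle_trans; [|apply (Hd i k)]; apply Rmult_le_compat_r; [apply Cmod_ge_0|apply HD].
  + intros n i k H; rewrite ent_comm_clip, (proj1 (Hz i k H)); apply E0.
- apply (schur _ _ (Rabs K * Rabs K)); [apply Rmult_le_pos; trivial| |].
  + intros [n m] i k; simpl; rewrite !ent_comm_clip, !Cmod_mult, !Cmod_R.
    destruct (in_dec I_dec i (near k)) as [H|H].
    * rewrite (HKi i); apply Rmult_le_compat; try apply Rabs_pos; auto.
      -- apply Rmult_le_pos; [apply Rabs_pos|apply Cmod_ge_0].
      -- eapply Rle_trans; [|apply (Hd i k)]; apply Rmult_le_compat_r; [apply Cmod_ge_0|apply HD].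
    * rewrite (proj1 (Hz i k H)), Cmod_0, !Rmult_0_r; apply Rmult_le_pos; trivial.
  + intros [n m] i k H; simpl; rewrite !ent_comm_clip, (proj1 (Hz i k H)), !E0; reflexivity.
- apply swap.
  (* Conjugation by W reverses the sign of the clipped Dirac gap; this turns the sum in the
     anticommutator into the difference of the entries of [T] at (i, k) and (s i, s k). *)
  assert (Ee : forall n m i k, E (mul_op swap_op (acomm (swap_weight_op m) (comm (clip_op d n) T))) i k
    = (RtoC (clip n (d i) - clip n (d k)) * (RtoC (clip m (w i) - clip m (w k)) * E T i k
       + RtoC (clip m (w k)) * (E T i k - E T (s i) (s k))))%C).
  { intros n m i k; unfold swap_op at 1; rewrite ent_invol_l; unfold acomm.
    rewrite ent_add, ent_swap_weight_l, ent_swap_weight_r, !ent_comm_clip, s_inv, ws.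
    rewrite !ds, !clip_opp, !RtoC_minus, !RtoC_opp; ring. }
  apply (schur _ _ (Rabs K * Rabs K + Rabs K)).
  + apply Rplus_le_le_0_compat; [apply Rmult_le_pos|]; trivial.
  + intros [n m] i k; simpl; rewrite Ee.
    destruct (in_dec I_dec i (near k)) as [H|H].
    * rewrite Cmod_mult, Cmod_R.
      eapply Rle_trans; [apply Rmult_le_compat_r; [apply Cmod_ge_0|apply HD]|].
      eapply Rle_trans; [apply Rmult_le_compat_l; [apply Rabs_pos|apply Cmod_triangle]|].
      rewrite !Cmod_mult, !Cmod_R, (HKi i), Rmult_plus_distr_l.
      apply Rplus_le_compat.
      -- replace (Rabs (d i - d k) * (Rabs (clip m (w i) - clip m (w k)) * Cmod (E T i k)))
           with (Rabs (clip m (w i) - clip m (w k)) * (Rabs (d i - d k) * Cmod (E T i k))) by ring.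
         apply Rmult_le_compat; try apply Rabs_pos; auto.
         apply Rmult_le_pos; [apply Rabs_pos|apply Cmod_ge_0].
      -- rewrite (Rabs_pos_eq (clip m (w k))) by (apply clip_nonneg; auto).
         eapply Rle_trans; [|apply (Hds i k)].
         apply Rmult_le_compat_l; [apply Rabs_pos|]; rewrite Rmult_comm.
         apply Rmult_le_compat_l; [apply Cmod_ge_0|apply clip_nonneg; auto].
    * rewrite (proj1 (Hz i k H)), (proj2 (Hz i k H)), E0.
      replace (RtoC (clip n (d i) - clip n (d k)) * (0 + RtoC (clip m (w k)) * (0 - 0)))%C with (RtoC 0) by ring.
      rewrite Cmod_0; apply Rplus_le_le_0_compat; [apply Rmult_le_pos|]; trivial.
  + intros [n m] i k H; simpl; rewrite Ee, (proj1 (Hz i k H)), (proj2 (Hz i k H)); ring.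
Qed.

(** Entries of the truncated commutators stabilise, so the uniform bound yields an operator for the
    untruncated [D, T]. The same limit, taken at a fixed weight level, shows that it is odd. *)
Lemma smooth_commutator (T : bounded_op I) : smooth_ T ->
  exists S, odd_ S /\ forall i k, E S i k = (RtoC (d i - d k) * E T i k)%C.
Proof.
intros [_ [M [HM HD]] [N [HN HX]] [L [HL HZ]]].
assert (Hev : forall i k, exists n0, forall n, (n0 <= n)%nat ->
  E (comm (clip_op d n) T) i k = (RtoC (d i - d k) * E T i k)%C).
{ intros i k; destruct (clip_eventually (d i)) as [n1 H1], (clip_eventually (d k)) as [n2 H2].
  exists (n1 + n2)%nat; intros n Hn; rewrite ent_comm_clip, H1, H2 by lia; reflexivity. }
destruct (op_of_matrix I_dec _ M HM (matrix_bound_limit I_dec _ _ M HM HD Hev)) as [S [HS _]].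
exists S; split; [|exact HS]; split.
- exists N; split; [exact HN|intro m].
  apply (opbound_limit I_dec (fun n => comm (clip_op w m) (comm (clip_op d n) T))); [exact HN|intro n; apply (HX (n, m))|].
  intros i k; destruct (Hev i k) as [n0 H]; exists n0; intros n Hn.
  rewrite ent_comm_clip, H by exact Hn; rewrite ent_comm_clip, HS; reflexivity.
- exists L; split; [exact HL|intro m].
  apply (opbound_limit I_dec (fun n => acomm (swap_weight_op m) (comm (clip_op d n) T))); [exact HL|intro n; apply (HZ (n, m))|].
  intros i k; destruct (Hev (s i) k) as [n0 H], (Hev i (s k)) as [n1 H'].
  exists (n0 + n1)%nat; intros n Hn; unfold acomm.
  rewrite !ent_add, !ent_swap_weight_l, !ent_swap_weight_r, H, H', !HS by lia; reflexivity.
Qed.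

(* The matrix entry of the anticommutator of [swap_weight_op m] with [T] at
   [(s k, k)] is [(T k k + T (s k) (s k)) * w k], as soon as [w k <= m]. *)
Lemma odd_diagonal (T : bounded_op I) : odd_ T ->
  exists M, 0 <= M /\ forall k, Cmod (E T k k + E T (s k) (s k)) * w k <= M.
Proof.
intros [_ [M [HM H]]]; exists M; split; [exact HM|intro k].
destruct (clip_eventually (w k)) as [n Hn].
assert (H1 := ent_le I_dec _ M (s k) k (H n)); revert H1.
unfold acomm; rewrite ent_add, ent_swap_weight_l, ent_swap_weight_r, s_inv, ws, Hn by lia.
replace (RtoC (w k) * E T k k + E T (s k) (s k) * RtoC (w k))%C
  with ((E T k k + E T (s k) (s k)) * RtoC (w k))%C by ring.
rewrite Cmod_mult, Cmod_R, Rabs_pos_eq by apply w_ge0; trivial.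
Qed.

End Weights.

(** * The labels of the spinor basis *)

Definition swap_label (k : label) : label :=
  match k with
  | Label J M N up => Label (J + 1) N M down
  | Label J M N down => Label (J - 1) N M up
  end.

Lemma swap_label_involutive k : swap_label (swap_label k) = k.
Proof. destruct k as [J M N []]; simpl; f_equal; lia. Qed.

Lemma valid_up J M N : valid (Label J M N up) = true <->
  (0 <= J /\ Z.abs M <= J /\ Z.even (J - M) = true
   /\ Z.abs N <= J + 1 /\ Z.even (J + 1 - N) = true)%Z.
Proof. unfold valid; rewrite !andb_true_iff, !Z.leb_le; tauto. Qed.

Lemma valid_down J M N : valid (Label J M N down) = true <->
  (1 <= J /\ Z.abs M <= J /\ Z.even (J - M) = true
   /\ Z.abs N <= J - 1 /\ Z.even (J - 1 - N) = true)%Z.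
Proof. unfold valid; rewrite !andb_true_iff, !Z.leb_le; tauto. Qed.

Lemma valid_swap k : valid k = true -> valid (swap_label k) = true.
Proof.
destruct k as [J M N []]; unfold swap_label; rewrite ?valid_up, ?valid_down; intros (H1 & H2 & H3 & H4 & H5).
- replace (J + 1 - 1 - M)%Z with (J - M)%Z by lia; repeat split; trivial; lia.
- replace (J - 1 + 1 - M)%Z with (J - M)%Z by lia; repeat split; trivial; lia.
Qed.

(** The bijection |j mu n up> <-> |j^+ n mu down>; it preserves |D|, changes the
    sign of D, and exchanges the roles of mu and n. *)
Definition swap (i : spinor_index) : spinor_index :=
  exist _ (swap_label (proj1_sig i)) (valid_swap _ (proj2_sig i)).

Lemma swap_swap i : swap (swap i) = i.
Proof. apply spinor_index_eq, swap_label_involutive. Qed.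

(** One plus the distance, in doubled units, to the faces mu = -j and
    n = -j^+ (or -j^-). *)
Definition depth (k : label) : Z :=
  match k with
  | Label J M N up => 1 + Z.min (J + M) (J + N + 1)
  | Label J M N down => 1 + Z.min (J + M) (J + N - 1)
  end.

Definition weight (i : spinor_index) : R := IZR (depth (proj1_sig i)).

Lemma weight_swap i : weight (swap i) = weight i.
Proof.
unfold weight; f_equal; destruct i as [[J M N []] Hk]; cbn [proj1_sig swap swap_label depth]; lia.
Qed.

Lemma dirac_swap i : dirac_eigenvalue (swap i) = - dirac_eigenvalue i.
Proof.
destruct i as [[J M N []] Hk]; unfold dirac_eigenvalue; cbn [proj1_sig swap swap_label];
  rewrite ?plus_IZR, ?minus_IZR; lra.
Qed.

Lemma depth_pos k : valid k = true -> (1 <= depth k)%Z.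
Proof.
destruct k as [J M N []]; rewrite ?valid_up, ?valid_down; cbn [depth]; lia.
Qed.

Lemma weight_ge1 i : 1 <= weight i.
Proof. apply IZR_le, depth_pos, (proj2_sig i). Qed.

Lemma weight_ge0 i : 0 <= weight i.
Proof. generalize (weight_ge1 i); lra. Qed.

Definition index_of (k : label) : list spinor_index :=
  match bool_dec (valid k) true with
  | left H => [exist _ k H]
  | right _ => nil
  end.

Lemma in_index_of i k : In i (index_of k) <-> proj1_sig i = k.
Proof.
unfold index_of; destruct (bool_dec (valid k) true) as [H|H]; simpl.
- split; [intros [<-|[]]; reflexivity|intro H'; left; apply spinor_index_eq; symmetry; exact H'].
- split; [intros []|intros <-; apply H, (proj2_sig i)].
Qed.

(** The generators change [twoj] by 1, and W changes it by 1 at either end, so a window of 3 holds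
    the support both of a generator and of its conjugate by W. The other two windows are just
    exchanged by W. There are 7 * 3 * 3 * 2 = 126 labels. *)
Definition near_labels (k : label) : list label :=
  match k with
  | Label J M N _ =>
      flat_map (fun a => flat_map (fun b => flat_map (fun c =>
        [Label (J + a) (M + b) (N + c) up; Label (J + a) (M + b) (N + c) down])
        [-1; 0; 1]%Z) [-1; 0; 1]%Z) [-3; -2; -1; 0; 1; 2; 3]%Z
  end.

Definition near_index (i : spinor_index) : list spinor_index :=
  flat_map index_of (near_labels (proj1_sig i)).

Lemma near_labels_spec k l : In l (near_labels k) <->
  (Z.abs (twoj l - twoj k) <= 3 /\ Z.abs (twomu l - twomu k) <= 1
   /\ Z.abs (twon l - twon k) <= 1)%Z.
Proof.
destruct k as [J M N s], l as [J' M' N' s']; unfold near_labels; cbn [twoj twomu twon].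
rewrite in_flat_map; split.
- intros [a [Ha H]]; apply in_flat_map in H; destruct H as [b [Hb H]].
  apply in_flat_map in H; destruct H as [c [Hc H]].
  assert (Ha' : (-3 <= a <= 3)%Z) by (simpl in Ha; lia).
  assert (Hb' : (-1 <= b <= 1)%Z) by (simpl in Hb; lia).
  assert (Hc' : (-1 <= c <= 1)%Z) by (simpl in Hc; lia).
  destruct H as [H|[H|[]]]; injection H as <- <- <- <-; lia.
- intros (H1 & H2 & H3).
  exists (J' - J)%Z; split; [simpl; lia|].
  apply in_flat_map; exists (M' - M)%Z; split; [simpl; lia|].
  apply in_flat_map; exists (N' - N)%Z; split; [simpl; lia|].
  replace (J + (J' - J))%Z with J' by lia.
  replace (M + (M' - M))%Z with M' by lia.
  replace (N + (N' - N))%Z with N' by lia.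
  destruct s'; simpl; auto.
Qed.

Lemma in_near_index i k : In i (near_index k) <-> In (proj1_sig i) (near_labels (proj1_sig k)).
Proof.
unfold near_index; rewrite in_flat_map; split.
- intros [l [Hl H]]; apply in_index_of in H; rewrite H; exact Hl.
- intro H; exists (proj1_sig i); split; [exact H|apply in_index_of; reflexivity].
Qed.

Lemma near_index_sym i k : In i (near_index k) -> In k (near_index i).
Proof. rewrite !in_near_index, !near_labels_spec; lia. Qed.

Lemma near_index_length i : (length (near_index i) <= 126)%nat.
Proof.
unfold near_index.
replace 126%nat with (length (near_labels (proj1_sig i))).
- generalize (near_labels (proj1_sig i)); intro l; induction l as [|k l IH]; [constructor|].
  simpl; rewrite length_app.
  assert (length (index_of k) <= 1)%nat by (unfold index_of; destruct (bool_dec _ _); simpl; lia).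
  lia.
- destruct (proj1_sig i) as [J M N s]; reflexivity.
Qed.

Definition ind (i : spinor_index) (l : label) : R :=
  if label_dec (proj1_sig i) l then 1 else 0.

Lemma coord_ket J M N s i : coord (ket J M N s) i = RtoC (ind i (Label J M N s)).
Proof.
unfold ind; simpl; unfold delta; destruct (label_dec (proj1_sig i) (Label J M N s)); reflexivity.
Qed.

Lemma basis_ket k J M N s : proj1_sig k = Label J M N s ->
  basis spinor_index_dec k = ket J M N s.
Proof.
intro H; apply ell2_eq; intro i; rewrite coord_ket; unfold ind.
destruct (label_dec (proj1_sig i) (Label J M N s)) as [E1|E1].
- replace i with k by (apply spinor_index_eq; congruence); apply coord_basis_same.
- apply coord_basis_other; intros ->; apply E1; exact H.
Qed.

Definition other (s : spin) : spin := match s with up => down | down => up end.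
Definition flip_j (s : spin) (J : Z) : Z := match s with up => J + 1 | down => J - 1 end.

(** * Operators composed of two weighted shifts and a spin flip *)

Section Form.
Local Notation E := (ent spinor_index_dec).
Context (T : bounded_op spinor_index) (e : Z) (P Mi F : spin -> Z -> Z -> Z -> R).
Hypothesis e_unit : Z.abs e = 1%Z.
Hypothesis T_form : forall i k J M N s, proj1_sig k = Label J M N s ->
  E T i k = RtoC (P s J M N * ind i (Label (J + 1) (M + 1) (N + e) s)
    + Mi s J M N * ind i (Label (J - 1) (M + 1) (N + e) s)
    + F s J M N * ind i (Label (flip_j s J) (M + 1) (N + e) (other s))).

Local Notation lab i := (proj1_sig i).
Local Notation d := dirac_eigenvalue.

Lemma form_support i k : E T i k <> RtoC 0 ->
  (Z.abs (twoj (lab i) - twoj (lab k)) = 1 /\ Z.abs (twomu (lab i) - twomu (lab k)) <= 1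
   /\ Z.abs (twon (lab i) - twon (lab k)) <= 1)%Z.
Proof.
destruct (lab k) as [J M N s] eqn:Hk; rewrite (T_form i k J M N s Hk); unfold ind.
intro H; cbn [twoj twomu twon].
destruct (label_dec (lab i) (Label (J + 1) (M + 1) (N + e) s)) as [E1|E1];
  [rewrite E1; cbn [twoj twomu twon]; lia|].
destruct (label_dec (lab i) (Label (J - 1) (M + 1) (N + e) s)) as [E2|E2];
  [rewrite E2; cbn [twoj twomu twon]; lia|].
destruct (label_dec (lab i) (Label (flip_j s J) (M + 1) (N + e) (other s))) as [E3|E3];
  [rewrite E3; destruct s; cbn [twoj twomu twon flip_j]; lia|].
exfalso; apply H; f_equal; ring.
Qed.

Lemma form_near i k : ~ In i (near_index k) -> E T i k = RtoC 0.
Proof.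
intro H; apply NNPP; intro H'; apply form_support in H'; apply H.
rewrite in_near_index, near_labels_spec; lia.
Qed.

Lemma form_near_swap i k : ~ In i (near_index k) -> E T (swap i) (swap k) = RtoC 0.
Proof.
intro H; apply NNPP; intro H'; apply form_support in H'; apply H.
rewrite in_near_index, near_labels_spec.
destruct i as [[J M N s] Hi], k as [[J' M' N' s'] Hk].
destruct s, s'; cbn [proj1_sig swap swap_label twoj twomu twon] in *; lia.
Qed.

Lemma form_same_spin_dist i k : spin_of (lab i) = spin_of (lab k) ->
  E T i k <> RtoC 0 -> Rabs (d i - d k) <= 1.
Proof.
intros Hs H; apply form_support in H; destruct H as [H _].
assert (HJ : IZR (twoj (lab i)) - IZR (twoj (lab k)) = 1
  \/ IZR (twoj (lab i)) - IZR (twoj (lab k)) = -1).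
{ rewrite <- minus_IZR; assert (H' : (twoj (lab i) - twoj (lab k) = 1
    \/ twoj (lab i) - twoj (lab k) = -1)%Z) by lia.
  destruct H' as [-> | ->]; auto. }
unfold dirac_eigenvalue; destruct (lab i) as [J M N []], (lab k) as [J' M' N' []];
  cbn [twoj spin_of] in *; try discriminate; apply Rabs_le; lra.
Qed.

Context (K : R).
Hypothesis F_bound : forall J M N s, valid (Label J M N s) = true ->
  Rabs (F s J M N) * (IZR J + 2) ^ 2 <= K.
Hypothesis same_spin : forall i k, spin_of (lab i) = spin_of (lab k) ->
  Cmod (E T i k - E T (swap i) (swap k)) * weight k <= K.

Lemma dirac_weight_bound i k : Z.abs (twoj (lab i) - twoj (lab k)) = 1%Z ->
  0 <= IZR (twoj (lab k)) /\
  Rabs (d i - d k) <= 2 * (IZR (twoj (lab k)) + 2) /\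
  weight k <= 2 * (IZR (twoj (lab k)) + 2).
Proof.
intro H; unfold weight, dirac_eigenvalue.
assert (Hi := proj2_sig i); assert (Hk := proj2_sig k); cbv beta in Hi, Hk.
assert (H1 : IZR (twoj (lab i)) <= IZR (twoj (lab k)) + 1).
{ rewrite <- plus_IZR; apply IZR_le; lia. }
assert (H0 : 0 <= IZR (twoj (lab i))).
{ apply IZR_le; destruct (lab i) as [J M N []]; rewrite ?valid_up, ?valid_down in Hi; cbn [twoj]; lia. }
assert (H2 : 0 <= IZR (twoj (lab k))).
{ apply IZR_le; destruct (lab k) as [J M N []]; rewrite ?valid_up, ?valid_down in Hk; cbn [twoj depth]; lia. }
split; [exact H2|split].
- destruct (lab i) as [J M N []], (lab k) as [J' M' N' []]; cbn [twoj] in *; apply Rabs_le; lra.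
- replace 2 with (IZR 2) at 1 2 by reflexivity; rewrite <- plus_IZR, <- mult_IZR; apply IZR_le.
  destruct (lab k) as [J M N []]; rewrite ?valid_up, ?valid_down in Hk; cbn [twoj depth]; lia.
Qed.

Lemma K_ge0 (k : spinor_index) : 0 <= K.
Proof.
destruct (lab k) as [J M N s] eqn:Hk; assert (Hv := proj2_sig k); cbv beta in Hv; rewrite Hk in Hv.
eapply Rle_trans; [|apply (F_bound J M N s Hv)].
apply Rmult_le_pos; [apply Rabs_pos|apply pow2_ge_0].
Qed.

(** Across a spin flip the Dirac eigenvalue changes sign, so its gap grows linearly in j, as the
    weight may do. The quadratic decay in [F_bound] pays for the product of the two. *)
Lemma form_flip i k : spin_of (lab i) <> spin_of (lab k) ->
  Cmod (E T i k) * weight k <= 4 * K /\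
  Rabs (d i - d k) * Cmod (E T i k) <= 4 * K /\
  Rabs (d i - d k) * (Cmod (E T i k) * weight k) <= 4 * K.
Proof.
intro Hs; assert (HK := K_ge0 k).
destruct (classic (E T i k = RtoC 0)) as [E0|E0].
{ rewrite E0, Cmod_0, !Rmult_0_l, !Rmult_0_r; lra. }
assert (Hsup := form_support i k E0); destruct Hsup as [HJ _].
destruct (dirac_weight_bound i k HJ) as (H0 & H1 & H2).
assert (Hv := proj2_sig k); cbv beta in Hv.
destruct (lab k) as [J M N s] eqn:Hk; cbn [twoj twomu twon spin_of] in *.
assert (HE : Cmod (E T i k) <= Rabs (F s J M N)).
{ rewrite (T_form i k J M N s Hk), Cmod_R; unfold ind.
  destruct (label_dec (lab i) (Label (J + 1) (M + 1) (N + e) s)) as [E1|E1];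
    [exfalso; apply Hs; rewrite E1; reflexivity|].
  destruct (label_dec (lab i) (Label (J - 1) (M + 1) (N + e) s)) as [E2|E2];
    [exfalso; apply Hs; rewrite E2; reflexivity|].
  assert (H := Rabs_pos (F s J M N)).
  destruct (label_dec (lab i) (Label (flip_j s J) (M + 1) (N + e) (other s))).
  - right; f_equal; ring.
  - rewrite !Rmult_0_r, !Rplus_0_r, Rabs_R0; exact H. }
assert (HF := F_bound J M N s Hv).
set (f := Rabs (F s J M N)) in *; set (c := Cmod (E T i k)) in *.
assert (Hc : 0 <= c) by apply Cmod_ge_0.
assert (Hw := weight_ge0 k); assert (Hd := Rabs_pos (d i - d k)).
set (dd := Rabs (d i - d k)) in *; set (x := IZR J) in *; set (wk := weight k) in *.
assert (Hf : 0 <= f) by lra.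
assert (K1 : dd * wk <= (2 * (x + 2)) * (2 * (x + 2))) by (apply Rmult_le_compat; lra).
assert (K2 : c * (dd * wk) <= f * ((2 * (x + 2)) * (2 * (x + 2)))).
{ apply Rmult_le_compat; trivial; apply Rmult_le_pos; trivial. }
assert (K3 : c * wk <= f * (2 * (x + 2))) by (apply Rmult_le_compat; lra).
assert (K4 : dd * c <= (2 * (x + 2)) * f) by (apply Rmult_le_compat; lra).
assert (K5 : f * (2 * (x + 2)) <= f * (4 * (x + 2) ^ 2)).
{ apply Rmult_le_compat_l; [exact Hf|nra]. }
repeat split; nra.
Qed.

Lemma smooth_of_form :
  smooth (clip_op dirac_eigenvalue) (clip_op weight)
    (swap_weight_op swap swap_swap weight) T.
Proof.
destruct (op_bounded_pos T) as [B [HB0 HB]].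
assert (HT : forall i k, Cmod (E T i k) <= B) by (intros i k; apply ent_le; exact HB).
assert (HK0 := Rle_abs K).
assert (dsw : forall i k, Rabs (d (swap i) - d (swap k)) = Rabs (d i - d k)).
{ intros i k; rewrite !dirac_swap, <- Rabs_Ropp; f_equal; ring. }
assert (spin_swap : forall i, spin_of (lab (swap i)) = other (spin_of (lab i))).
{ intros [[J M N []] Hv]; reflexivity. }
(* [B] covers entries without spin flip, where the gap is at most 1; [8 * Rabs K] covers two spin
   flips at [4 * K] each; 6 bounds the variation of the weight over the window: 3 from j, 1 from mu
   or n, 2 from the spin. *)
set (K' := B + 8 * Rabs K + 6).
assert (HKp := Rabs_pos K).
apply (smooth_of_entries spinor_index_dec swap swap_swap dirac_eigenvalue weight
  dirac_swap weight_swap weight_ge0 T near_index 126 K').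
- apply near_index_length.
- apply near_index_sym.
- intros i k H; split; [apply form_near|apply form_near_swap]; exact H.
- intros i k; unfold K'.
  destruct (spin_of (lab i)) eqn:Ei, (spin_of (lab k)) eqn:Ek;
  try (destruct (form_flip i k) as (_ & H & _); [congruence|lra]);
  (destruct (classic (E T i k = RtoC 0)) as [E0|E0];
    [rewrite E0, Cmod_0, Rmult_0_r; lra|]);
  (assert (H := form_same_spin_dist i k (eq_trans Ei (eq_sym Ek)) E0);
   assert (H1 := HT i k); assert (H2 := Cmod_ge_0 (E T i k)); nra).
- intros i k H; rewrite in_near_index, near_labels_spec in H.
  apply Rle_trans with 6; [|unfold K'; lra].
  unfold weight; rewrite <- minus_IZR, <- abs_IZR; apply IZR_le.
  destruct (lab i) as [J M N []], (lab k) as [J' M' N' []];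
    cbn [twoj twomu twon depth] in *; lia.
- intros i k; unfold K'.
  destruct (spin_of (lab i)) eqn:Ei, (spin_of (lab k)) eqn:Ek;
  try (assert (H := same_spin i k (eq_trans Ei (eq_sym Ek))); lra);
  (destruct (form_flip i k) as (H & _ & _); [congruence|];
   destruct (form_flip (swap i) (swap k)) as (H' & _ & _);
     [rewrite !spin_swap, Ei, Ek; discriminate|];
   rewrite weight_swap in H';
   assert (Hw := weight_ge0 k);
   assert (Ht := Cmod_triangle (E T i k) (- E T (swap i) (swap k))); rewrite Cmod_opp in Ht;
   apply Rle_trans with ((Cmod (E T i k) + Cmod (E T (swap i) (swap k))) * weight k);
   [apply Rmult_le_compat_r; [exact Hw|exact Ht]|lra]).
- intros i k; unfold K'.
  destruct (spin_of (lab i)) eqn:Ei, (spin_of (lab k)) eqn:Ek;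
  try (destruct (form_flip i k) as (_ & _ & H); [congruence|];
   destruct (form_flip (swap i) (swap k)) as (_ & _ & H');
     [rewrite !spin_swap, Ei, Ek; discriminate|];
   rewrite weight_swap, dsw in H';
   assert (Hw := weight_ge0 k);
   assert (Ht := Cmod_triangle (E T i k) (- E T (swap i) (swap k))); rewrite Cmod_opp in Ht;
   apply Rle_trans with (Rabs (d i - d k) * ((Cmod (E T i k) + Cmod (E T (swap i) (swap k))) * weight k));
   [apply Rmult_le_compat_l; [apply Rabs_pos|]; apply Rmult_le_compat_r; [exact Hw|exact Ht]|lra]);
  (assert (H := same_spin i k (eq_trans Ei (eq_sym Ek)));
   assert (Hp : 0 <= Cmod (E T i k - E T (swap i) (swap k)) * weight k)
     by (apply Rmult_le_pos; [apply Cmod_ge_0|apply weight_ge0]);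
   (* Without spin flip a gap above 1 forces both entries to vanish, so the gap costs nothing beyond
      [same_spin]. *)
   destruct (Rle_dec (Rabs (d i - d k)) 1) as [Hd|Hd];
   [assert (Hdp := Rabs_pos (d i - d k)); nra|];
   replace (E T i k) with (RtoC 0);
   [replace (E T (swap i) (swap k)) with (RtoC 0)|];
   [replace (0 - 0)%C with (RtoC 0) by ring; rewrite Cmod_0, Rmult_0_l, Rmult_0_r; lra| |];
   apply NNPP; intro E0; apply Hd;
   [rewrite <- dsw; apply form_same_spin_dist; [rewrite !spin_swap, Ei, Ek; reflexivity|]
   |apply form_same_spin_dist; [congruence|]]; intro; apply E0; symmetry; assumption).
Qed.

End Form.

(** * Size of the matrix coefficients *)

Lemma coord_plus_module {I : Type} (x y : ell2 I) i :
  coord (@plus (ModuleSpace.AbelianMonoid C_Ring ell2_ModuleSpace) x y) i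
  = (coord x i + coord y i)%C.
Proof. reflexivity. Qed.

Section Generators.
Context (q : R) (hq : 0 < q < 1).

Local Notation q_ := (Rpower q).
Local Notation qn := (qnum q).
Local Notation c0 := (/ (/ q - q)).

Lemma qnum_den_pos : 0 < / q - q.
Proof.
assert (1 < / q) by (rewrite <- Rinv_1; apply Rinv_lt_contravar; lra); lra.
Qed.

Lemma q_pos x : 0 < q_ x.
Proof. apply exp_pos. Qed.

Lemma ln_q_neg : ln q < 0.
Proof. rewrite <- ln_1; apply ln_increasing; lra. Qed.

Lemma q_antitone x y : x <= y -> q_ y <= q_ x.
Proof.
intro H; unfold Rpower; assert (Hl := ln_q_neg).
destruct (Req_dec x y) as [->|E]; [lra|left; apply exp_increasing; nra].
Qed.

Lemma sqrt_qnum_le x : sqrt (qn x) <= sqrt c0 * q_ (- x / 2).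
Proof.
assert (H0 := qnum_den_pos); assert (H1 : 0 < c0) by (apply Rinv_0_lt_compat; exact H0).
replace (q_ (- x / 2)) with (sqrt (q_ (- x))).
- rewrite <- sqrt_mult by (try apply Rlt_le; trivial; apply q_pos).
  apply sqrt_le_1_alt; unfold qnum, Rdiv; rewrite Rmult_comm.
  apply Rmult_le_compat_l; [lra|]; generalize (q_pos x); lra.
- replace (- x) with (- x / 2 + - x / 2) at 1 by field.
  rewrite Rpower_plus; apply sqrt_square, Rlt_le, q_pos.
Qed.

(** Multiplying q^(1-y) by 1/q - q gives q^(-y) - q^(2-y), and q^(2-y) >= q^y because y >= 2 - y. *)
Lemma inv_qnum_le y : 1 <= y -> 0 < / qn y <= q_ (y - 1).
Proof.
intro Hy; assert (H0 := qnum_den_pos).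
assert (H : q_ (1 - y) <= qn y).
{ unfold qnum; apply Rmult_le_reg_r with (/ q - q); [exact H0|].
  unfold Rdiv; rewrite (Rmult_assoc (_ - _)), Rinv_l, Rmult_1_r by lra.
  replace (q_ (1 - y)) with (q * q_ (- y)).
  2:{ replace (1 - y) with (1 + - y) by ring; rewrite Rpower_plus, Rpower_1 by lra; reflexivity. }
  replace (q * q_ (- y) * (/ q - q)) with (q_ (- y) - q * q * q_ (- y)) by (field; lra).
  replace (q * q * q_ (- y)) with (q_ (2 + - y)).
  2:{ rewrite Rpower_plus; replace 2 with (1 + 1) by ring; rewrite Rpower_plus, Rpower_1 by lra; ring. }
  assert (H1 : q_ y <= q_ (2 + - y)) by (apply q_antitone; lra); lra. }
assert (Hp := q_pos (1 - y)).
split; [apply Rinv_0_lt_compat; lra|].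
replace (q_ (y - 1)) with (/ q_ (1 - y)).
- apply Rinv_le_contravar; trivial.
- rewrite <- Rpower_Ropp; f_equal; ring.
Qed.

(** Every coefficient of the representation is reduced to one power of q, after which all size
    estimates are linear inequalities in j, mu and n. *)
Lemma coef_bound e0 x1 e x2 y : 1 <= y ->
  0 <= q_ e0 * sqrt (qn x1) * (q_ e * (sqrt (qn x2) / qn y))
    <= c0 * q_ (e0 - x1 / 2 + e - x2 / 2 + (y - 1)).
Proof.
intro Hy; destruct (inv_qnum_le y Hy) as [Hy0 Hy1].
assert (H1 := sqrt_qnum_le x1); assert (H2 := sqrt_qnum_le x2).
assert (P1 := sqrt_pos (qn x1)); assert (P2 := sqrt_pos (qn x2)).
assert (Q0 := q_pos e0); assert (Q1 := q_pos e).
unfold Rdiv; split; [repeat apply Rmult_le_pos; lra|].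
apply Rle_trans with (q_ e0 * (sqrt c0 * q_ (- x1 / 2)) * (q_ e * ((sqrt c0 * q_ (- x2 / 2)) * q_ (y - 1)))).
- apply Rmult_le_compat; [repeat apply Rmult_le_pos; lra|repeat apply Rmult_le_pos; lra| |].
  + apply Rmult_le_compat_l; lra.
  + apply Rmult_le_compat_l; [lra|]; apply Rmult_le_compat; lra.
- right.
  replace (e0 - x1 * / 2 + e - x2 * / 2 + (y - 1)) with (e0 + (- x1 / 2 + (e + (- x2 / 2 + (y - 1))))) by (unfold Rdiv; ring).
  assert (Hs : sqrt c0 * sqrt c0 = c0).
  { apply sqrt_sqrt, Rlt_le, Rinv_0_lt_compat, qnum_den_pos. }
  rewrite !Rpower_plus; set (r := sqrt c0) in *; rewrite <- Hs; ring.
Qed.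

Lemma q_0 : q_ 0 = 1.
Proof. apply Rpower_O; lra. Qed.

Lemma coef_bound0 e0 x1 x2 y : 1 <= y ->
  0 <= q_ e0 * sqrt (qn x1) * (sqrt (qn x2) / qn y)
    <= c0 * q_ (e0 - x1 / 2 - x2 / 2 + (y - 1)).
Proof.
intro Hy; assert (H := coef_bound e0 x1 0 x2 y Hy).
rewrite q_0, Rmult_1_l, Rplus_0_r in H; exact H.
Qed.

Lemma coef_bound2 e0 x1 e x2 y y' : 1 <= y -> 1 <= y' ->
  0 <= q_ e0 * sqrt (qn x1) * (q_ e * (sqrt (qn x2) / (qn y * qn y')))
    <= c0 * q_ (e0 - x1 / 2 + e - x2 / 2 + (y - 1) + (y' - 1)).
Proof.
intros Hy Hy'; destruct (inv_qnum_le y' Hy') as [Hy0 Hy1].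
destruct (coef_bound e0 x1 e x2 y Hy) as [H1 H2].
replace (q_ e0 * sqrt (qn x1) * (q_ e * (sqrt (qn x2) / (qn y * qn y'))))
  with (q_ e0 * sqrt (qn x1) * (q_ e * (sqrt (qn x2) / qn y)) * / qn y')
  by (unfold Rdiv; rewrite Rinv_mult; ring).
rewrite Rpower_plus, <- (Rmult_assoc c0); split.
- apply Rmult_le_pos; lra.
- apply Rmult_le_compat; lra.
Qed.


Local Notation Lq := (- ln q).

(** This is 1 + u <= exp u at u = - t ln q. *)
Lemma linear_decay t : 0 <= t -> t * q_ t <= / Lq.
Proof.
intro Ht; assert (HL := ln_q_neg).
apply Rmult_le_reg_r with (Lq * q_ (- t)).
{ apply Rmult_lt_0_compat; [lra|apply q_pos]. }
replace (/ Lq * (Lq * q_ (- t))) with (q_ (- t)) by (field; lra).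
replace (t * q_ t * (Lq * q_ (- t))) with (t * Lq * (q_ t * q_ (- t))) by ring.
rewrite <- Rpower_plus, Rplus_opp_r, q_0.
unfold Rpower; replace (- t * ln q) with (t * Lq) by ring.
destruct (Req_dec (t * Lq) 0) as [E0|E0].
- rewrite E0, exp_0; lra.
- assert (H := exp_ineq1 (t * Lq) E0); lra.
Qed.

(** One constant for the two estimates that follow: the first summand serves the quadratic one, the
    second the linear one. The power q^(-4) comes from t - 2 = (t + 2) - 4, and the 4 from splitting
    t + 2 into two halves. *)
Definition decay_const : R := q_ (-4) * (4 * (/ Lq * / Lq)) + 2 * q_ (-4) * / Lq.

Lemma inv_Lq_pos : 0 < / Lq.
Proof. apply Rinv_0_lt_compat; generalize ln_q_neg; lra. Qed.

Lemma quadratic_decay t x : 0 <= t -> t - 2 <= x -> (t + 2) ^ 2 * q_ x <= decay_const.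
Proof.
intros Ht Hx; assert (HL := inv_Lq_pos).
assert (H : (t + 2) / 2 * q_ ((t + 2) / 2) <= / Lq) by (apply linear_decay; lra).
assert (H0 : 0 <= (t + 2) / 2 * q_ ((t + 2) / 2)).
{ apply Rmult_le_pos; [lra|apply Rlt_le, q_pos]. }
assert (Hm : q_ x <= q_ (-4) * (q_ ((t + 2) / 2) * q_ ((t + 2) / 2))).
{ rewrite <- !Rpower_plus; apply q_antitone; lra. }
apply Rle_trans with (q_ (-4) * (4 * (/ Lq * / Lq))).
- apply Rle_trans with ((t + 2) ^ 2 * (q_ (-4) * (q_ ((t + 2) / 2) * q_ ((t + 2) / 2)))).
  + apply Rmult_le_compat_l; [apply pow2_ge_0|exact Hm].
  + replace ((t + 2) ^ 2 * (q_ (-4) * (q_ ((t + 2) / 2) * q_ ((t + 2) / 2))))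
      with (q_ (-4) * (4 * (((t + 2) / 2 * q_ ((t + 2) / 2)) * ((t + 2) / 2 * q_ ((t + 2) / 2))))) by field.
    apply Rmult_le_compat_l; [apply Rlt_le, q_pos|].
    apply Rmult_le_compat_l; [lra|]; apply Rmult_le_compat; lra.
- unfold decay_const; generalize (q_pos (-4)); intro.
  assert (0 <= 2 * q_ (-4) * / Lq) by (repeat apply Rmult_le_pos; lra); lra.
Qed.

Lemma weight_decay t x u : 0 <= t -> t - 2 <= x -> u <= 2 * (t + 2) -> u * q_ x <= decay_const.
Proof.
intros Ht Hx Hu; assert (HL := inv_Lq_pos).
assert (H : (t + 2) * q_ (t + 2) <= / Lq) by (apply linear_decay; lra).
assert (Hm : q_ x <= q_ (-4) * q_ (t + 2)).
{ rewrite <- Rpower_plus; apply q_antitone; lra. }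
assert (H4 := q_pos (-4)); assert (Ht2 := q_pos (t + 2)).
apply Rle_trans with (2 * (t + 2) * q_ x).
{ apply Rmult_le_compat_r; [apply Rlt_le, q_pos|exact Hu]. }
apply Rle_trans with (2 * (t + 2) * (q_ (-4) * q_ (t + 2))).
{ apply Rmult_le_compat_l; lra. }
apply Rle_trans with (2 * q_ (-4) * / Lq).
{ replace (2 * (t + 2) * (q_ (-4) * q_ (t + 2))) with (2 * q_ (-4) * ((t + 2) * q_ (t + 2))) by ring.
  apply Rmult_le_compat_l; lra. }
unfold decay_const; assert (0 <= q_ (-4) * (4 * (/ Lq * / Lq))); [|lra].
repeat apply Rmult_le_pos; lra.
Qed.

Lemma valid_up_R J M N : valid (Label J M N up) = true ->
  0 <= IZR J /\ - IZR J <= IZR M /\ - IZR J - 1 <= IZR N.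
Proof.
rewrite valid_up; intro H; replace (- IZR J - 1) with (IZR (- J - 1))
  by (rewrite minus_IZR, opp_IZR; reflexivity).
rewrite <- opp_IZR; repeat split; apply IZR_le; lia.
Qed.

Lemma valid_down_R J M N : valid (Label J M N down) = true ->
  1 <= IZR J /\ - IZR J <= IZR M /\ - IZR J + 1 <= IZR N.
Proof.
rewrite valid_down; intro H; replace (- IZR J + 1) with (IZR (- J + 1))
  by (rewrite plus_IZR, opp_IZR; reflexivity).
rewrite <- opp_IZR; repeat split; apply IZR_le; lia.
Qed.

Local Notation j_ J := (IZR J / 2).
Definition kap (M N : Z) : R := q_ ((IZR M / 2 + IZR N / 2 - 1 / 2) / 2).

Definition a_plus (s : spin) (J M N : Z) : R :=
  match s with
  | up => kap M N * sqrt (qn (j_ J + j_ M + 1))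
      * (q_ (- j_ J - 1 / 2) * (sqrt (qn (j_ J + j_ N + 3 / 2)) / qn (2 * j_ J + 2)))
  | down => kap M N * sqrt (qn (j_ J + j_ M + 1)) * q_ (- j_ J)
      * (sqrt (qn (j_ J + j_ N + 1 / 2)) / qn (2 * j_ J + 1))
  end.

Definition a_minus (s : spin) (J M N : Z) : R :=
  match s with
  | up => kap M N * sqrt (qn (j_ J - j_ M)) * q_ (j_ J + 1)
      * (sqrt (qn (j_ J - j_ N + 1 / 2)) / qn (2 * j_ J + 1))
  | down => kap M N * sqrt (qn (j_ J - j_ M))
      * (q_ (j_ J + 1 / 2) * (sqrt (qn (j_ J - j_ N - 1 / 2)) / qn (2 * j_ J)))
  end.

Definition a_flip (s : spin) (J M N : Z) : R :=
  match s with
  | up => kap M N * sqrt (qn (j_ J + j_ M + 1))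
      * (q_ (1 / 2) * (sqrt (qn (j_ J - j_ N + 1 / 2)) / (qn (2 * j_ J + 1) * qn (2 * j_ J + 2))))
  | down => kap M N * sqrt (qn (j_ J - j_ M))
      * (- q_ (1 / 2) * (sqrt (qn (j_ J + j_ N + 1 / 2)) / (qn (2 * j_ J) * qn (2 * j_ J + 1))))
  end.

Definition b_plus (s : spin) (J M N : Z) : R :=
  match s with
  | up => kap M N * sqrt (qn (j_ J + j_ M + 1))
      * (sqrt (qn (j_ J - j_ N + 3 / 2)) / qn (2 * j_ J + 2))
  | down => kap M N * sqrt (qn (j_ J + j_ M + 1)) * q_ (- 1 / 2)
      * (sqrt (qn (j_ J - j_ N + 1 / 2)) / qn (2 * j_ J + 1))
  end.

Definition b_minus (s : spin) (J M N : Z) : R :=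
  match s with
  | up => - kap M N * sqrt (qn (j_ J - j_ M)) * q_ (- 1 / 2)
      * (sqrt (qn (j_ J + j_ N + 1 / 2)) / qn (2 * j_ J + 1))
  | down => kap M N * sqrt (qn (j_ J - j_ M)) * - (sqrt (qn (j_ J + j_ N - 1 / 2)) / qn (2 * j_ J))
  end.

Definition b_flip (s : spin) (J M N : Z) : R :=
  match s with
  | up => kap M N * sqrt (qn (j_ J + j_ M + 1))
      * (- q_ (- j_ J - 1) * (sqrt (qn (j_ J + j_ N + 1 / 2)) / (qn (2 * j_ J + 1) * qn (2 * j_ J + 2))))
  | down => kap M N * sqrt (qn (j_ J - j_ M))
      * (- q_ (j_ J) * (sqrt (qn (j_ J - j_ N + 1 / 2)) / (qn (2 * j_ J) * qn (2 * j_ J + 1))))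
  end.

Lemma a_form a : acts_as_a q a -> forall i k J M N s, proj1_sig k = Label J M N s ->
  ent spinor_index_dec a i k = RtoC (a_plus s J M N * ind i (Label (J + 1) (M + 1) (N + 1) s)
    + a_minus s J M N * ind i (Label (J - 1) (M + 1) (N + 1) s)
    + a_flip s J M N * ind i (Label (flip_j s J) (M + 1) (N + 1) (other s))).
Proof.
intros ha i k J M N s Hk; unfold ent; rewrite (basis_ket k J M N s Hk).
assert (Hv := proj2_sig k); cbv beta in Hv; rewrite Hk in Hv.
destruct (ha J M N) as [H1 H2]; destruct s.
- rewrite (H1 Hv), !coord_plus_module, !coord_scal, !coord_plus_module, !coord_scal, !coord_ket.
  unfold a_plus, a_minus, a_flip, kap, flip_j, other; rewrite <- ?RtoC_mult, <- ?RtoC_plus, <- ?RtoC_mult, <- ?RtoC_plus.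
  f_equal; ring.
- rewrite (H2 Hv), !coord_plus_module, !coord_scal, !coord_plus_module, !coord_scal, !coord_ket.
  unfold a_plus, a_minus, a_flip, kap, flip_j, other; rewrite <- ?RtoC_mult, <- ?RtoC_plus, <- ?RtoC_mult, <- ?RtoC_plus.
  f_equal; ring.
Qed.

Lemma b_form b : acts_as_b q b -> forall i k J M N s, proj1_sig k = Label J M N s ->
  ent spinor_index_dec b i k = RtoC (b_plus s J M N * ind i (Label (J + 1) (M + 1) (N + -1) s)
    + b_minus s J M N * ind i (Label (J - 1) (M + 1) (N + -1) s)
    + b_flip s J M N * ind i (Label (flip_j s J) (M + 1) (N + -1) (other s))).
Proof.
intros hb i k J M N s Hk; unfold ent; rewrite (basis_ket k J M N s Hk).
assert (Hv := proj2_sig k); cbv beta in Hv; rewrite Hk in Hv.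
replace (N + -1)%Z with (N - 1)%Z by ring.
destruct (hb J M N) as [H1 H2]; destruct s.
- rewrite (H1 Hv), !coord_plus_module, !coord_scal, !coord_plus_module, !coord_scal, !coord_ket.
  unfold b_plus, b_minus, b_flip, kap, flip_j, other; rewrite <- ?RtoC_mult, <- ?RtoC_plus, <- ?RtoC_mult, <- ?RtoC_plus.
  f_equal; ring.
- rewrite (H2 Hv), !coord_plus_module, !coord_scal, !coord_plus_module, !coord_scal, !coord_ket.
  unfold b_plus, b_minus, b_flip, kap, flip_j, other; rewrite <- ?RtoC_mult, <- ?RtoC_plus, <- ?RtoC_mult, <- ?RtoC_plus.
  f_equal; ring.
Qed.

Lemma c0_pos : 0 < c0.
Proof. apply Rinv_0_lt_compat, qnum_den_pos. Qed.

Lemma flip_decay f J x : 0 <= IZR J -> IZR J - 2 <= x -> Rabs f <= c0 * q_ x ->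
  Rabs f * (IZR J + 2) ^ 2 <= c0 * decay_const.
Proof.
intros HJ Hx Hf; assert (Hc := c0_pos).
apply Rle_trans with (c0 * q_ x * (IZR J + 2) ^ 2).
- apply Rmult_le_compat_r; [apply pow2_ge_0|exact Hf].
- rewrite Rmult_assoc; apply Rmult_le_compat_l; [lra|]; rewrite Rmult_comm.
  apply quadratic_decay; trivial.
Qed.

(** Two q-numbers in the denominator make a spin flip O(q^(2j)) uniformly in mu and n, right up to
    the faces. *)
Lemma a_flip_bound J M N s : valid (Label J M N s) = true ->
  Rabs (a_flip s J M N) * (IZR J + 2) ^ 2 <= c0 * decay_const.
Proof.
destruct s; intro Hv; unfold a_flip, kap.
- destruct (valid_up_R J M N Hv) as (H1 & H2 & H3).
  eapply flip_decay; [lra| |rewrite Rabs_pos_eq; apply coef_bound2; lra]; lra.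
- destruct (valid_down_R J M N Hv) as (H1 & H2 & H3).
  rewrite Ropp_mult_distr_l_reverse, Ropp_mult_distr_r_reverse, Rabs_Ropp.
  eapply flip_decay; [lra| |rewrite Rabs_pos_eq; apply coef_bound2; lra]; lra.
Qed.

Lemma b_flip_bound J M N s : valid (Label J M N s) = true ->
  Rabs (b_flip s J M N) * (IZR J + 2) ^ 2 <= c0 * decay_const.
Proof.
destruct s; intro Hv; unfold b_flip, kap;
  rewrite Ropp_mult_distr_l_reverse, Ropp_mult_distr_r_reverse, Rabs_Ropp.
- destruct (valid_up_R J M N Hv) as (H1 & H2 & H3).
  eapply flip_decay; [lra| |rewrite Rabs_pos_eq; apply coef_bound2; lra]; lra.
- destruct (valid_down_R J M N Hv) as (H1 & H2 & H3).
  eapply flip_decay; [lra| |rewrite Rabs_pos_eq; apply coef_bound2; lra]; lra.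
Qed.

(** The coefficients of a without spin flip are symmetric under the exchange of mu and n with the
    shift of j. That part of a therefore commutes with W exactly, with no error term. *)
Lemma a_plus_swap J M N : a_plus down (J + 1) N M = a_plus up J M N.
Proof.
unfold a_plus, kap; rewrite plus_IZR.
replace (IZR N / 2 + IZR M / 2 - 1 / 2) with (IZR M / 2 + IZR N / 2 - 1 / 2) by ring.
replace ((IZR J + 1) / 2 + IZR N / 2 + 1) with (IZR J / 2 + IZR N / 2 + 3 / 2) by field.
replace ((IZR J + 1) / 2 + IZR M / 2 + 1 / 2) with (IZR J / 2 + IZR M / 2 + 1) by field.
replace (- ((IZR J + 1) / 2)) with (- (IZR J / 2) - 1 / 2) by field.
replace (2 * ((IZR J + 1) / 2) + 1) with (2 * (IZR J / 2) + 2) by field.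
unfold Rdiv; ring.
Qed.

Lemma a_minus_swap J M N : a_minus down (J + 1) N M = a_minus up J M N.
Proof.
unfold a_minus, kap; rewrite plus_IZR.
replace (IZR N / 2 + IZR M / 2 - 1 / 2) with (IZR M / 2 + IZR N / 2 - 1 / 2) by ring.
replace ((IZR J + 1) / 2 - IZR N / 2) with (IZR J / 2 - IZR N / 2 + 1 / 2) by field.
replace ((IZR J + 1) / 2 - IZR M / 2 - 1 / 2) with (IZR J / 2 - IZR M / 2) by field.
replace ((IZR J + 1) / 2 + 1 / 2) with (IZR J / 2 + 1) by field.
replace (2 * ((IZR J + 1) / 2)) with (2 * (IZR J / 2) + 1) by field.
unfold Rdiv; ring.
Qed.

End Generators.

(** * Smoothness of the generators and of the algebra *)

Section SmoothGenerators.
Context (q : R) (hq : 0 < q < 1).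
Local Notation E := (ent spinor_index_dec).
Local Notation q_ := (Rpower q).
Local Notation c0 := (/ (/ q - q)).

Lemma ind_swap i l : ind (swap i) (swap_label l) = ind i l.
Proof.
unfold ind; destruct (label_dec (proj1_sig i) l) as [E1|E1],
  (label_dec (proj1_sig (swap i)) (swap_label l)) as [E2|E2]; trivial; exfalso.
- apply E2; simpl; rewrite E1; reflexivity.
- apply E1; simpl in E2; rewrite <- (swap_label_involutive l), <- E2.
  symmetry; apply swap_label_involutive.
Qed.

Lemma ind_spin i l : spin_of (proj1_sig i) <> spin_of l -> ind i l = 0.
Proof.
intro H; unfold ind; destruct (label_dec (proj1_sig i) l) as [E1|E1]; trivial.
exfalso; apply H; rewrite E1; reflexivity.
Qed.

Lemma a_swap a : acts_as_a q a -> forall i k, spin_of (proj1_sig i) = spin_of (proj1_sig k) ->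
  E a i k = E a (swap i) (swap k).
Proof.
intro ha.
assert (Hup : forall i k, spin_of (proj1_sig i) = up -> spin_of (proj1_sig k) = up ->
  E a i k = E a (swap i) (swap k)).
{ intros i k Hi Hk; destruct (proj1_sig k) as [J M N s] eqn:Ek; simpl in Hk; subst s.
  assert (Es : proj1_sig (swap k) = Label (J + 1) N M down) by (simpl; rewrite Ek; reflexivity).
  rewrite (a_form q a ha i k J M N up Ek), (a_form q a ha _ _ _ _ _ _ Es).
  rewrite a_plus_swap, a_minus_swap; f_equal.
  rewrite <- (ind_swap i (Label (J + 1) (M + 1) (N + 1) up)).
  rewrite <- (ind_swap i (Label (J - 1) (M + 1) (N + 1) up)).
  rewrite (ind_spin i (Label (flip_j up J) (M + 1) (N + 1) (other up))) by (rewrite Hi; discriminate).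
  rewrite (ind_spin (swap i) (Label (flip_j down (J + 1)) (N + 1) (M + 1) (other down))).
  - cbn [swap_label]; replace (J + 1 - 1)%Z with (J - 1 + 1)%Z by lia; ring.
  - simpl; destruct (proj1_sig i) as [J' M' N' s']; simpl in *; subst s'; discriminate. }
intros i k Hik; destruct (spin_of (proj1_sig k)) eqn:Hk; [auto|].
rewrite <- (swap_swap i) at 1; rewrite <- (swap_swap k) at 1; symmetry; apply Hup.
- simpl; destruct (proj1_sig i) as [J M N s]; simpl in *; subst s; reflexivity.
- simpl; destruct (proj1_sig k) as [J M N s]; simpl in *; subst s; reflexivity.
Qed.

Lemma depth_up_R J M N : IZR (depth (Label J M N up)) <= 1 + IZR J + IZR M
  /\ IZR (depth (Label J M N up)) <= IZR J + IZR N + 2.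
Proof.
cbn [depth]; split; [rewrite <- !plus_IZR; apply IZR_le; lia|].
replace 2 with (IZR 2) by reflexivity; rewrite <- !plus_IZR; apply IZR_le; lia.
Qed.

Lemma depth_down_R J M N : IZR (depth (Label J M N down)) <= 1 + IZR J + IZR M
  /\ IZR (depth (Label J M N down)) <= IZR J + IZR N.
Proof.
cbn [depth]; split; rewrite <- !plus_IZR; apply IZR_le; lia.
Qed.

Lemma depth_decay f u t x : 0 <= u -> 0 <= t -> t - 2 <= x -> u <= 2 * (t + 2) ->
  Rabs f <= c0 * q_ x -> Rabs f * u <= c0 * decay_const q.
Proof.
intros Hu0 Ht Hx Hu Hf; assert (Hc := c0_pos q hq).
apply Rle_trans with (c0 * q_ x * u).
- apply Rmult_le_compat_r; trivial.
- rewrite Rmult_assoc; apply Rmult_le_compat_l; [lra|]; rewrite Rmult_comm.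
  apply (weight_decay q hq) with t; trivial.
Qed.

(** Here b_+ is O(q^(j+n)), and below b_- is O(q^(j+mu)): each is small away from one face only. The
    depth is a minimum and so is controlled by either distance. The first argument of [depth_decay]
    is the distance to the face, the second the exponent delivered by [coef_bound] or
    [coef_bound0]. *)
Lemma b_plus_bound J M N s : valid (Label J M N s) = true ->
  Rabs (b_plus q s J M N) * IZR (depth (Label J M N s)) <= c0 * decay_const q.
Proof.
intro Hv; assert (Hd := depth_pos _ Hv); apply IZR_le in Hd.
destruct s; unfold b_plus, kap.
- destruct (valid_up_R J M N Hv) as (H1 & H2 & H3), (depth_up_R J M N) as [H4 H5].
  apply depth_decay with (IZR J / 2 + IZR N / 2 + 1 / 2)
    (((IZR M / 2 + IZR N / 2 - 1 / 2) / 2) - (IZR J / 2 + IZR M / 2 + 1) / 2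
      - (IZR J / 2 - IZR N / 2 + 3 / 2) / 2 + (2 * (IZR J / 2) + 2 - 1)); try lra.
  rewrite Rabs_pos_eq; apply (coef_bound0 q hq); lra.
- destruct (valid_down_R J M N Hv) as (H1 & H2 & H3), (depth_down_R J M N) as [H4 H5].
  rewrite (Rmult_assoc (_ * _)).
  apply depth_decay with (IZR J / 2 + IZR N / 2 - 1 / 2)
    (((IZR M / 2 + IZR N / 2 - 1 / 2) / 2) - (IZR J / 2 + IZR M / 2 + 1) / 2 + (- 1 / 2)
      - (IZR J / 2 - IZR N / 2 + 1 / 2) / 2 + (2 * (IZR J / 2) + 1 - 1)); try lra.
  rewrite Rabs_pos_eq; apply (coef_bound q hq); lra.
Qed.

Lemma b_minus_bound J M N s : valid (Label J M N s) = true ->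
  Rabs (b_minus q s J M N) * IZR (depth (Label J M N s)) <= c0 * decay_const q.
Proof.
intro Hv; assert (Hd := depth_pos _ Hv); apply IZR_le in Hd.
destruct s; unfold b_minus, kap.
- destruct (valid_up_R J M N Hv) as (H1 & H2 & H3), (depth_up_R J M N) as [H4 H5].
  rewrite (Rmult_assoc (_ * _)), !Ropp_mult_distr_l_reverse, Rabs_Ropp.
  apply depth_decay with (IZR J / 2 + IZR M / 2)
    (((IZR M / 2 + IZR N / 2 - 1 / 2) / 2) - (IZR J / 2 - IZR M / 2) / 2 + (- 1 / 2)
      - (IZR J / 2 + IZR N / 2 + 1 / 2) / 2 + (2 * (IZR J / 2) + 1 - 1)); try lra.
  rewrite Rabs_pos_eq; apply (coef_bound q hq); lra.
- destruct (valid_down_R J M N Hv) as (H1 & H2 & H3), (depth_down_R J M N) as [H4 H5].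
  rewrite Ropp_mult_distr_r_reverse, Rabs_Ropp.
  apply depth_decay with (IZR J / 2 + IZR M / 2)
    (((IZR M / 2 + IZR N / 2 - 1 / 2) / 2) - (IZR J / 2 - IZR M / 2) / 2
      - (IZR J / 2 + IZR N / 2 - 1 / 2) / 2 + (2 * (IZR J / 2) - 1)); try lra.
  rewrite Rabs_pos_eq; apply (coef_bound0 q hq); lra.
Qed.

Lemma b_entry_bound b : acts_as_b q b -> forall i k, spin_of (proj1_sig i) = spin_of (proj1_sig k) ->
  Cmod (E b i k) * weight k <= 2 * (c0 * decay_const q).
Proof.
intros hb i k Hik; destruct (proj1_sig k) as [J M N s] eqn:Ek.
assert (Hv := proj2_sig k); cbv beta in Hv; rewrite Ek in Hv.
assert (H1 := b_plus_bound J M N s Hv); assert (H2 := b_minus_bound J M N s Hv).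
unfold weight; rewrite Ek.
assert (Hd := depth_pos _ Hv); apply IZR_le in Hd.
rewrite (b_form q b hb i k J M N s Ek), Cmod_R.
rewrite (ind_spin i (Label (flip_j s J) (M + 1) (N + -1) (other s)))
  by (rewrite Hik; destruct s; discriminate).
assert (Hind : forall l, 0 <= ind i l <= 1).
{ intro l; unfold ind; destruct (label_dec (proj1_sig i) l); lra. }
set (u := IZR (depth _)) in *.
set (P := b_plus q s J M N) in *; set (Q := b_minus q s J M N) in *.
assert (HP := Hind (Label (J + 1) (M + 1) (N + -1) s)).
assert (HQ := Hind (Label (J - 1) (M + 1) (N + -1) s)).
set (x := ind i (Label (J + 1) (M + 1) (N + -1) s)) in *.
set (y := ind i (Label (J - 1) (M + 1) (N + -1) s)) in *.
rewrite Rmult_0_r, Rplus_0_r.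
apply Rle_trans with ((Rabs P + Rabs Q) * u); [|lra].
apply Rmult_le_compat_r; [lra|].
eapply Rle_trans; [apply Rabs_triang|]; rewrite !Rabs_mult, (Rabs_pos_eq x), (Rabs_pos_eq y) by lra.
assert (A1 := Rabs_pos P); assert (A2 := Rabs_pos Q); nra.
Qed.

Local Notation smooth_ := (smooth (clip_op dirac_eigenvalue) (clip_op weight)
    (swap_weight_op swap swap_swap weight)).

Lemma decay_const_ge0 : 0 <= c0 * decay_const q.
Proof.
assert (Hc := c0_pos q hq); assert (H := quadratic_decay q hq 0 0 (Rle_refl 0)).
apply Rmult_le_pos; [lra|].
eapply Rle_trans; [|apply H; lra]; apply Rmult_le_pos; [apply pow2_ge_0|apply Rlt_le, q_pos].
Qed.

Lemma smooth_a a : acts_as_a q a -> smooth_ a.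
Proof.
intro ha.
apply (smooth_of_form a 1 (a_plus q) (a_minus q) (a_flip q) eq_refl (a_form q a ha)
  (c0 * decay_const q)).
- apply (a_flip_bound q hq).
- intros i k Hik; rewrite <- (a_swap a ha i k Hik).
  replace (E a i k - E a i k)%C with (RtoC 0) by ring.
  rewrite Cmod_0, Rmult_0_l; apply decay_const_ge0.
Qed.

(** No cancellation is used, since b raises mu and lowers n, which W does not respect. The entry and
    its conjugate by W are small separately, with the same invariant weight, whence 4 = 2 + 2. *)
Lemma smooth_b b : acts_as_b q b -> smooth_ b.
Proof.
intro hb; assert (H0 := decay_const_ge0).
apply (smooth_of_form b (-1) (b_plus q) (b_minus q) (b_flip q) eq_refl (b_form q b hb)
  (4 * (c0 * decay_const q))).
- intros J M N s Hv; generalize (b_flip_bound q hq J M N s Hv); lra.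
- intros i k Hik.
  assert (H1 := b_entry_bound b hb i k Hik).
  assert (H2 : Cmod (E b (swap i) (swap k)) * weight (swap k) <= 2 * (c0 * decay_const q)).
  { apply b_entry_bound; [exact hb|].
    destruct i as [[J M N s] Hi], k as [[J' M' N' s'] Hk]; simpl in *; subst s'.
    destruct s; reflexivity. }
  rewrite weight_swap in H2.
  assert (Ht := Cmod_triangle (E b i k) (- E b (swap i) (swap k))); rewrite Cmod_opp in Ht.
  apply Rle_trans with ((Cmod (E b i k) + Cmod (E b (swap i) (swap k))) * weight k); [|lra].
  apply Rmult_le_compat_r; [apply weight_ge0|exact Ht].
Qed.

Lemma generated_smooth a b T : acts_as_a q a -> acts_as_b q b ->
  pre_Cstar_generated a b T -> smooth_ T.
Proof.
intros ha hb HT; apply HT; [|apply smooth_a; exact ha|apply smooth_b; exact hb].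
apply (smooth_pre_Cstar_algebra spinor_index_dec).
- intro n; apply clip_op_adjoint.
- intro n; apply clip_op_adjoint.
- intro n; apply (swap_weight_adjoint spinor_index_dec); apply weight_swap.
Qed.

End SmoothGenerators.

(** * Summability over the spinor basis *)

(** An exponent 1 + delta must be summable and satisfy 3 (1 + delta) - 1 < 3, so any delta strictly
    between 0 and 1/3 would serve. *)
Definition phi (n : nat) : R := Rpower (1 + INR n) (- (5 / 4)).

Lemma phi_pos n : 0 < phi n.
Proof. apply exp_pos. Qed.

(* With r^4 = x and s^4 = x + 1 one has s - r >= 1 / (4 s^3). *)
Lemma phi_telescope x : 0 < x ->
  Rpower (x + 1) (- (5 / 4)) <= 4 * (Rpower x (- (1 / 4)) - Rpower (x + 1) (- (1 / 4))).
Proof.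
intro Hx.
set (r := Rpower x (1 / 4)); set (s := Rpower (x + 1) (1 / 4)).
assert (Hr : 0 < r) by apply exp_pos; assert (Hs : 0 < s) by apply exp_pos.
assert (Hr4 : r ^ 4 = x).
{ unfold r; rewrite <- Rpower_pow by apply exp_pos; rewrite Rpower_mult.
  replace (1 / 4 * INR 4) with 1 by (simpl; field); apply Rpower_1; exact Hx. }
assert (Hs4 : s ^ 4 = x + 1).
{ unfold s; rewrite <- Rpower_pow by apply exp_pos; rewrite Rpower_mult.
  replace (1 / 4 * INR 4) with 1 by (simpl; field); apply Rpower_1; lra. }
replace (Rpower (x + 1) (- (5 / 4))) with (/ (s ^ 5)).
2:{ rewrite Rpower_Ropp; f_equal; unfold s; rewrite <- Rpower_pow by apply exp_pos.
    rewrite Rpower_mult; f_equal; simpl; field. }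
rewrite !Rpower_Ropp; fold r s.
assert (Hrs : r < s).
{ apply Rnot_le_lt; intro H; assert (s ^ 4 <= r ^ 4) by (apply pow_incr; lra); lra. }
assert (H1 : 1 <= 4 * s ^ 3 * (s - r)).
{ replace 1 with (s ^ 4 - r ^ 4) by lra.
  replace (s ^ 4 - r ^ 4) with ((s ^ 3 + s ^ 2 * r + s * r ^ 2 + r ^ 3) * (s - r)) by ring.
  apply Rmult_le_compat_r; [lra|].
  assert (r ^ 2 <= s ^ 2) by (apply pow_incr; lra).
  assert (r ^ 3 <= s ^ 3) by (apply pow_incr; lra).
  assert (s ^ 2 * r <= s ^ 2 * s) by (apply Rmult_le_compat_l; [apply pow2_ge_0|lra]).
  assert (s * r ^ 2 <= s * s ^ 2) by (apply Rmult_le_compat_l; lra).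
  nra. }
replace (4 * (/ r - / s)) with (/ s ^ 5 * (4 * s ^ 3 * (s - r) * (s / r))) by (field; lra).
rewrite <- (Rmult_1_r (/ s ^ 5)) at 1; apply Rmult_le_compat_l.
- apply Rlt_le, Rinv_0_lt_compat, pow_lt; exact Hs.
- assert (H2 : 1 <= s / r).
  { apply Rmult_le_reg_r with r; [exact Hr|]; unfold Rdiv; rewrite Rmult_assoc, Rinv_l by lra; lra. }
  nra.
Qed.

Lemma phi_sum n : lsum phi (seq 0 n) <= 5.
Proof.
(* The telescoping remainder is kept in the claim so that the induction closes; at n = 0 it is the
   equality 1 = 5 - 4. *)
cut (lsum phi (seq 0 (S n)) <= 5 - 4 * Rpower (1 + INR n) (- (1 / 4))).
{ intro H; rewrite seq_S, lsum_app_R, lsum_cons_R, lsum_nil_R in H.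
  generalize (phi_pos (0 + n)) (exp_pos (- (1 / 4) * ln (1 + INR n))); unfold Rpower in H; lra. }
induction n as [|n IH].
- simpl seq; rewrite lsum_cons_R, lsum_nil_R; unfold phi; simpl INR; rewrite !Rplus_0_r.
  unfold Rpower; rewrite ln_1, !Rmult_0_r, exp_0; lra.
- rewrite seq_S, lsum_app_R, lsum_cons_R, lsum_nil_R; simpl Nat.add.
  assert (H := phi_telescope (1 + INR n)); unfold phi at 2.
  rewrite S_INR; replace (1 + (INR n + 1)) with (1 + INR n + 1) by ring.
  assert (0 < 1 + INR n) by (generalize (pos_INR n); lra).
  specialize (H H0); lra.
Qed.

Lemma lsum_list_prod {A B : Type} (F : A * B -> R) (l : list A) (l' : list B) :
  lsum F (list_prod l l') = lsum (fun a => lsum (fun b => F (a, b)) l') l.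
Proof.
induction l as [|a l IH]; [reflexivity|].
simpl list_prod; rewrite lsum_app_R, lsum_map, IH, lsum_cons_R; reflexivity.
Qed.

Lemma NoDup_list_prod {A B : Type} (l : list A) (l' : list B) :
  NoDup l -> NoDup l' -> NoDup (list_prod l l').
Proof.
intros Hl Hl'; induction Hl as [|a l Ha Hl IH]; [constructor|].
simpl; apply NoDup_app; trivial.
- apply FinFun.Injective_map_NoDup; [intros x y E; injection E; trivial|exact Hl'].
- intros [x y] H H'; apply in_map_iff in H; destruct H as [z [E _]]; injection E as <- _.
  apply in_prod_iff in H'; apply Ha, H'.
Qed.

(** The second and third coordinates are the doubled distances to the two faces, so the weight is
    one plus the smaller of them; together with 2j and the spin they determine the label. *)
Definition coords (k : label) : nat * (nat * (nat * bool)) :=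
  match k with
  | Label J M N up => (Z.to_nat J, (Z.to_nat (J + M), (Z.to_nat (J + N + 1), true)))
  | Label J M N down => (Z.to_nat J, (Z.to_nat (J + M), (Z.to_nat (J + N - 1), false)))
  end.

Definition phi3 (c : nat * (nat * (nat * bool))) : R :=
  phi (fst c) * (phi (fst (snd c)) * phi (fst (snd (snd c)))).

Lemma coords_inj (i j : spinor_index) :
  coords (proj1_sig i) = coords (proj1_sig j) -> i = j.
Proof.
intro H; apply spinor_index_eq.
destruct i as [[J M N s] Hi], j as [[J' M' N' s'] Hj]; simpl in H |- *.
destruct s, s'; rewrite ?valid_up, ?valid_down in Hi, Hj; injection H; try discriminate;
  intros; f_equal; lia.
Qed.

Lemma phi3_pos c : 0 < phi3 c.
Proof. repeat apply Rmult_lt_0_compat; apply phi_pos. Qed.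

(** The labels embed in a box of three natural coordinates and a spin: 250 = 5 ^ 3 * 2. *)
Lemma phi3_sum (l : list spinor_index) : NoDup l ->
  lsum (fun i => phi3 (coords (proj1_sig i))) l <= 250.
Proof.
intro Hl; rewrite <- (lsum_map phi3 (fun i : spinor_index => coords (proj1_sig i))).
set (m := map _ l).
assert (Hm : NoDup m) by (apply FinFun.Injective_map_NoDup; [exact coords_inj|exact Hl]).
assert (Hn : exists n, forall c, In c m ->
  (fst c < n /\ fst (snd c) < n /\ fst (snd (snd c)) < n)%nat).
{ clear; induction m as [|c m [n Hn]]; [exists 0%nat; intros c []|].
  exists (n + S (fst c) + S (fst (snd c)) + S (fst (snd (snd c))))%nat.
  intros c' [<-|H]; [lia|]; generalize (Hn c' H); lia. }
destruct Hn as [n Hn].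
set (s := seq 0 n); set (box := list_prod s (list_prod s (list_prod s [true; false]))).
apply Rle_trans with (lsum phi3 box).
- apply lsum_incl; trivial.
  + intro c; apply Rlt_le, phi3_pos.
  + assert (Hs : NoDup s) by apply seq_NoDup.
    assert (Hb : NoDup [true; false]).
    { constructor; [intros [H|[]]; discriminate|constructor; [intros []|constructor]]. }
    unfold box; repeat apply NoDup_list_prod; trivial.
  + intros [x [y [z t]]] Hc; apply Hn in Hc; simpl in Hc.
    repeat apply in_prod; try (apply in_seq; lia); destruct t; simpl; auto.
- set (S := lsum phi s : R).
  assert (HS : S <= 5) by apply phi_sum.
  assert (HS0 : 0 <= S) by (apply lsum_ge0; intro; apply Rlt_le, phi_pos).
  assert (Eq : lsum phi3 box = S * (S * (2 * S)) :> R).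
  { unfold box; rewrite lsum_list_prod.
    rewrite (lsum_ext _ (fun a => (S * (2 * S)) * phi a)).
    - rewrite lsum_scal_R; fold S; refine (_ : @eq R _ _); ring.
    - intros a _; rewrite lsum_list_prod.
      rewrite (lsum_ext _ (fun b => (phi a * (2 * S)) * phi b)).
      + rewrite lsum_scal_R; fold S; refine (_ : @eq R _ _); ring.
      + intros b _; rewrite lsum_list_prod.
        rewrite (lsum_ext _ (fun c => (2 * (phi a * phi b)) * phi c)).
        * rewrite lsum_scal_R; fold S; refine (_ : @eq R _ _); ring.
        * intros c _; rewrite !lsum_cons_R, lsum_nil_R; unfold phi3; simpl; refine (_ : @eq R _ _); ring. }
  rewrite Eq; assert (S * S <= 25) by nra; nra.
Qed.

Definition level (i : spinor_index) : R := sqrt (dirac_eigenvalue i ^ 2).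

Lemma level_swap i : level (swap i) = level i.
Proof. unfold level; rewrite dirac_swap; f_equal; ring. Qed.

Lemma level_ge (i : spinor_index) : 3 / 2 <= level i /\
  let c := coords (proj1_sig i) in
  1 + INR (fst c) <= 2 * level i /\ 1 + INR (fst (snd c)) <= 2 * level i /\
  1 + INR (fst (snd (snd c))) <= 2 * level i /\
  (weight i = 1 + INR (fst (snd c)) \/ weight i = 1 + INR (fst (snd (snd c)))).
Proof.
assert (HI : forall z, (0 <= z)%Z -> INR (Z.to_nat z) = IZR z).
{ intros z Hz; rewrite INR_IZR_INZ, Z2Nat.id by exact Hz; reflexivity. }
destruct i as [[J M N s] Hv]; unfold level, weight, dirac_eigenvalue; cbn [proj1_sig].
destruct s.
- rewrite valid_up in Hv.
  assert (0 <= IZR J) by (apply IZR_le; lia).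
  assert (IZR M <= IZR J) by (apply IZR_le; lia).
  assert (IZR N <= IZR J + 1) by (rewrite <- plus_IZR; apply IZR_le; lia).
  rewrite sqrt_pow2 by lra; cbn [coords fst snd depth].
  rewrite !HI by lia; rewrite !plus_IZR; repeat split; try lra.
  destruct (Z.min_spec (J + M) (J + N + 1)) as [[_ ->]|[_ ->]]; rewrite ?plus_IZR; [left|right]; ring.
- rewrite valid_down in Hv.
  assert (1 <= IZR J) by (apply IZR_le; lia).
  assert (IZR M <= IZR J) by (apply IZR_le; lia).
  assert (IZR N <= IZR J - 1) by (rewrite <- minus_IZR; apply IZR_le; lia).
  replace ((- (IZR J + 1 / 2)) ^ 2) with ((IZR J + 1 / 2) ^ 2) by ring.
  rewrite sqrt_pow2 by lra; cbn [coords fst snd depth].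
  rewrite !HI by lia; rewrite !minus_IZR, !plus_IZR; repeat split; try lra.
  destruct (Z.min_spec (J + M) (J + N - 1)) as [[_ ->]|[_ ->]]; rewrite ?minus_IZR, ?plus_IZR; [left|right]; ring.
Qed.

Lemma Rpower_neg_antitone x y e : 0 < x <= y -> 0 <= e -> Rpower y (- e) <= Rpower x (- e).
Proof.
intros H He; rewrite !Rpower_Ropp; apply Rinv_le_contravar; [apply exp_pos|].
apply Rle_Rpower_l; lra.
Qed.

(** All three factors 1 + c are at most [2 * level i]. This crude count is enough in the half-plane
    where the trace itself is defined. *)
Lemma level_phi3 (i : spinor_index) :
  Rpower (2 * level i) (- (15 / 4)) <= phi3 (coords (proj1_sig i)).
Proof.
destruct (level_ge i) as (H0 & H1 & H2 & H3 & _).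
set (c := coords (proj1_sig i)) in *; set (t := 2 * level i) in *.
replace (- (15 / 4)) with (- (5 / 4) + (- (5 / 4) + - (5 / 4))) by field.
rewrite !Rpower_plus; unfold phi3, phi.
assert (P := pos_INR).
repeat apply Rmult_le_compat; try (apply Rlt_le, exp_pos);
  try (apply Rmult_le_pos; apply Rlt_le, exp_pos);
  apply Rpower_neg_antitone; try lra; split; trivial; apply Rplus_lt_le_0_compat; auto; lra.
Qed.

(** 3 * 5/4 = 11/4 + 1: the decay in the weight is what lets the exponent of
    the level drop from 15/4 below 3. *)
Lemma weight_level_phi3 (i : spinor_index) :
  Rpower (2 * level i) (- (11 / 4)) <= weight i * phi3 (coords (proj1_sig i)).
Proof.
destruct (level_ge i) as (H0 & H1 & H2 & H3 & H4).
set (c := coords (proj1_sig i)) in *; set (t := 2 * level i) in *.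
replace (- (11 / 4)) with (- (5 / 4) + (- (5 / 4) + - (1 / 4))) by field.
rewrite !Rpower_plus; unfold phi3, phi.
assert (P := pos_INR).
assert (split_pow : forall x, 0 < x -> x * Rpower x (- (5 / 4)) = Rpower x (- (1 / 4))).
{ intros x Hx; rewrite <- (Rpower_1 x) at 1 by exact Hx; rewrite <- Rpower_plus; f_equal; field. }
assert (Hp : forall n, 0 < 1 + INR n) by (intro n; apply Rplus_lt_le_0_compat; auto; lra).
destruct H4 as [-> | ->].
- replace (_ * (_ * (_ * _))) with (Rpower (1 + INR (fst c)) (- (5 / 4)) *
    (Rpower (1 + INR (fst (snd (snd c)))) (- (5 / 4)) *
     ((1 + INR (fst (snd c))) * Rpower (1 + INR (fst (snd c))) (- (5 / 4))))) by ring.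
  rewrite split_pow by apply Hp.
  repeat apply Rmult_le_compat; try (apply Rlt_le, exp_pos);
  try (apply Rmult_le_pos; apply Rlt_le, exp_pos);
  apply Rpower_neg_antitone; try lra; split; trivial.
- replace (_ * (_ * (_ * _))) with (Rpower (1 + INR (fst c)) (- (5 / 4)) *
    (Rpower (1 + INR (fst (snd c))) (- (5 / 4)) *
     ((1 + INR (fst (snd (snd c)))) * Rpower (1 + INR (fst (snd (snd c)))) (- (5 / 4))))) by ring.
  rewrite split_pow by apply Hp.
  repeat apply Rmult_le_compat; try (apply Rlt_le, exp_pos);
  try (apply Rmult_le_pos; apply Rlt_le, exp_pos);
  apply Rpower_neg_antitone; try lra; split; trivial.
Qed.

(** * The zeta function *)

Lemma MVT_zero_le (f f' : R -> R) (B x : R) :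
  (forall t, derivable_pt_lim f t (f' t)) -> f 0 = 0 ->
  (forall t, Rabs t <= Rabs x -> Rabs (f' t) <= B) -> Rabs (f x) <= B * Rabs x.
Proof.
intros Hd H0 HB.
destruct (MVT_abs f f' 0 x) as [t [Ht1 Ht2]]; [intros; apply Hd|].
rewrite H0, !Rminus_0_r in Ht1; rewrite Ht1.
apply Rmult_le_compat_r; [apply Rabs_pos|apply HB].
revert Ht2; unfold Rmin, Rmax; destruct (Rle_dec 0 x); intro; unfold Rabs;
  destruct (Rcase_abs t), (Rcase_abs x); lra.
Qed.

Lemma exp_minus_1_le x : Rabs (exp x - 1) <= exp (Rabs x) * Rabs x.
Proof.
apply (MVT_zero_le (fun t => exp t - 1) exp).
- intro t; rewrite <- (Rminus_0_r (exp t)) at 1.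
  apply (derivable_pt_lim_minus exp (fun _ => 1)).
  + apply derivable_pt_lim_exp.
  + apply derivable_pt_lim_const.
- rewrite exp_0; ring.
- intros t Ht; rewrite Rabs_pos_eq by (apply Rlt_le, exp_pos).
  assert (H : t <= Rabs x) by (eapply Rle_trans; [apply Rle_abs|exact Ht]).
  destruct (Req_dec t (Rabs x)) as [<-|E]; [lra|left; apply exp_increasing; lra].
Qed.

Lemma exp_taylor2_le x : Rabs (exp x - 1 - x) <= exp (Rabs x) * Rabs x * Rabs x.
Proof.
apply (MVT_zero_le (fun t => exp t - 1 - t) (fun t => exp t - 0 - 1)).
- intro t; apply (derivable_pt_lim_minus (fun t => exp t - 1) id).
  + apply (derivable_pt_lim_minus exp (fun _ => 1));
      [apply derivable_pt_lim_exp|apply derivable_pt_lim_const].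
  + apply derivable_pt_lim_id.
- rewrite exp_0; ring.
- intros t Ht; rewrite Rminus_0_r; eapply Rle_trans; [apply exp_minus_1_le|].
  apply Rmult_le_compat; try apply Rabs_pos; trivial; [apply Rlt_le, exp_pos|].
  destruct (Req_dec (Rabs t) (Rabs x)) as [->|E]; [lra|left; apply exp_increasing; lra].
Qed.

Lemma sin_le_abs y : Rabs (sin y) <= Rabs y.
Proof.
rewrite <- (Rmult_1_l (Rabs y)); apply (MVT_zero_le sin cos).
- apply derivable_pt_lim_sin.
- apply sin_0.
- intros t _; apply Rabs_le; generalize (COS_bound t); lra.
Qed.

Lemma one_minus_cos_le y : Rabs (1 - cos y) <= Rabs y * Rabs y.
Proof.
apply (MVT_zero_le (fun t => 1 - cos t) (fun t => 0 - - sin t)).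
- intro t; apply (derivable_pt_lim_minus (fun _ => 1) cos);
    [apply derivable_pt_lim_const|apply derivable_pt_lim_cos].
- rewrite cos_0; ring.
- intros t Ht; replace (0 - - sin t) with (sin t) by ring.
  eapply Rle_trans; [apply sin_le_abs|exact Ht].
Qed.

Lemma sin_taylor_le y : Rabs (sin y - y) <= 2 * Rabs y * Rabs y.
Proof.
apply (MVT_zero_le (fun t => sin t - t) (fun t => cos t - 1)).
- intro t; apply (derivable_pt_lim_minus sin id);
    [apply derivable_pt_lim_sin|apply derivable_pt_lim_id].
- rewrite sin_0; ring.
- intros t Ht; rewrite Rabs_minus_sym.
  (* The derivative is to be at most 2 |t|: the quadratic bound gives this for |t| <= 1, the trivial
     bound 2 beyond. *)
  destruct (Rle_dec (Rabs t) 1) as [H|H].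
  + eapply Rle_trans; [apply one_minus_cos_le|].
    assert (H0 := Rabs_pos t); nra.
  + apply Rle_trans with 2; [|lra]; apply Rabs_le; generalize (COS_bound t); lra.
Qed.

Definition cexp (z : C) : C := (exp (fst z) * cos (snd z), exp (fst z) * sin (snd z)).

Lemma cexp_plus z w : cexp (z + w) = (cexp z * cexp w)%C.
Proof.
unfold cexp; apply injective_projections; simpl;
  rewrite exp_plus, ?cos_plus, ?sin_plus; ring.
Qed.

Lemma Cmod_cexp z : Cmod (cexp z) = exp (fst z).
Proof.
unfold Cmod, cexp; simpl fst; simpl snd.
replace ((exp (fst z) * cos (snd z)) ^ 2 + (exp (fst z) * sin (snd z)) ^ 2)
  with (exp (fst z) ^ 2).
- apply sqrt_pow2, Rlt_le, exp_pos.
- assert (H := sin2_cos2 (snd z)); unfold Rsqr in H.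
  replace (exp (fst z) ^ 2) with (exp (fst z) ^ 2 * 1) by ring; rewrite <- H; ring.
Qed.

Lemma Cmod_le_sum z : Cmod z <= Rabs (fst z) + Rabs (snd z).
Proof.
replace z with (RtoC (fst z) + Ci * RtoC (snd z))%C at 1.
- eapply Rle_trans; [apply Cmod_triangle|].
  rewrite Cmod_mult, !Cmod_R, Cmod_Ci; lra.
- apply injective_projections; simpl; ring.
Qed.

Lemma exp_le x y : x <= y -> exp x <= exp y.
Proof.
intro H; destruct (Req_dec x y) as [->|E]; [lra|left; apply exp_increasing; lra].
Qed.

(** The real part of the remainder is (e^x - 1 - x) + e^x (cos y - 1), the imaginary part e^x (sin y
    - y) + (e^x - 1) y. The four pieces cost 1 + 1 + 2 + 1 times exp m * m^2, rounded up to 6. *)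
Lemma cexp_taylor h : Cmod (cexp h - 1 - h) <= 6 * exp (Cmod h) * Cmod h ^ 2.
Proof.
destruct h as [x y]; set (m := Cmod (x, y)).
assert (Hm := Rmax_Cmod (x, y)); simpl fst in Hm; simpl snd in Hm; fold m in Hm.
assert (Hx : Rabs x <= m) by (eapply Rle_trans; [apply Rmax_l|exact Hm]).
assert (Hy : Rabs y <= m) by (eapply Rle_trans; [apply Rmax_r|exact Hm]).
assert (Hx0 := Rabs_pos x); assert (Hy0 := Rabs_pos y); assert (Hm0 : 0 <= m) by lra.
assert (He : 1 <= exp m) by (rewrite <- exp_0; apply exp_le; exact Hm0).
assert (Hex : exp (Rabs x) <= exp m) by (apply exp_le; exact Hx).
assert (Hex' : exp x <= exp m).
{ apply exp_le; eapply Rle_trans; [apply Rle_abs|exact Hx]. }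
assert (Hexp := exp_pos x).
assert (Hm2 : m * m <= exp m * (m * m)).
{ rewrite <- (Rmult_1_l (m * m)) at 1; apply Rmult_le_compat_r; [apply Rmult_le_pos; lra|exact He]. }
assert (B1 : Rabs (exp x - 1 - x) <= exp m * (m * m)).
{ eapply Rle_trans; [apply exp_taylor2_le|]; rewrite Rmult_assoc.
  apply Rmult_le_compat; [apply Rlt_le, exp_pos|apply Rmult_le_pos; lra|exact Hex|].
  apply Rmult_le_compat; lra. }
assert (B2 : Rabs (exp x * (cos y - 1)) <= exp m * (m * m)).
{ rewrite Rabs_mult, (Rabs_pos_eq (exp x)) by lra.
  apply Rmult_le_compat; [lra|apply Rabs_pos|exact Hex'|].
  rewrite Rabs_minus_sym; eapply Rle_trans; [apply one_minus_cos_le|].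
  apply Rmult_le_compat; lra. }
assert (B3 : Rabs (exp x * (sin y - y)) <= 2 * (exp m * (m * m))).
{ rewrite Rabs_mult, (Rabs_pos_eq (exp x)) by lra.
  apply Rle_trans with (exp m * (2 * (m * m))); [|lra].
  apply Rmult_le_compat; [lra|apply Rabs_pos|exact Hex'|].
  eapply Rle_trans; [apply sin_taylor_le|]; rewrite Rmult_assoc.
  apply Rmult_le_compat_l; [lra|]; apply Rmult_le_compat; lra. }
assert (B4 : Rabs ((exp x - 1) * y) <= exp m * (m * m)).
{ rewrite Rabs_mult, <- Rmult_assoc; apply Rmult_le_compat; try apply Rabs_pos; trivial.
  eapply Rle_trans; [apply exp_minus_1_le|].
  apply Rmult_le_compat; trivial; apply Rlt_le, exp_pos. }
eapply Rle_trans; [apply Cmod_le_sum|]; simpl fst; simpl snd.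
replace (exp x * cos y + - (1) + - x) with ((exp x - 1 - x) + exp x * (cos y - 1)) by ring.
replace (exp x * sin y + - 0 + - y) with (exp x * (sin y - y) + (exp x - 1) * y) by ring.
assert (T1 := Rabs_triang (exp x - 1 - x) (exp x * (cos y - 1))).
assert (T2 := Rabs_triang (exp x * (sin y - y)) ((exp x - 1) * y)).
replace (6 * exp m * m ^ 2) with (6 * (exp m * (m * m))) by ring.
assert (0 <= exp m * (m * m)) by (apply Rmult_le_pos; nra).
lra.
Qed.

Lemma cpow_cexp r w : cpow r w = cexp (w * RtoC (ln r)).
Proof.
destruct w as [x y]; unfold cpow, cexp; simpl.
replace (x * ln r - y * 0) with (x * ln r) by ring.
replace (x * 0 + y * ln r) with (y * ln r) by ring; reflexivity.
Qed.

Lemma Cmod_cpow r w : Cmod (cpow r w) = Rpower r (Re w).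
Proof. rewrite cpow_cexp, Cmod_cexp; destruct w as [x y]; unfold Rpower; simpl; f_equal; ring. Qed.

(** Differentiability with an explicit quadratic remainder: such remainders can be added over an
    infinite series by domination, and they imply [holomorphic_at]. *)
Definition quad_diff (f : C -> C) (z : C) : Prop :=
  exists (D : C) (K d : R), 0 < d /\ 0 <= K /\
    forall h, Cmod h < d -> Cmod (f (z + h)%C - f z - h * D) <= K * Cmod h ^ 2.

Lemma quad_diff_holomorphic f z : quad_diff f z -> holomorphic_at f z.
Proof.
intros (D & K & d & Hd & HK & H); exists D; split; [apply is_linear_scal_l|].
intros x Hx; assert (Ex : z = x).
{ exact (@is_filter_lim_locally_unique C_AbsRing (AbsRing_NormedModule C_AbsRing) z x Hx). }
subst x; intro eps.
set (e := Rmin d (eps / (K + 1))).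
assert (He : 0 < e).
{ apply Rmin_glb_lt; [exact Hd|].
  apply Rdiv_lt_0_compat; [apply cond_pos|lra]. }
exists (mkposreal _ He); cut (forall y : C, Cmod (y - z) < e -> Cmod (f y - f z - (y - z) * D)%C <= eps * Cmod (y - z)).
{ intros Main y Hy; exact (Main y Hy). }
intros y Hye.
assert (H1 := H (y - z)%C (Rlt_le_trans _ _ _ Hye (Rmin_l _ _))).
replace (z + (y - z))%C with y in H1 by ring.
eapply Rle_trans; [exact H1|].
assert (H0 := Cmod_ge_0 (y - z)).
replace (K * Cmod (y - z) ^ 2) with ((K * Cmod (y - z)) * Cmod (y - z)) by ring.
apply Rmult_le_compat_r; [exact H0|].
assert (H2 : Cmod (y - z) <= eps / (K + 1)) by (eapply Rle_trans; [apply Rlt_le, Hye|apply Rmin_r]).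
apply Rle_trans with ((K + 1) * (eps / (K + 1))); [|right; field; lra].
apply Rmult_le_compat; lra.
Qed.

(** Accounts for the factor z in the definition of tau_1. *)
Lemma quad_diff_mul_id f z : quad_diff f z -> quad_diff (fun w => w * f w)%C z.
Proof.
intros (D & K & d & Hd & HK & H).
exists (f z + z * D)%C, (Cmod z * K + (Cmod D + K * d)), d; split; [exact Hd|split].
{ assert (0 <= Cmod z) by apply Cmod_ge_0; assert (0 <= Cmod D) by apply Cmod_ge_0.
  assert (0 <= K * d) by nra; nra. }
intros h Hh; specialize (H h Hh); set (r := (f (z + h)%C - f z - h * D)%C) in *.
replace ((z + h) * f (z + h) - z * f z - h * (f z + z * D))%C
  with (z * r + h * (h * D + r))%C by (unfold r; ring).
assert (H0 := Cmod_ge_0 h); assert (Hz := Cmod_ge_0 z).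
eapply Rle_trans; [apply Cmod_triangle|]; rewrite !Cmod_mult.
assert (H1 := Cmod_triangle (h * D) r); rewrite Cmod_mult in H1.
assert (HD := Cmod_ge_0 D).
assert (H2 : Cmod r <= K * d * Cmod h).
{ eapply Rle_trans; [exact H|].
  replace (K * d * Cmod h) with (d * (K * Cmod h)) by ring.
  replace (K * Cmod h ^ 2) with (Cmod h * (K * Cmod h)) by ring.
  apply Rmult_le_compat_r; [apply Rmult_le_pos|]; lra. }
assert (H3 : Cmod z * Cmod r <= Cmod z * (K * Cmod h ^ 2)) by (apply Rmult_le_compat_l; trivial).
assert (H4 : Cmod h * Cmod (h * D + r) <= Cmod h * (Cmod h * Cmod D + K * d * Cmod h)).
{ apply Rmult_le_compat_l; lra. }
nra.
Qed.

(** * Dominated Dirichlet series and their holomorphy *)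

Section Zeta.
Context {I : Type} (I_dec : forall i j : I, {i = j} + {i <> j}).
Context (c : I -> C) (lev Phi : I -> R) (S K : R).
Hypothesis lev_ge1 : forall i, 1 <= lev i.
Hypothesis K_ge0 : 0 <= K.
Hypothesis Phi_ge0 : forall i, 0 <= Phi i.
Hypothesis Phi_sum : forall l, NoDup l -> lsum Phi l <= S.
Hypothesis c_bound : forall i, Cmod (c i) * Rpower (lev i) (- (11 / 4)) <= K * Phi i.

Local Notation ell i := (ln (lev i)).

Lemma ell_ge0 i : 0 <= ell i.
Proof.
destruct (Req_dec (lev i) 1) as [->|E]; [rewrite ln_1; lra|].
rewrite <- ln_1; left; apply ln_increasing; generalize (lev_ge1 i); lra.
Qed.

Lemma dominated_summable (f : I -> C) (B : R) : 0 <= B ->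
  (forall i, Cmod (f i) <= B * Phi i) -> exists s, is_sum f s.
Proof.
intros HB H; apply (summable I_dec f (B * S)); intros l Hl.
apply Rle_trans with (lsum (fun i => B * Phi i) l); [apply lsum_le; intros i _; apply H|].
rewrite lsum_scal_R; apply Rmult_le_compat_l; [exact HB|apply Phi_sum; exact Hl].
Qed.

Lemma dominated_sum_le (f : I -> C) (B : R) (s : C) : 0 <= B ->
  (forall i, Cmod (f i) <= B * Phi i) -> is_sum f s -> Cmod s <= B * S.
Proof.
intros HB H Hs; apply (is_sum_Cmod_le I_dec f s _ Hs); intros l Hl.
eapply Rle_trans; [apply Cmod_lsum|].
apply Rle_trans with (lsum (fun i => B * Phi i) l); [apply lsum_le; intros i _; apply H|].
rewrite lsum_scal_R; apply Rmult_le_compat_l; [exact HB|apply Phi_sum; exact Hl].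
Qed.

Definition zeta_term (z : C) (i : I) : C := (c i * cpow (lev i) (RtoC (-3) - 2 * z))%C.
Definition zeta (z : C) : C := Csum (zeta_term z).

Lemma zeta_term_cexp z i : zeta_term z i = (c i * cexp ((RtoC (-3) - 2 * z) * RtoC (ell i)))%C.
Proof. unfold zeta_term; rewrite cpow_cexp; reflexivity. Qed.

Lemma zeta_term_bound z i :
  Cmod (zeta_term z i) <= K * Phi i * exp (- (2 * (Re z + 1 / 8)) * ell i).
Proof.
unfold zeta_term; rewrite Cmod_mult, Cmod_cpow.
(* The splitting isolates the exponent 11/4 of [c_bound]; the rest is nonpositive exactly when Re z
   >= -1/8. *)
replace (Re (RtoC (-3) - 2 * z)) with (- (11 / 4) + - (2 * (Re z + 1 / 8))).
- rewrite Rpower_plus, <- Rmult_assoc; apply Rmult_le_compat_r; [apply Rlt_le, exp_pos|apply c_bound].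
- destruct z as [x y]; simpl; field.
Qed.

Lemma zeta_term_le z i : - (1 / 8) < Re z -> Cmod (zeta_term z i) <= K * Phi i.
Proof.
intro Hz; eapply Rle_trans; [apply zeta_term_bound|].
rewrite <- (Rmult_1_r (K * Phi i)) at 2; apply Rmult_le_compat_l.
- apply Rmult_le_pos; trivial.
- apply Rle_trans with (exp 0); [|rewrite exp_0; lra].
  apply exp_le; rewrite Ropp_mult_distr_l_reverse.
  assert (H : 0 <= 2 * (Re z + 1 / 8) * ell i) by (apply Rmult_le_pos; [lra|apply ell_ge0]); lra.
Qed.

Lemma is_sum_zeta z : - (1 / 8) < Re z -> is_sum (zeta_term z) (zeta z).
Proof.
intro Hz; destruct (dominated_summable (zeta_term z) K K_ge0) as [s Hs].
- intro i; apply zeta_term_le; exact Hz.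
- unfold zeta; rewrite (is_sum_Csum I_dec _ _ Hs); exact Hs.
Qed.

Lemma t_exp_le t : t * exp (- t) <= 1.
Proof.
apply Rmult_le_reg_r with (exp t); [apply exp_pos|].
rewrite Rmult_assoc, <- exp_plus, Rplus_opp_l, exp_0.
assert (H := exp_ineq1_le t); lra.
Qed.

(* Taylor expansion of each term; the factors [ln (lev i)] are absorbed in the
   gap between [Re z] and the abscissa [-1/8]. *)
Lemma zeta_quad_diff z : - (1 / 8) < Re z -> quad_diff zeta z.
Proof.
intro Hz; set (g := Re z + 1 / 8); assert (Hg : 0 < g) by (unfold g; lra).
set (dt := fun i => (zeta_term z i * RtoC (- (2 * ell i)))%C).
assert (Hdt : forall i, Cmod (dt i) <= (K * (1 / g)) * Phi i).
{ intro i; unfold dt; rewrite Cmod_mult, Cmod_R, Rabs_Ropp.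
  assert (He := ell_ge0 i); rewrite Rabs_pos_eq by lra.
  eapply Rle_trans; [apply Rmult_le_compat_r; [lra|apply zeta_term_bound]|].
  fold g.
  assert (H := t_exp_le (2 * g * ell i)).
  replace (- (2 * g * ell i)) with (- (2 * g) * ell i) in H by ring.
  replace (K * Phi i * exp (- (2 * g) * ell i) * (2 * ell i))
    with (K * Phi i * (1 / g) * (2 * g * ell i * exp (- (2 * g) * ell i))) by (field; lra).
  replace (K * (1 / g) * Phi i) with (K * Phi i * (1 / g) * 1) by ring.
  apply Rmult_le_compat_l; [|exact H].
  apply Rmult_le_pos; [apply Rmult_le_pos; trivial|].
  apply Rlt_le, Rdiv_lt_0_compat; lra. }
assert (Hg1 : 0 <= K * (1 / g)).
{ apply Rmult_le_pos; [exact K_ge0|apply Rlt_le, Rdiv_lt_0_compat; lra]. }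
destruct (dominated_summable dt _ Hg1 Hdt) as [D HD].
(* With l = ln (lev i), the Taylor remainder contributes 6 (2 l)^2 = 24 l^2, and 24 l^2 exp (- g l)
   = (96 / g^2) t^2 for t = (g / 2) l exp (- (g / 2) l) <= 1. The radius g / 2 below keeps exp |hh|
   under exp (g l). *)
set (B := K * (96 / g ^ 2)).
assert (HB : 0 <= B).
{ apply Rmult_le_pos; [exact K_ge0|apply Rlt_le, Rdiv_lt_0_compat; [lra|apply pow_lt; lra]]. }
assert (HS : 0 <= S).
{ assert (H := Phi_sum nil (NoDup_nil _)); rewrite lsum_nil_R in H; exact H. }
exists D, (B * S), (g / 2); split; [lra|split; [apply Rmult_le_pos; trivial|]].
intros h Hh.
assert (Hre : Rabs (Re h) <= Cmod h).
{ eapply Rle_trans; [|apply Rmax_Cmod]; apply Rmax_l. }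
assert (Hzh : - (1 / 8) < Re (z + h)).
{ replace (Re (z + h)) with (Re z + Re h) by reflexivity.
  apply Rabs_le_between in Hre; unfold g in Hh; lra. }
assert (Hsum : is_sum (fun i => zeta_term (z + h) i + (RtoC (-1) * zeta_term z i + - h * dt i))%C
   (zeta (z + h) + (RtoC (-1) * zeta z + - h * D))%C).
{ apply (is_sum_plus I_dec); [apply is_sum_zeta; exact Hzh|].
  apply (is_sum_plus I_dec); apply (is_sum_scal I_dec); [apply is_sum_zeta; exact Hz|exact HD]. }
replace (zeta (z + h) - zeta z - h * D)%C
  with (zeta (z + h) + (RtoC (-1) * zeta z + - h * D))%C by ring.
replace (B * S * Cmod h ^ 2) with ((B * Cmod h ^ 2) * S) by ring.
refine (dominated_sum_le _ _ _ _ _ Hsum).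
{ apply Rmult_le_pos; [exact HB|apply pow2_ge_0]. }
intro i; unfold dt; assert (He := ell_ge0 i).
set (hh := (h * RtoC (- (2 * ell i)))%C).
replace (zeta_term (z + h) i + (RtoC (-1) * zeta_term z i + - h * (zeta_term z i * RtoC (- (2 * ell i)))))%C
  with (zeta_term z i * (cexp hh - 1 - hh))%C.
2:{ rewrite !zeta_term_cexp.
    replace ((RtoC (-3) - 2 * (z + h)) * RtoC (ell i))%C
      with ((RtoC (-3) - 2 * z) * RtoC (ell i) + hh)%C.
    - rewrite cexp_plus; unfold hh; ring.
    - unfold hh; rewrite RtoC_opp, RtoC_mult; ring. }
rewrite Cmod_mult.
assert (Hhh : Cmod hh = 2 * ell i * Cmod h).
{ unfold hh; rewrite Cmod_mult, Cmod_R, Rabs_Ropp, Rabs_pos_eq by lra; ring. }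
assert (Hh0 := Cmod_ge_0 h).
apply Rle_trans with ((K * Phi i * exp (- (2 * g) * ell i)) * (6 * exp (g * ell i) * (2 * ell i * Cmod h) ^ 2)).
- apply Rmult_le_compat; try apply Cmod_ge_0; [apply zeta_term_bound|].
  eapply Rle_trans; [apply cexp_taylor|]; rewrite Hhh.
  apply Rmult_le_compat_r; [apply pow2_ge_0|].
  apply Rmult_le_compat_l; [lra|]; apply exp_le; nra.
- assert (H := t_exp_le (g / 2 * ell i)).
  assert (H0 : 0 <= g / 2 * ell i * exp (- (g / 2 * ell i))).
  { apply Rmult_le_pos; [apply Rmult_le_pos; lra|apply Rlt_le, exp_pos]. }
  set (t := g / 2 * ell i * exp (- (g / 2 * ell i))) in *.
  assert (E1 : exp (- (2 * g) * ell i) * exp (g * ell i)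
    = exp (- (g / 2 * ell i)) * exp (- (g / 2 * ell i))).
  { rewrite <- !exp_plus; f_equal; field. }
  replace (K * Phi i * exp (- (2 * g) * ell i) * (6 * exp (g * ell i) * (2 * ell i * Cmod h) ^ 2))
    with (K * Phi i * Cmod h ^ 2 * (24 * ell i ^ 2 * (exp (- (2 * g) * ell i) * exp (g * ell i)))) by ring.
  rewrite E1.
  replace (24 * ell i ^ 2 * (exp (- (g / 2 * ell i)) * exp (- (g / 2 * ell i))))
    with (96 / g ^ 2 * (t * t)) by (unfold t; field; lra).
  unfold B.
  replace (K * (96 / g ^ 2) * Cmod h ^ 2 * Phi i) with (K * Phi i * Cmod h ^ 2 * (96 / g ^ 2 * 1)) by ring.
  apply Rmult_le_compat_l.
  + apply Rmult_le_pos; [apply Rmult_le_pos; trivial|apply pow2_ge_0].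
  + apply Rmult_le_compat_l; [apply Rlt_le, Rdiv_lt_0_compat; [lra|apply pow_lt; lra]|nra].
Qed.

End Zeta.

(** * The residue *)

Local Notation E := (ent spinor_index_dec).
Local Notation odd_ := (odd_op (clip_op weight) (swap_weight_op swap swap_swap weight)).
Local Notation even_ := (even_op (clip_op weight) (swap_weight_op swap swap_swap weight)).
Local Notation smooth_ := (smooth (clip_op dirac_eigenvalue) (clip_op weight)
    (swap_weight_op swap swap_swap weight)).

(** For x in the domain of D, d_i T_ik x_k = (d_i - d_k) T_ik x_k + T_ik d_k x_k. Summing over k
    shows that D (T x) = S x + T (D x); in particular T x lies in the domain. *)
Lemma commutator_of_entries (T S : bounded_op spinor_index) :
  (forall i k, E S i k = (RtoC (dirac_eigenvalue i - dirac_eigenvalue k) * E T i k)%C) ->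
  is_commutator T S.
Proof.
intros H x y Hxy; exists (plus (S x) (T y)); split.
- intro i.
  apply (is_sum_unique spinor_index_dec) with
    (fun k => RtoC (dirac_eigenvalue i) * (E T i k * coord x k))%C.
  + eapply is_sum_ext; [|apply (is_sum_plus spinor_index_dec);
      apply (is_sum_row spinor_index_dec)].
    intro k; cbv beta; rewrite H, (Hxy k), RtoC_minus; ring.
  + apply (is_sum_scal spinor_index_dec), is_sum_row.
- apply ell2_eq; intro i; simpl; ring.
Qed.

Lemma smooth_commutator_odd (T : bounded_op spinor_index) : smooth_ T ->
  exists S, is_commutator T S /\ odd_ S.
Proof.
intro HT; destruct (smooth_commutator spinor_index_dec swap swap_swap
  dirac_eigenvalue weight weight_swap T HT) as [S [HS H]].
exists S; split; [apply commutator_of_entries; exact H|exact HS].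
Qed.

Lemma odd_product a0 d1 d2 d3 : even_ a0 -> odd_ d1 -> odd_ d2 -> odd_ d3 ->
  odd_ (mul_op a0 (mul_op d1 (mul_op d2 d3))).
Proof.
intros H0 H1 H2 H3; apply (odd_mul_l spinor_index_dec); [exact H0|].
apply (odd_mul_r spinor_index_dec); [exact H1|].
apply (even_mul_odd spinor_index_dec); trivial.
Qed.

(** * The zeta function of an odd operator *)

Section Tau.
Context (T : bounded_op spinor_index) (M : R).
Hypothesis M_ge0 : 0 <= M.
Hypothesis T_anti : forall k, Cmod (E T k k + E T (swap k) (swap k)) * weight k <= M.

(** Averaging over [swap] does not change the trace, and makes it converge
    absolutely beyond the original half-plane. *)
Definition sym_diag (i : spinor_index) : C := (/ 2 * (E T i i + E T (swap i) (swap i)))%C.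
Definition Phi (i : spinor_index) : R := phi3 (coords (proj1_sig i)).
Definition K_sym : R := M * Rpower 2 (11 / 4).

Lemma level_ge1 i : 1 <= level i.
Proof. generalize (proj1 (level_ge i)); lra. Qed.

Lemma level_pos i : 0 < level i.
Proof. generalize (level_ge1 i); lra. Qed.

Lemma Phi_ge0 i : 0 <= Phi i.
Proof. apply Rlt_le, phi3_pos. Qed.

Lemma K_sym_ge0 : 0 <= K_sym.
Proof. apply Rmult_le_pos; [exact M_ge0|apply Rlt_le, exp_pos]. Qed.

Lemma sym_diag_bound i :
  Cmod (sym_diag i) * Rpower (level i) (- (11 / 4)) <= K_sym * Phi i.
Proof.
assert (H := weight_level_phi3 i); fold (Phi i) in H.
rewrite <- Rpower_mult_distr in H by (try apply level_pos; lra).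
set (r := Rpower (level i) (- (11 / 4))) in *.
assert (Hr : r <= Rpower 2 (11 / 4) * (weight i * Phi i)).
{ replace r with (Rpower 2 (11 / 4) * (Rpower 2 (- (11 / 4)) * r)).
  - apply Rmult_le_compat_l; [apply Rlt_le, exp_pos|exact H].
  - rewrite <- Rmult_assoc, <- Rpower_plus, Rplus_opp_r, Rpower_O by lra; ring. }
unfold sym_diag; rewrite Cmod_mult, Cmod_inv, Cmod_R, Rabs_pos_eq
  by (try lra; intro E0; apply RtoC_inj in E0; lra).
assert (HT := T_anti i); set (c := Cmod _) in *.
assert (Hc : 0 <= c) by apply Cmod_ge_0.
assert (HP := Phi_ge0 i); assert (H2 := exp_pos (11 / 4 * ln 2)); fold (Rpower 2 (11 / 4)) in H2.
apply Rle_trans with (c * (Rpower 2 (11 / 4) * (weight i * Phi i))).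
- apply Rmult_le_compat; [lra|apply Rlt_le, exp_pos|lra|exact Hr].
- unfold K_sym.
  replace (c * (Rpower 2 (11 / 4) * (weight i * Phi i)))
    with ((c * weight i) * (Rpower 2 (11 / 4) * Phi i)) by ring.
  rewrite (Rmult_assoc M); apply Rmult_le_compat_r; [apply Rmult_le_pos; lra|exact HT].
Qed.

Lemma level_pow_bound i e : e <= - (15 / 4) ->
  Rpower (level i) e <= Rpower 2 (15 / 4) * Phi i.
Proof.
intro He; assert (H := level_phi3 i); fold (Phi i) in H.
rewrite <- Rpower_mult_distr in H by (try apply level_pos; lra).
apply Rle_trans with (Rpower (level i) (- (15 / 4))).
- unfold Rpower; apply exp_le, Rmult_le_compat_r; [apply ell_ge0; exact level_ge1|exact He].
- replace (Rpower (level i) (- (15 / 4)))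
    with (Rpower 2 (15 / 4) * (Rpower 2 (- (15 / 4)) * Rpower (level i) (- (15 / 4)))).
  + apply Rmult_le_compat_l; [apply Rlt_le, exp_pos|exact H].
  + rewrite <- Rmult_assoc, <- Rpower_plus, Rplus_opp_r, Rpower_O by lra; ring.
Qed.

Lemma cpow_level_le1 w : Re w <= 0 -> forall i, Cmod (cpow (level i) w) <= 1.
Proof.
intros Hw i; rewrite Cmod_cpow; unfold Rpower; rewrite <- exp_0; apply exp_le.
assert (H := ell_ge0 level level_ge1 i); nra.
Qed.

Lemma cpow_half r w : (cpow r (w / 2) * cpow r (w / 2))%C = cpow r w.
Proof.
rewrite !cpow_cexp, <- cexp_plus; f_equal; field.
Qed.

Lemma Re_half w : Re (w / 2)%C = Re w / 2.
Proof. destruct w as [x y]; simpl; field. Qed.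

Local Notation Bs := (basis spinor_index_dec).

(** Trace class means a product of two Hilbert-Schmidt operators: here T |D|^(w/2) and |D|^(w/2),
    the squared Hilbert-Schmidt norm of the latter being the sum of |D|^(Re w) over the basis. *)
Lemma abs_dirac_trace_class w (hw : Re w <= - (15 / 4)) (hw0 : Re w <= 0) :
  trace_class spinor_index_dec
    (mul_op T (diag_op (fun i => cpow (level i) w) 1 (cpow_level_le1 w hw0))).
Proof.
assert (Hh : Re (w / 2)%C <= 0) by (rewrite Re_half; lra).
set (R2 := diag_op (fun i => cpow (level i) (w / 2)%C) 1 (cpow_level_le1 _ Hh)).
assert (HR : forall i, hnorm (R2 (Bs i)) ^ 2 <= Rpower 2 (15 / 4) * Phi i).
{ intro i; unfold R2; rewrite diag_basis, (hnorm_scal spinor_index_dec), hnorm_basis, Rmult_1_r.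
  replace (Cmod (cpow (level i) (w / 2)) ^ 2) with (Cmod (cpow (level i) w)).
  - rewrite Cmod_cpow; apply level_pow_bound; exact hw.
  - rewrite <- cpow_half, Cmod_mult; ring. }
assert (Hc : 0 <= Rpower 2 (15 / 4)) by apply Rlt_le, exp_pos.
assert (HS : forall c (l : list spinor_index), 0 <= c -> NoDup l ->
  lsum (fun i => c * (Rpower 2 (15 / 4) * Phi i)) l <= c * (Rpower 2 (15 / 4) * 250)).
{ intros c l H0 Hl; rewrite lsum_scal_R, lsum_scal_R; apply Rmult_le_compat_l; [exact H0|].
  apply Rmult_le_compat_l; [exact Hc|apply phi3_sum; exact Hl]. }
destruct (op_bounded_pos T) as [B [HB0 HB]].
exists (mul_op T R2), R2; split; [|split].
- exists (B ^ 2 * (Rpower 2 (15 / 4) * 250)); intros l Hl.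
  eapply Rle_trans; [|apply HS; [apply pow2_ge_0|exact Hl]].
  apply lsum_le; intros i _; change (hnorm (T (R2 (Bs i))) ^ 2 <= B ^ 2 * (Rpower 2 (15 / 4) * Phi i)).
  apply Rle_trans with ((B * hnorm (R2 (Bs i))) ^ 2).
  + apply pow_incr; split; [apply hnorm_ge0|apply HB].
  + rewrite Rpow_mult_distr; apply Rmult_le_compat_l; [apply pow2_ge_0|apply HR].
- exists (1 * (Rpower 2 (15 / 4) * 250)); intros l Hl.
  eapply Rle_trans; [|apply HS; [lra|exact Hl]].
  apply lsum_le; intros i _; rewrite Rmult_1_l; exact (HR i).
- apply op_ext; intro x.
  change (T (diag_op (fun i => cpow (level i) w) 1 (cpow_level_le1 w hw0) x) = T (R2 (R2 x))).
  f_equal; apply ell2_eq; intro i; unfold R2; rewrite !coord_diag, Cmult_assoc, cpow_half.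
  reflexivity.
Qed.

Definition tau_zeta : C -> C := zeta sym_diag level.

Lemma zeta_is_trace z : 1 < Re z ->
  exists X, is_mul_abs_dirac_pow T (RtoC (-3) - 2 * z)%C X /\ is_trace spinor_index_dec X (tau_zeta z).
Proof.
intro Hz; set (w := (RtoC (-3) - 2 * z)%C).
assert (Hw : Re w = -3 - 2 * Re z) by (destruct z as [x y]; simpl; ring).
assert (hw0 : Re w <= 0) by lra; assert (hw : Re w <= - (15 / 4)) by lra.
exists (mul_op T (diag_op (fun i => cpow (level i) w) 1 (cpow_level_le1 w hw0))); split.
- intros x y Hxy.
  change (T (diag_op (fun i => cpow (level i) w) 1 (cpow_level_le1 w hw0) x) = T y).
  f_equal; apply ell2_eq; intro i; rewrite coord_diag; symmetry; exact (Hxy i).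
- split; [apply abs_dirac_trace_class; exact hw|].
  set (f := fun i => (E T i i * cpow (level i) w)%C).
  apply is_sum_ext with f.
  { intro i; change (basis_vector spinor_index_dec i) with (Bs i); rewrite inner_basis_l.
    unfold f; rewrite <- (ent_diag_r spinor_index_dec _ _ (cpow_level_le1 w hw0)); reflexivity. }
  destruct (op_bounded_pos T) as [B [HB0 HB]].
  destruct (dominated_summable spinor_index_dec Phi 250 phi3_sum f (B * Rpower 2 (15 / 4))) as [s Hs].
  { apply Rmult_le_pos; [exact HB0|apply Rlt_le, exp_pos]. }
  { intro i; unfold f; rewrite Cmod_mult, Rmult_assoc; apply Rmult_le_compat; try apply Cmod_ge_0.
    - apply ent_le; exact HB.
    - rewrite Cmod_cpow; apply level_pow_bound; exact hw. }
  replace (tau_zeta z) with s; [exact Hs|].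
  symmetry; apply (is_sum_Csum spinor_index_dec).
  (* Reindexing by [swap] preserves both the sum and the level, so the averaged series defining
     [tau_zeta] has the same sum [s]. *)
  assert (Hss := is_sum_involution spinor_index_dec swap f s swap_swap Hs).
  assert (Hsum := is_sum_scal spinor_index_dec (/ 2)%C _ _ (is_sum_plus spinor_index_dec _ _ _ _ Hs Hss)).
  replace (/ 2 * (s + s))%C with s in Hsum.
  + eapply is_sum_ext; [|exact Hsum]; intro i; unfold zeta_term, sym_diag, f; fold w.
    rewrite level_swap; ring.
  + field.
Qed.

Lemma tau_zeta_quad_diff z : - (1 / 8) < Re z -> quad_diff tau_zeta z.
Proof.
apply (zeta_quad_diff spinor_index_dec sym_diag level Phi 250 K_sym).
- exact level_ge1.
- exact K_sym_ge0.
- exact Phi_ge0.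
- exact phi3_sum.
- exact sym_diag_bound.
Qed.

Lemma locally_half_plane z0 : - (1 / 8) < Re z0 ->
  @locally C_UniformSpace z0 (fun z => - (1 / 8) < Re z).
Proof.
intro Hz; assert (Hr : 0 < (Re z0 + 1 / 8) / 2) by lra.
exists (mkposreal _ Hr); intros y Hy; apply Cmod_ball in Hy; simpl in Hy.
assert (H : Rabs (Re (y - z0)%C) <= Cmod (y - z0)%C).
{ eapply Rle_trans; [|apply Rmax_Cmod]; apply Rmax_l. }
replace (Re (y - z0)%C) with (Re y - Re z0) in H by reflexivity.
assert (H' := Rle_lt_trans _ _ _ H Hy); apply Rabs_def2 in H'; lra.
Qed.

Lemma tau_zero k : (k <= 1)%nat -> is_tau k T (RtoC (-3)) (RtoC 0).
Proof.
intro Hk; exists (1 / 8), 1, tau_zeta; split; [lra|split; [|split]].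
- intros z0 Hz0; exists 0%nat, tau_zeta; split.
  + eapply filter_imp; [|apply (locally_half_plane z0 Hz0)].
    intros z Hz; apply quad_diff_holomorphic, tau_zeta_quad_diff; exact Hz.
  + apply filter_forall; intro z; simpl; ring.
- exact zeta_is_trace.
(* [sum_n] at 0 still contains the term m = 0, so the principal part is c_0 / z; its coefficient is
   taken to be zero and the whole function is the holomorphic part. *)
- exists 0%nat, (fun _ => RtoC 0), (fun z => z ^ k * tau_zeta z)%C; split; [|split].
  + eapply filter_imp; [|apply (locally_half_plane (RtoC 0)); simpl; lra].
    intros z Hz; apply quad_diff_holomorphic.
    destruct k as [|[|k]]; [| |lia].
    * replace (fun z => z ^ 0 * tau_zeta z)%C with tau_zeta.
      -- apply tau_zeta_quad_diff; exact Hz.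
      -- apply functional_extensionality; intro; simpl; ring.
    * replace (fun z => z ^ 1 * tau_zeta z)%C with (fun z => z * tau_zeta z)%C.
      -- apply quad_diff_mul_id, tau_zeta_quad_diff; exact Hz.
      -- apply functional_extensionality; intro; simpl; ring.
  + apply filter_forall; intro z; rewrite sum_O; unfold Cdiv; ring.
  + reflexivity.
Qed.

End Tau.

Theorem corollary7p2 (q : R) (hq : 0 < q < 1) (a b : bounded_op spinor_index)
  (ha : acts_as_a q a) (hb : acts_as_b q b)
  (a0 a1 a2 a3 : bounded_op spinor_index)
  (h0 : pre_Cstar_generated a b a0) (h1 : pre_Cstar_generated a b a1)
  (h2 : pre_Cstar_generated a b a2) (h3 : pre_Cstar_generated a b a3) :
  is_phi3 a0 a1 a2 a3 (RtoC 0).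
Proof.
assert (S0 := smooth_even _ _ _ _ (generated_smooth q hq a b a0 ha hb h0)).
destruct (smooth_commutator_odd a1 (generated_smooth q hq a b a1 ha hb h1)) as [d1 [C1 O1]].
destruct (smooth_commutator_odd a2 (generated_smooth q hq a b a2 ha hb h2)) as [d2 [C2 O2]].
destruct (smooth_commutator_odd a3 (generated_smooth q hq a b a3 ha hb h3)) as [d3 [C3 O3]].
destruct (odd_diagonal spinor_index_dec swap swap_swap weight weight_swap weight_ge0 _
  (odd_product a0 d1 d2 d3 S0 O1 O2 O3)) as [M [HM0 HM]].
exists d1, d2, d3, (RtoC 0), (RtoC 0).
repeat split; trivial; try (apply (tau_zero _ M HM0 HM); lia).
ring.
Qed.
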